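(* Let $z^*=(x^*,u^*,\lambda^* )$ be a KKT point of the optimal control problem (OCP) described in the context that satisfies LICQ and SOSC, and let $w^*=(x^*,u^* )$, $y^*=(x^*,x^*,u^* )$. Then the asymptotic linear contraction rate of the generalized Gauss-Newton (GGN) multiple shooting iteration $w^+=\Pi_{\mathrm{MS}}(w)$ at $w^*$, that of the GGN single shooting iteration $y^+=\hat\Pi_{\mathrm{SS}}(y)$ at $y^*$, and that of the GGN differential dynamic programming iteration $w^+=\Pi_{\mathrm{DDP}}(w)$ at $w^*$ are all equal, and their common value is the smallest $\kappa\in\mathbb{R}$ satisfying $$-\kappa\,\tilde M(z^* )\preceq \tilde E(z^* )\preceq \kappa\,\tilde M(z^* ),$$ where $\tilde M(z^* )=Z^\top M(z^* )Z$, $\tilde E(z^* )=Z^\top E(z^* )Z$, the columns of $Z$ form a basis of the null space of the Jacobian $\frac{\partial F}{\partial w}(x^*,u^* )$, $M(z^* )=\nabla_w^2 V(w^* )$ is the GGN Hessian, and $E(z^* )=\nabla_w^2\big((\lambda^* )^\top F(x,u)\big)\big|_{(x,u)=(x^*,u^* )}$ is its deviation from the exact Hessian of the Lagrangian.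
   Context: OCP. Let $N\ge 1$, $x=(x_0,\dots,x_N)$ with $x_i\in\mathbb{R}^{n_x}$, $u=(u_0,\dots,u_{N-1})$ with $u_i\in\mathbb{R}^{n_u}$, $w=(x,u)$, and let $\bar{\bar x}_0\in\mathbb{R}^{n_x}$ be given. Minimize $V(w)=\sum_{i=0}^{N-1} l_i(x_i,u_i)+l_N(x_N)$ over $w$ subject to $x_0=\bar{\bar x}_0$ and $x_{i+1}=f_i(x_i,u_i)$, $i=0,\dots,N-1$. The functions $l_i$ and $l_N$ are convex. The constraints are written $F(x,u)=0$, where $F(x,u)$ stacks $\bar{\bar x}_0-x_0$ and $f_i(x_i,u_i)-x_{i+1}$, $i=0,\dots,N-1$. The Lagrangian is $V(w)+\lambda^\top F(w)$. A KKT point $(w^*,\lambda^* )$ satisfies $F(w^* )=0$ and $\nabla V(w^* )+\frac{\partial F}{\partial w}(w^* )^\top\lambda^*=0$. LICQ: $\frac{\partial F}{\partial w}(w^* )$ has full row rank. SOSC: the Hessian in $w$ of the Lagrangian at $(w^*,\lambda^* )$ is positive definite on the null space of $\frac{\partial F}{\partial w}(w^* )$. Linearization at $\bar w=(\bar x,\bar u)$. For $i=0,\dots,N-1$: $A_i=\frac{\partial f_i}{\partial x_i}(\bar x_i,\bar u_i)$, $B_i=\frac{\partial f_i}{\partial u_i}(\bar x_i,\bar u_i)$, $\bar f_i=f_i(\bar x_i,\bar u_i)$, $a_i=\bar f_i-A_i\bar x_i-B_i\bar u_i$; GGN Hessian blocks $\begin{bmatrix}Q_i&S_i^\top\\S_i&R_i\end{bmatrix}=\nabla^2_{(x_i,u_i)}l_i(\bar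 x_i,\bar u_i)$; $q_i=\nabla_{x_i}l_i(\bar x_i,\bar u_i)-Q_i\bar x_i-S_i^\top\bar u_i$, $r_i=\nabla_{u_i}l_i(\bar x_i,\bar u_i)-S_i\bar x_i-R_i\bar u_i$; $P_N=\nabla^2 l_N(\bar x_N)$, $p_N=\nabla l_N(\bar x_N)-P_N\bar x_N$. Riccati recursion, for $i=N-1,\dots,0$: $K_i=-(R_i+B_i^\top P_{i+1}B_i)^{-1}(S_i+B_i^\top P_{i+1}A_i)$; $\kappa_i^{0}=-(R_i+B_i^\top P_{i+1}B_i)^{-1}\big(r_i+B_i^\top(P_{i+1}a_i+p_{i+1})\big)$; $P_i=Q_i+A_i^\top P_{i+1}A_i+(S_i^\top+A_i^\top P_{i+1}B_i)K_i$; $p_i=q_i+A_i^\top(P_{i+1}a_i+p_{i+1})+K_i^\top\big(r_i+B_i^\top(P_{i+1}a_i+p_{i+1})\big)$. The resulting affine feedback law of the quadratic subproblem is $u_i=\kappa_i^0+K_ix_i$; it is written relative to the linearization point as $u_i=\bar u_i+k_i+K_i(x_i-\bar x_i)$, i.e. $k_i=\kappa^0_i+K_i\bar x_i-\bar u_i$. The $K_i,k_i$ depend on $\bar w$ only. Residual blocks. $\hat F(x,u;\bar w)$ stacks $\bar{\bar x}_0-x_0$ and $\bar f_i+A_i(x_i-\bar x_i)+B_i(u_i-\bar u_i)-x_{i+1}$, $i=0,\dots,N-1$. $G(x,u;\bar w)$ stacks $\bar u_i+k_i(\bar w)+K_i(\bar w)(x_i-\bar x_i)-u_i$, $i=0,\dots,N-1$.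 Iterations. $\Pi_{\mathrm{MS}}(\bar w)$ is the solution $w=(x,u)$ of $R_{\mathrm{MS}}(w;\bar w)=(\hat F(x,u;\bar w),G(x,u;\bar w))=0$. $\Pi_{\mathrm{DDP}}(\bar w)$ is the solution $w=(x,u)$ of $R_{\mathrm{DDP}}(w;\bar w)=(F(x,u),G(x,u;\bar w))=0$. With $y=(x,\hat x,u)$ and $\bar y=(\bar x,\bar{\hat x},\bar u)$, $\bar w=(\bar x,\bar u)$, $\hat\Pi_{\mathrm{SS}}(\bar y)$ is the solution $y$ of $\hat R_{\mathrm{SS}}(y;\bar y)=(F(x,u),\hat F(\hat x,u;\bar w),G(\hat x,u;\bar w))=0$. Asymptotic linear contraction rate. For an iteration $z^+=\Pi(z)$ given by $R(\Pi(\bar z);\bar z)=0$ with fixed point $z^*$, it is the spectral radius $\rho(J(z^* ))$ of $J(z^* )=-\big(\frac{\partial R}{\partial z}(z^*;z^* )\big)^{-1}\frac{\partial R}{\partial\bar z}(z^*;z^* )$, which is the derivative of $\Pi$ at $z^*$. Standing assumptions. The matrices inverted in the Riccati recursion are invertible at $\bar w=w^*$ (hence nearby), so that the iterations are well defined near $w^*$; the functions $f_i,l_i,l_N$ are smooth enough that the residual maps are twice continuously differentiable near the fixed point. *)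

(* Defs.v *)
From HB Require Import structures.
From mathcomp Require Import all_boot all_order all_algebra.
From mathcomp Require Import complex.
From mathcomp Require Import all_classical all_reals all_analysis.

Set Implicit Arguments.
Unset Strict Implicit.
Unset Printing Implicit Defensive.

Import Order.TTheory GRing.Theory Num.Theory.
Import numFieldNormedType.Exports.

Local Open Scope classical_set_scope.
Local Open Scope ring_scope.

Section calculus.
Variable R : realType.

(* The library's 'J is stated for row vectors and is the transpose of the usual
   Jacobian matrix; here vectors are columns and (jac f p) i j = d f_i / d x_j. *)
Definition jac n m (f : 'cV[R]_n -> 'cV[R]_m) (p : 'cV[R]_n) : 'M[R]_(m, n) :=
  \matrix_(i, j) ('d f p (delta_mx j 0)) i 0.

Definition grad n (g : 'cV[R]_n -> R) (p : 'cV[R]_n) : 'cV[R]_n :=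
  \col_i 'd g p (delta_mx i 0).

Definition hess n (g : 'cV[R]_n -> R) (p : 'cV[R]_n) : 'M[R]_n :=
  jac (grad g) p.

Definition C2_near (V W : normedModType R) (f : V -> W) (p : V) : Prop :=
  \forall q \near p, differentiable f q /\
    forall v, differentiable ('D_v f) q /\
      forall u, {for q, continuous ('D_u ('D_v f))}.

Definition on_stack a b (T : Type) (g : 'cV[R]_a -> 'cV[R]_b -> T)
  (v : 'cV[R]_(a + b)) : T := g (usubmx v) (dsubmx v).

End calculus.

Section linear_algebra.
Variable R : realType.

Definition qform n (A : 'M[R]_n) (v : 'cV[R]_n) : R := (v^T *m A *m v) 0 0.

Definition loewner_le n (A B : 'M[R]_n) : Prop :=
  (B - A)^T = B - A /\ forall v : 'cV[R]_n, 0 <= qform (B - A) v.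

(* kermx is the row kernel, so the null space of A is the row space of
   kermx A^T. *)
Definition null_space_basis m n d (A : 'M[R]_(m, n)) (Z : 'M[R]_(n, d)) : bool :=
  row_free Z^T && (Z^T == kermx A^T)%MS.

Definition spectral_radius n (A : 'M[R]_n) : R :=
  sup [set ComplexField.Normc.normc c | c in
    [set c : R[i] | eigenvalue (map_mx (real_complex R) A) c]].

End linear_algebra.

Section iterations.
Variables (R : realType) (n : nat).
Implicit Types (Rs : 'cV[R]_n -> 'cV[R]_n -> 'cV[R]_n).

(* A residual map is applied to the unknown z first and to the linearization
   point zb second. *)
Definition solution_map Rs (zb : 'cV[R]_n) : 'cV[R]_n :=
  get [set z | Rs z zb = 0].

Definition rate_matrix Rs (z : 'cV[R]_n) : 'M[R]_n :=
  - (invmx (jac (Rs ^~ z) z) *m jac (Rs z) z).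

Definition contraction_rate Rs (z : 'cV[R]_n) : R :=
  spectral_radius (rate_matrix Rs z).

(* [get] and [invmx] are total; this says that near z the map Pi is really given
   by "Pi zb is the solution of Rs (Pi zb) zb = 0", that z is a fixed point, and
   that the inverse in [rate_matrix] is a genuine one. *)
Definition well_defined_at Rs (Pi : 'cV[R]_n -> 'cV[R]_n) (z : 'cV[R]_n) : Prop :=
  [/\ Pi z = z,
      \forall zb \near z, forall y, Rs y zb = 0 <-> y = Pi zb &
      jac (Rs ^~ z) z \in unitmx].

End iterations.

(* xinit is the given initial state, fcost the terminal cost l_N. *)
Record ocp (R : realType) (N nx nu : nat) := Ocp {
  xinit : 'cV[R]_nx;
  dyn : 'I_N -> 'cV[R]_nx -> 'cV[R]_nu -> 'cV[R]_nx;
  cost : 'I_N -> 'cV[R]_nx -> 'cV[R]_nu -> R;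
  fcost : 'cV[R]_nx -> R
}.

Section trajectories.
Variables (R : realType) (N nx nu : nat).

(* x = (x_0, ..., x_N) and u = (u_0, ..., u_(N-1)) are stacked block columns,
   w = (x, u) and y = (x, xh, u). *)
Notation xvec := 'cV[R]_(\sum_(i < N.+1) nx).
Notation uvec := 'cV[R]_(\sum_(i < N) nu).
Notation wvec := 'cV[R]_(\sum_(i < N.+1) nx + \sum_(i < N) nu).
Notation yvec := 'cV[R]_(\sum_(i < N.+1) nx +
                         (\sum_(i < N.+1) nx + \sum_(i < N) nu)).

Definition st (w : wvec) (i : 'I_N.+1) : 'cV[R]_nx :=
  @submxcol R N.+1 (fun=> nx) 1 (usubmx w) i.
Definition ct (w : wvec) (i : 'I_N) : 'cV[R]_nu :=
  @submxcol R N (fun=> nu) 1 (dsubmx w) i.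

(* States are indexed by 'I_N.+1, stages by 'I_N: cur i is i, nxt i is i + 1. *)
Definition cur (i : 'I_N) : 'I_N.+1 := widen_ord (leqnSn N) i.
Definition nxt (i : 'I_N) : 'I_N.+1 := lift ord0 i.

(* Block 0 is [b0], block i + 1 is [b i]. *)
Definition stack_cons (b0 : 'cV[R]_nx) (b : 'I_N -> 'cV[R]_nx) : xvec :=
  @mxcol R N.+1 (fun=> nx) 1 (fun i => oapp b b0 (unlift ord0 i)).

Definition y_x (y : yvec) : xvec := usubmx y.
Definition y_xh (y : yvec) : xvec := usubmx (dsubmx y).
Definition y_u (y : yvec) : uvec := dsubmx (dsubmx y).

Variable P : ocp R N nx nu.

Definition V (w : wvec) : R :=
  \sum_(i < N) cost P i (st w (cur i)) (ct w i) + fcost P (st w ord_max).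

Definition F (w : wvec) : xvec :=
  stack_cons (xinit P - st w ord0)
             (fun i => dyn P i (st w (cur i)) (ct w i) - st w (nxt i)).

Definition constraint_term (lam : xvec) (w : wvec) : R := (lam^T *m F w) 0 0.

Definition lagrangian (lam : xvec) (w : wvec) : R := V w + constraint_term lam w.

Definition KKT (w : wvec) (lam : xvec) : Prop :=
  F w = 0 /\ grad V w + (jac F w)^T *m lam = 0.

Definition LICQ (w : wvec) : bool := row_free (jac F w).

Definition SOSC (w : wvec) (lam : xvec) : Prop :=
  forall v : wvec, jac F w *m v = 0 -> v != 0 ->
    0 < qform (hess (lagrangian lam) w) v.

Definition convex_costs : Prop :=
  (forall i, convex_function setT (on_stack (cost P i))) /\
  convex_function setT (fcost P).

(* C2 data give the gradients and Hessians their meaning.  The gains K_i, k_i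
   involve second derivatives of the costs, so the regularity of the residual
   maps is a separate requirement, [smooth_residuals]. *)
Definition smooth_data (w : wvec) : Prop :=
  [/\ forall i, C2_near (on_stack (dyn P i)) (col_mx (st w (cur i)) (ct w i)),
      forall i, C2_near (on_stack (cost P i)) (col_mx (st w (cur i)) (ct w i)) &
      C2_near (fcost P) (st w ord_max)].

Section linearization.
Variable wb : wvec.

Section stage.
Variable i : 'I_N.
Notation xb := (st wb (cur i)).
Notation ub := (ct wb i).

Definition lin_A : 'M[R]_nx := jac (dyn P i ^~ ub) xb.
Definition lin_B : 'M[R]_(nx, nu) := jac (dyn P i xb) ub.
Definition lin_f : 'cV[R]_nx := dyn P i xb ub.
Definition lin_a : 'cV[R]_nx := lin_f - lin_A *m xb - lin_B *m ub.

Definition stage_hess : 'M[R]_(nx + nu) :=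
  hess (on_stack (cost P i)) (col_mx xb ub).
Definition hess_Q : 'M[R]_nx := ulsubmx stage_hess.
Definition hess_S : 'M[R]_(nu, nx) := dlsubmx stage_hess.
Definition hess_R : 'M[R]_nu := drsubmx stage_hess.

Definition grad_q : 'cV[R]_nx :=
  grad (cost P i ^~ ub) xb - hess_Q *m xb - hess_S^T *m ub.
Definition grad_r : 'cV[R]_nu :=
  grad (cost P i xb) ub - hess_S *m xb - hess_R *m ub.

(* The quantities below take (P_(i+1), p_(i+1)) as argument [Pp]. *)
Implicit Type Pp : 'M[R]_nx * 'cV[R]_nx.

Definition ric_H Pp : 'M[R]_nu := hess_R + lin_B^T *m Pp.1 *m lin_B.
Definition ric_g Pp : 'cV[R]_nu := grad_r + lin_B^T *m (Pp.1 *m lin_a + Pp.2).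
Definition ric_K Pp : 'M[R]_(nu, nx) :=
  - (invmx (ric_H Pp) *m (hess_S + lin_B^T *m Pp.1 *m lin_A)).
Definition ric_kappa Pp : 'cV[R]_nu := - (invmx (ric_H Pp) *m ric_g Pp).
Definition ric_step Pp : 'M[R]_nx * 'cV[R]_nx :=
  (hess_Q + lin_A^T *m Pp.1 *m lin_A
     + (hess_S^T + lin_A^T *m Pp.1 *m lin_B) *m ric_K Pp,
   grad_q + lin_A^T *m (Pp.1 *m lin_a + Pp.2) + (ric_K Pp)^T *m ric_g Pp).

End stage.

Definition term_P : 'M[R]_nx := hess (fcost P) (st wb ord_max).
Definition term_p : 'cV[R]_nx :=
  grad (fcost P) (st wb ord_max) - term_P *m st wb ord_max.

(* (P_i, p_i) for 0 <= i <= N: the steps N - 1, ..., i applied to (P_N, p_N). *)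
Definition ric (i : nat) : 'M[R]_nx * 'cV[R]_nx :=
  foldr ric_step (term_P, term_p) (drop i (enum 'I_N)).

Lemma ricN : ric N = (term_P, term_p).
Proof. by rewrite /ric drop_oversize // size_enum_ord. Qed.

Lemma ricE (i : 'I_N) : ric i = ric_step i (ric i.+1).
Proof.
rewrite /ric (drop_nth i) ?size_enum_ord ?ltn_ord //=.
by rewrite (_ : nth i (enum 'I_N) i = i) //; apply: val_inj; rewrite /= nth_enum_ord.
Qed.

Definition fb_K (i : 'I_N) : 'M[R]_(nu, nx) := ric_K i (ric i.+1).
Definition fb_kappa0 (i : 'I_N) : 'cV[R]_nu := ric_kappa i (ric i.+1).
Definition fb_k (i : 'I_N) : 'cV[R]_nu :=
  fb_kappa0 i + fb_K i *m st wb (cur i) - ct wb i.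

Definition riccati_regular : Prop :=
  forall i : 'I_N, ric_H i (ric i.+1) \in unitmx.

Definition Fhat (w : wvec) : xvec :=
  stack_cons (xinit P - st w ord0)
    (fun i => lin_f i + lin_A i *m (st w (cur i) - st wb (cur i))
              + lin_B i *m (ct w i - ct wb i) - st w (nxt i)).

Definition G (w : wvec) : uvec :=
  @mxcol R N (fun=> nu) 1
    (fun i => ct wb i + fb_k i + fb_K i *m (st w (cur i) - st wb (cur i)) - ct w i).

End linearization.

Definition R_MS (w wb : wvec) : wvec := col_mx (Fhat wb w) (G wb w).

Definition R_DDP (w wb : wvec) : wvec := col_mx (F w) (G wb w).

Definition R_SS (y yb : yvec) : yvec :=
  let wb := col_mx (y_x yb) (y_u yb) in
  let w := col_mx (y_x y) (y_u y) in
  let wh := col_mx (y_xh y) (y_u y) in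
  col_mx (F w) (col_mx (Fhat wb wh) (G wb wh)).

Definition Pi_MS : wvec -> wvec := solution_map R_MS.
Definition Pi_DDP : wvec -> wvec := solution_map R_DDP.
Definition Pi_SS : yvec -> yvec := solution_map R_SS.

Definition smooth_residuals (w : wvec) (y : yvec) : Prop :=
  [/\ C2_near (fun z : wvec * wvec => R_MS z.1 z.2) (w, w),
      C2_near (fun z : wvec * wvec => R_DDP z.1 z.2) (w, w) &
      C2_near (fun z : yvec * yvec => R_SS z.1 z.2) (y, y)].

End trajectories.

Definition loewner_bounds (R : realType) d (Mt Et : 'M[R]_d) : set R :=
  [set k | loewner_le (- (k *: Mt)) Et /\ loewner_le Et (k *: Mt)].

(* Main.v *)
(** Fix a base point wb and a trajectory w. Let e_i and d_i be the defects of w in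
    the dynamics linearized at wb and in the Riccati feedback law at wb, and set
    lam_k = P_k x_k + p_k. Substituting the Riccati recursion stage by stage shows
    that, for every direction v,
      DV(wb) v + D^2V(wb)(v, w - wb) + lam . DF(wb) v
    is a sum of terms that are linear in the e_i and d_i.

    For w = wb = w*, this identity and the KKT conditions force d = 0 and
    lam = lam*, so that w* is a fixed point. For wb = w* it also writes D^2V on the
    null space of DF as a sum of squares weighted by the invertible matrices
    R_i + B_i^T P_(i+1) B_i, whence Z^T M Z is positive definite when the costs are
    convex. For wb = w* + t h and w = w* + t J h, where J is the rate matrix of
    multiple shooting, the defects are o(t); division by t gives
    Z^T (M J + E) h = 0. The gains, which contain second derivatives of the costs,
    need not be differentiated. Since DF J = 0 at w*, it follows that
    J = - Z (Z^T M Z)^-1 Z^T E, and the nonzero eigenvalues of J are those of a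
    symmetric pencil. They are real, and their largest modulus is the maximum of
    |g^T Z^T E Z g| / (g^T Z^T M Z g), which is the smallest kappa.

    The linearized dynamics are stationary in the base point at w*, so that DDP has
    the same rate matrix J. Single shooting has the rate matrix T J S, where
    S (x, xh, u) = (x, u) and T (x, u) = (x, x, u); as S T = 1, it has the same
    nonzero eigenvalues. *)

From HB Require Import structures.
Require Import Defs.
From mathcomp Require Import all_boot all_order all_algebra.
From mathcomp Require Import complex ring lra.
From mathcomp Require Import all_classical all_reals all_analysis.

Set Implicit Arguments.
Unset Strict Implicit.
Unset Printing Implicit Defensive.

Import Order.TTheory GRing.Theory Num.Theory.
Import numFieldNormedType.Exports.
Local Open Scope classical_set_scope.
Local Open Scope ring_scope.

(** At a fixed base point, [lin_dyn] and [lin_fb] together form a bijective linear map on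
    directions, because a closed-loop trajectory is determined by forward simulation. A test
    direction can therefore be prescribed through its two residuals. Zero dynamics residual and
    feedback residuals H_i d_i, with H_i = R_i + B_i^T P_(i+1) B_i, turn the identity at the KKT
    point into a sum of the |H_i d_i|^2, so that invertibility of the H_i does the work of
    definiteness. The same choice shows that the Hessian of V is nondegenerate on the null space,
    and convexity upgrades this to positive definiteness.

    The defects are o(t) because the multiple shooting residual is jointly differentiable in unknown
    and base point: the equation that defines J says that its derivative in the direction (J h, h)
    is zero. All other factors of the identity need only converge. The costate converges to the KKT
    multiplier, and this is how E enters the limit. *)

(** * Limits of matrix-valued functions *)

Section matrix_continuity.
Variable R : realType.

Lemma cvg_sumr (T I : Type) (F : set_system T) {FF : Filter F}
    (V : normedModType R) (r : seq I) (Q : pred I) (f : I -> T -> V) (l : I -> V) :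
  (forall i, f i @ F --> l i) ->
  (fun t => \sum_(i <- r | Q i) f i t) @ F --> \sum_(i <- r | Q i) l i.
Proof.
move=> fl; elim: r => [|i r IH].
  rewrite big_nil; under eq_fun do rewrite big_nil; exact: cvg_cst.
rewrite big_cons; under eq_fun do rewrite big_cons.
by case: ifP => // _; apply: cvgD.
Qed.

Lemma cvg_prodr (T I : Type) (F : set_system T) {FF : Filter F}
    (r : seq I) (f : I -> T -> R) (l : I -> R) :
  (forall i, f i @ F --> l i) ->
  (fun t => \prod_(i <- r) f i t) @ F --> \prod_(i <- r) l i.
Proof.
move=> fl; elim: r => [|i r IH].
  rewrite big_nil; under eq_fun do rewrite big_nil; exact: cvg_cst.
by rewrite big_cons; under eq_fun do rewrite big_cons; apply: cvgM.
Qed.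

Lemma mx_linear_continuous m n (W : normedModType R)
    (f : {linear 'M[R]_(m, n) -> W}) : continuous f.
Proof.
move=> x.
have -> : (f : _ -> W) = fun y => \sum_i \sum_j y i j *: f (delta_mx i j).
  apply/funext => y; rewrite [in LHS](matrix_sum_delta y) linear_sum /=.
  by apply: eq_bigr => i _; rewrite linear_sum; apply: eq_bigr => j _; rewrite linearZ.
apply: (cvg_sumr (F := nbhs x)) => i; apply: (cvg_sumr (F := nbhs x)) => j.
by apply: cvgZr_tmp; exact: coord_continuous.
Qed.

Lemma mx_cvgP (T : Type) (F : set_system T) {FF : Filter F} m n
    (f : T -> 'M[R]_(m, n)) (l : 'M[R]_(m, n)) :
  (forall i j, (fun t => f t i j) @ F --> l i j) -> f @ F --> l.
Proof.
move=> h; have -> : f = fun t => \sum_i \sum_j f t i j *: delta_mx i j.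
  by apply/funext => t; exact: matrix_sum_delta.
rewrite (matrix_sum_delta l); apply: cvg_sumr => i; apply: cvg_sumr => j.
by apply: cvgZr_tmp; exact: h.
Qed.

Lemma mx_cvg_entry (T : Type) (F : set_system T) {FF : Filter F} m n
    (f : T -> 'M[R]_(m, n)) (l : 'M[R]_(m, n)) i j :
  f @ F --> l -> (fun t => f t i j) @ F --> l i j.
Proof. by move=> h; exact: (cvg_comp f (fun M : 'M[R]_(m, n) => M i j) h (@coord_continuous _ _ _ i j l)). Qed.

Lemma cvg_mulmx (T : Type) (F : set_system T) {FF : Filter F} m n p
    (f : T -> 'M[R]_(m, n)) (g : T -> 'M[R]_(n, p)) (a : 'M[R]_(m, n)) (b : 'M[R]_(n, p)) :
  f @ F --> a -> g @ F --> b -> (fun t => f t *m g t) @ F --> a *m b.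
Proof.
move=> fa gb; apply: mx_cvgP => i j; rewrite mxE.
under eq_fun do rewrite mxE.
by apply: cvg_sumr => k; apply: cvgM; exact: mx_cvg_entry.
Qed.

Lemma cvg_trmx (T : Type) (F : set_system T) {FF : Filter F} m n
    (f : T -> 'M[R]_(m, n)) (a : 'M[R]_(m, n)) :
  f @ F --> a -> (fun t => (f t)^T) @ F --> a^T.
Proof.
move=> fa; apply: mx_cvgP => i j; rewrite mxE.
by under eq_fun do rewrite mxE; exact: mx_cvg_entry.
Qed.

Lemma cvg_det (T : Type) (F : set_system T) {FF : Filter F} n
    (f : T -> 'M[R]_n) (a : 'M[R]_n) :
  f @ F --> a -> (fun t => \det (f t)) @ F --> \det a.
Proof.
move=> fa; apply: cvg_sumr => s; apply: cvgM; first exact: cvg_cst.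
by apply: cvg_prodr => i; exact: mx_cvg_entry.
Qed.

Lemma near_unitmx (T : Type) (F : set_system T) {FF : Filter F} n
    (f : T -> 'M[R]_n) (a : 'M[R]_n) :
  f @ F --> a -> a \in unitmx -> \forall t \near F, f t \in unitmx.
Proof.
move=> fa ua; have da : \det a != 0 by rewrite -unitfE -unitmxE.
have fda : (fun t => \det (f t)) @ F --> \det a by exact: cvg_det.
near=> t; rewrite unitmxE unitfE; near: t.
exact: cvgr_neq0 _ fda da.
Unshelve. all: by end_near. Qed.

(** The adjugate formula for [invmx] is valid only on invertible matrices, so [f t] must first be
    known invertible along the filter. *)
Lemma cvg_invmx (T : Type) (F : set_system T) {FF : Filter F} n
    (f : T -> 'M[R]_n) (a : 'M[R]_n) :
  f @ F --> a -> a \in unitmx -> (fun t => invmx (f t)) @ F --> invmx a.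
Proof.
move=> fa ua.
have da : \det a != 0 by rewrite -unitfE -unitmxE.
have fda : (fun t => \det (f t)) @ F --> \det a by exact: cvg_det.
have fu : \forall t \near F, f t \in unitmx by exact: near_unitmx ua.
have -> : invmx a = (\det a)^-1 *: \adj a by rewrite /invmx ua.
apply: (@cvg_trans _ ((fun t => (\det (f t))^-1 *: \adj (f t)) @ F)).
  apply: near_eq_cvg; near=> t.
  by rewrite /invmx (near fu t).
apply: cvgZ; first exact: cvgV.
apply: mx_cvgP => i j; rewrite mxE; under eq_fun do rewrite mxE.
apply: cvgM; first exact: cvg_cst.
apply: cvg_det; apply: mx_cvgP => k l; rewrite !mxE.
by under eq_fun do rewrite !mxE; exact: mx_cvg_entry.
Unshelve. all: by end_near. Qed.
End matrix_continuity.

(** * Directional derivatives *)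

Section derive_extra.
Variables (R : realType).
Implicit Types (U V W : normedModType R).

(** Formulas for derivatives of composites hold only near a point; this transports differentiability
    across them. The first-order expansion of f is one of g, and uniqueness of the differential
    concludes. *)
Lemma near_eq_differentiable V W (f g : V -> W) (p : V) :
  {near p, f =1 g} -> differentiable f p -> differentiable g p.
Proof.
move=> fg df.
have gf : g \o shift p = cst (g p) + 'd f p +o_ 0 id.
  apply/eqaddoP => e e0.
  have /eqaddoP/(_ e e0) := diff_locally df.
  have fg0 : \forall h \near 0, f (h + p) = g (h + p).
    have : \forall y \near p, f (y - p + p) = g (y - p + p).
      by near=> y; rewrite subrK; near: y; exact: fg.
    rewrite (near_shift 0 p) /=.
    by apply: filterS => h /=; rewrite subr0 addrK.
  apply: filterS2 fg0 => h /= E.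
  rewrite -![(_ - _ : _ -> _) _]/(_ - _) -![(_ + _ : _ -> _) _]/(_ + _) /=.
  by rewrite E (nbhs_singleton fg).
have cf : continuous ('d f p) by exact: diff_continuous.
have E := diff_unique cf gf.
by apply/diff_locallyP; rewrite E.
Unshelve. all: by end_near. Qed.

(** Both sides are limits of the same difference quotient, so the equation holds whether or not the
    limit exists. *)
Lemma derive_comp_linear U V W (L : {linear U -> V}) (f : V -> W) (p v : U) :
  'D_v (f \o L) p = 'D_(L v) f (L p).
Proof.
rewrite /derive (_ : (fun h => _) =
  (fun h => h^-1 *: ((f \o shift (L p)) (h *: L v) - f (L p)))) //.
by apply/funext => h /=; rewrite linearP.
Qed.

Lemma is_derive_linear_comp U V W (L : {linear V -> W}) (f : U -> V) (p v : U) :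
  continuous L -> derivable f p v -> is_derive p v (L \o f) (L ('D_v f p)).
Proof.
move=> cL df.
have h : (fun h => h^-1 *: (((L \o f) \o shift p) (h *: v) - (L \o f) p)) @ 0^' -->
    L ('D_v f p).
  rewrite (_ : (fun h => _) =
     L \o (fun h => h^-1 *: ((f \o shift p) (h *: v) - f p))); last first.
    by apply/funext => h /=; rewrite [RHS]linearZZ [in RHS]linearB.
  by apply: continuous_cvg; [exact: cL | exact: df].
by split; [apply/cvg_ex; exists (L ('D_v f p)) | exact/cvg_lim].
Qed.

Lemma derive_affine V W (f : V -> W) p v y :
  (forall h, f (h *: v + p) = f p + h *: y) -> 'D_v f p = y.
Proof.
move=> E; apply: lim_near_cst => //; near=> h.
rewrite /= E addrC addKr scalerA mulVf ?scale1r //.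
by near: h; exact: nbhs_dnbhs_neq.
Unshelve. all: by end_near. Qed.

Lemma derive_cvg V W (f : V -> W) p v : derivable f p v ->
  (fun h => h^-1 *: (f (h *: v + p) - f p)) @ 0^' --> 'D_v f p.
Proof. by []. Qed.

Lemma line_cvg V (p v : V) : (fun h : R => h *: v + p) @ 0^' --> p.
Proof.
rewrite -[X in _ --> X]add0r -[X in _ --> X + _](scale0r v).
apply: cvgD; last exact: cvg_cst.
by apply: cvgZr_tmp; apply: cvg_within_filter; exact: cvg_id.
Qed.

Lemma derive_limit V W (f : V -> W) (p v : V) (l : W) :
  (fun h => h^-1 *: (f (h *: v + p) - f p)) @ 0^' --> l -> 'D_v f p = l.
Proof. by move=> h; exact: cvg_lim h. Qed.

Lemma line_cvg_comp V W (f : V -> W) (p v : V) :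
  {for p, continuous f} -> (fun t : R => f (t *: v + p)) @ 0^' --> f p.
Proof. by move=> cf; apply: continuous_cvg; [exact: cf | exact: line_cvg]. Qed.

End derive_extra.

(** * Symmetry of second derivatives *)

Section schwarz.
Variables (R : realType) (V : normedModType R).
Implicit Types (f : V -> R) (p u v : V).

Lemma line_is_derive (W : normedModType R) (f : V -> W) p u (a : R) :
  derivable f (a *: u + p) u ->
  is_derive a 1 (fun a : R => f (a *: u + p)) ('D_u f (a *: u + p)).
Proof.
move=> df.
have E : (fun h : R => h^-1 *: (((fun a : R => f (a *: u + p)) \o shift a) (h *: 1) -
            f (a *: u + p))) =
    (fun h => h^-1 *: ((f \o shift (a *: u + p)) (h *: u) - f (a *: u + p))).
  by apply/funext => h /=; rewrite scalerDl -addrA [_%:A]mulr1.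
by split; rewrite /derivable /derive E.
Qed.

Lemma mean_value (g dg : R -> R) (s : R) : 0 < s ->
  (forall a, 0 <= a <= s -> is_derive a 1 g (dg a)) ->
  exists2 c, 0 < c < s & g s - g 0 = dg c * s.
Proof.
move=> s0 h; have [||c cs E] := @MVT R g dg 0 s s0.
- by move=> a; rewrite in_itv /= => /andP[a0 as_]; apply: h; rewrite !ltW.
- apply: derivable_within_continuous => a; rewrite in_itv /= => as_.
  by have [] := h _ as_.
by exists c; [move: cs; rewrite in_itv | rewrite E subr0].
Qed.

(* The left-hand side is symmetric in u and v, but the right-hand side is not:
   comparing the two forms as s tends to 0 yields Schwarz's theorem. *)
Lemma second_difference f p u v (r s : R) :
  (forall q, `|q - p| < r -> differentiable f q /\ differentiable ('D_u f) q) ->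
  0 < s -> s * (`|u| + `|v|) < r ->
  exists2 q, `|q - p| < r &
    f (s *: u + (s *: v + p)) - f (s *: v + p) - f (s *: u + p) + f p =
      'D_v ('D_u f) q * s * s.
Proof.
move=> df s0 sr.
have near_p (a b : R) : 0 <= a <= s -> 0 <= b <= s ->
    `|a *: u + (b *: v + p) - p| < r.
  move=> /andP[a0 as_] /andP[b0 bs]; apply: le_lt_trans sr.
  rewrite addrA addrK; apply: le_trans (ler_normD _ _) _.
  rewrite !normrZ !ger0_norm // mulrDr.
  by rewrite lerD // ler_wpM2r.
have s0s : 0 <= s <= s by rewrite lexx ltW.
have z0s : (0 : R) <= 0 <= s by rewrite lexx ltW.
pose g a := f (a *: u + (s *: v + p)) - f (a *: u + p).
pose dg a := 'D_u f (a *: u + (s *: v + p)) - 'D_u f (a *: u + p).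
have [|c cs Eg] := @mean_value g dg s s0.
  move=> a as_; apply: is_deriveB; apply: line_is_derive; apply: diff_derivable.
    by have [] := df _ (near_p a s as_ s0s).
  by have := near_p a 0 as_ z0s; rewrite scale0r add0r => /df[].
have {}cs : 0 <= c <= s by case/andP: cs => ? ?; rewrite !ltW.
pose k b := 'D_u f (b *: v + (c *: u + p)).
pose dk b := 'D_v ('D_u f) (b *: v + (c *: u + p)).
have [|d ds Ek] := @mean_value k dk s s0.
  move=> b bs; apply: line_is_derive; apply: diff_derivable.
  by have [] := df _ (near_p c b cs bs); rewrite addrCA.
have {}ds : 0 <= d <= s by case/andP: ds => ? ?; rewrite !ltW.
exists (d *: v + (c *: u + p)); first by rewrite addrCA; exact: near_p.
have -> : 'D_v ('D_u f) (d *: v + (c *: u + p)) * s = dg c.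
  by rewrite -[LHS]Ek /k /dg scale0r add0r addrCA.
rewrite -Eg /g.
by rewrite !scale0r !add0r; ring.
Qed.

Lemma dist_split (a b c e : R) :
  `|b - c| < e / 2 -> `|a - c| < e / 2 -> `|a - b| <= e.
Proof.
rewrite !ltr_norml ler_norml => /andP[h1 h2] /andP[h3 h4].
by apply/andP; split; lra.
Qed.

Lemma C2_near_sym f p u v : C2_near f p -> 'D_u ('D_v f) p = 'D_v ('D_u f) p.
Proof.
move=> cf; apply/eqP; rewrite -subr_eq0 -normr_le0; apply/ler_addgt0Pr => e e0.
rewrite add0r.
have e2 : 0 < e / 2 by rewrite divr_gt0.
have cfp := nbhs_singleton cf.
have cuv : \forall q \near p, `|'D_u ('D_v f) p - 'D_u ('D_v f) q| < e / 2.
  by have [_ /(_ v)[_ /(_ u)]] := cfp => /cvgrPdist_lt/(_ _ e2).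
have cvu : \forall q \near p, `|'D_v ('D_u f) p - 'D_v ('D_u f) q| < e / 2.
  by have [_ /(_ u)[_ /(_ v)]] := cfp => /cvgrPdist_lt/(_ _ e2).
have [r /= r0 hr] : exists2 r, 0 < r & forall q, `|q - p| < r ->
  [/\ differentiable f q, forall v, differentiable ('D_v f) q,
      `|'D_u ('D_v f) p - 'D_u ('D_v f) q| < e / 2 &
      `|'D_v ('D_u f) p - 'D_v ('D_u f) q| < e / 2].
  have /nbhs_normP[r /= r0 hr] : \forall q \near p,
    [/\ differentiable f q, forall v, differentiable ('D_v f) q,
      `|'D_u ('D_v f) p - 'D_u ('D_v f) q| < e / 2 &
      `|'D_v ('D_u f) p - 'D_v ('D_u f) q| < e / 2].
    apply: filterS3 cf cuv cvu => q [dq hq] h1 h2.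
    by split => // w; have [] := hq w.
  exists r => // q qr; apply: hr; by rewrite /ball_ /= distrC.
(* The step makes the whole parallelogram spanned by [s *: u] and [s *: v] fit in the ball of radius
   r; the [+ 1] covers u = v = 0. *)
pose s := r / 2 / (`|u| + `|v| + 1).
have D0 : 0 < `|u| + `|v| + 1 by rewrite ltr_wpDl // addr_ge0.
have s0 : 0 < s by rewrite !divr_gt0.
have sr : s * (`|u| + `|v|) < r.
  rewrite /s mulrAC ltr_pdivrMr //.
  have := normr_ge0 u; have := normr_ge0 v; move: `|u| `|v| => x y; nra.
have [|q1 q1r E1] := @second_difference f p u v r s _ s0 sr.
  by move=> q /hr[].
have [||q2 q2r E2] := @second_difference f p v u r s _ s0.
- by move=> q /hr[].
- by rewrite [`|v| + _]addrC.
have E : 'D_v ('D_u f) q1 = 'D_u ('D_v f) q2.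
  have sn0 : s != 0 by rewrite gt_eqF.
  move: E1 E2; rewrite [s *: u + _]addrCA.
  move: ('D_v ('D_u f) q1) ('D_u ('D_v f) q2) => a b E1 E2.
  have : a * s * s = b * s * s by rewrite -[LHS]E1 -[RHS]E2; ring.
  by move=> /(mulIf sn0) /(mulIf sn0).
have [_ _ _ H1] := hr _ q1r; have [_ _ H2 _] := hr _ q2r.
move: H1 H2; rewrite E.
move: ('D_v ('D_u f) p) ('D_u ('D_v f) p) ('D_u ('D_v f) q2) => a b c.
move=> h1 h2; exact: dist_split h1 h2.
Qed.

End schwarz.

(** * Twice continuously differentiable functions *)

Section C2.
Variables (R : realType).
Implicit Types (U V W : normedModType R).

(** The property is open since its definition quantifies over a neighbourhood. This lets a first
    derivative be computed near p before differentiating again. *)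
Lemma C2_near_near V W (f : V -> W) p :
  C2_near f p -> \forall q \near p, C2_near f q.
Proof. exact: nbhs_interior. Qed.

Lemma C2_near_preimage U V W (L : U -> V) (f : V -> W) p :
  continuous L -> C2_near f (L p) -> \forall q \near p, C2_near f (L q).
Proof. by move=> cL cf; apply: (cL p); exact: C2_near_near. Qed.

Lemma C2_near_diff V W (f : V -> W) p : C2_near f p -> differentiable f p.
Proof. by move/nbhs_singleton => []. Qed.

Lemma C2_near_derive_diff V W (f : V -> W) p v :
  C2_near f p -> differentiable ('D_v f) p.
Proof. by move/nbhs_singleton => [_ /(_ v)[]]. Qed.

Lemma C2_near_continuous V W (f : V -> W) p u v :
  C2_near f p -> {for p, continuous ('D_u ('D_v f))}.
Proof. by move/nbhs_singleton => [_ /(_ v)[]]. Qed.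

Lemma derive_comp_linear_fun U V W (L : {linear U -> V}) (f : V -> W) v :
  'D_v (f \o L) = 'D_(L v) f \o L.
Proof. by apply/funext => p; rewrite derive_comp_linear. Qed.

Lemma differentiable_comp_linear U V W (L : {linear U -> V}) (f : V -> W) p :
  continuous L -> differentiable f (L p) -> differentiable (f \o L) p.
Proof.
move=> cL df; apply: differentiable_comp => //.
exact: linear_differentiable.
Qed.

Lemma C2_near_comp_linear U V W (L : {linear U -> V}) (f : V -> W) p :
  continuous L -> C2_near f (L p) -> C2_near (f \o L) p.
Proof.
move=> cL cf; rewrite /C2_near; near=> q.
have cfq : C2_near f (L q).
  near: q; apply: (cL p); exact: C2_near_near.
split; first exact: differentiable_comp_linear (C2_near_diff cfq).
move=> v; rewrite derive_comp_linear_fun; split.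
  exact: differentiable_comp_linear (C2_near_derive_diff _ cfq).
move=> u; rewrite derive_comp_linear_fun.
by apply: continuous_comp; [exact: cL | exact: C2_near_continuous].
Unshelve. all: by end_near. Qed.

Lemma near_eq_continuous_at V W (f g : V -> W) p :
  {near p, f =1 g} -> {for p, continuous f} -> {for p, continuous g}.
Proof.
move=> fg cf; have gp : g @ p --> g p; last exact: gp.
by rewrite -(nbhs_singleton fg); apply: cvg_trans (near_eq_cvg fg) cf.
Qed.

Lemma derive_linear_comp U V W (L : {linear V -> W}) (f : U -> V) (p v : U) :
  continuous L -> differentiable f p -> 'D_v (L \o f) p = L ('D_v f p).
Proof.
by move=> cL df; have [] := is_derive_linear_comp cL (diff_derivable (v := v) df).
Qed.

Lemma derive2_linear_comp U V W (L : {linear V -> W}) (f : U -> V) (p u v : U) :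
  continuous L -> C2_near f p -> 'D_u ('D_v (L \o f)) p = L ('D_u ('D_v f) p).
Proof.
move=> cL cf; rewrite -derive_linear_comp //; last exact: C2_near_derive_diff.
apply: near_eq_derive; near=> q; rewrite /= derive_linear_comp //.
by apply: C2_near_diff; near: q; exact: C2_near_near.
Unshelve. all: by end_near. Qed.

Lemma C2_near_linear_comp U V W (L : {linear V -> W}) (f : U -> V) (p : U) :
  continuous L -> C2_near f p -> C2_near (L \o f) p.
Proof.
move=> cL cf.
have dL q : differentiable f q -> differentiable (L \o f) q.
  by move=> df; apply: differentiable_comp => //; exact: linear_differentiable.
rewrite /C2_near; near=> q.
have cfq : \forall r \near q, C2_near f r.
  by near: q; exact: nbhs_interior (C2_near_near cf).
split; first exact/dL/C2_near_diff/(nbhs_singleton cfq).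
move=> v.
have E : {near q, L \o 'D_v f =1 'D_v (L \o f)}.
  by near=> r; rewrite derive_linear_comp //; apply: C2_near_diff; near: r.
split.
  apply: near_eq_differentiable E _; apply: differentiable_comp.
    exact: C2_near_derive_diff (nbhs_singleton cfq).
  exact: linear_differentiable.
move=> u.
have E2 : {near q, L \o 'D_u ('D_v f) =1 'D_u ('D_v (L \o f))}.
  by near=> r; rewrite derive2_linear_comp //; near: r.
apply: near_eq_continuous_at E2 _.
by apply: continuous_comp; [exact: C2_near_continuous (nbhs_singleton cfq)|exact: cL].
Unshelve. all: by end_near. Qed.

Lemma derive_cst_fun V W (c : W) v : 'D_v (cst c : V -> W) = cst 0.
Proof. by apply/funext => q; rewrite derive_cst. Qed.

Lemma C2_near_cst V W (c : W) (p : V) : C2_near (cst c : V -> W) p.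
Proof.
rewrite /C2_near; near=> q; split; first exact: differentiable_cst.
move=> v; rewrite derive_cst_fun; split; first exact: differentiable_cst.
by move=> u; rewrite derive_cst_fun; exact: cst_continuous.
Unshelve. all: by end_near. Qed.

Lemma differentiable_affine V W (L : {linear V -> W}) c p :
  continuous L -> differentiable (fun z => L z + c) p.
Proof.
move=> cL; have -> : (fun z => L z + c) = (L : V -> W) + cst c by [].
by apply: differentiableD; [exact: linear_differentiable | exact: differentiable_cst].
Qed.

Lemma derive_of_linear V W (L : {linear V -> W}) p v : 'D_v L p = L v.
Proof. by apply: derive_affine => h; rewrite linearP addrC. Qed.

Lemma derive_linear_fun V W (L : {linear V -> W}) v : 'D_v L = cst (L v).
Proof.
by apply/funext => q; rewrite derive_of_linear.
Qed.

Lemma C2_near_linear V W (L : {linear V -> W}) (p : V) :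
  continuous L -> C2_near L p.
Proof.
move=> cL; rewrite /C2_near; near=> q; split; first exact: linear_differentiable.
move=> v; rewrite derive_linear_fun.
split; first exact: differentiable_cst.
by move=> u; rewrite derive_cst_fun; exact: cst_continuous.
Unshelve. all: by end_near. Qed.

Lemma derive2D V W (f g : V -> W) p u v : C2_near f p -> C2_near g p ->
  'D_u ('D_v (f + g)) p = 'D_u ('D_v f) p + 'D_u ('D_v g) p.
Proof.
move=> cf cg; rewrite -deriveD; first last.
- exact/diff_derivable/C2_near_derive_diff.
- exact/diff_derivable/C2_near_derive_diff.
apply: near_eq_derive.
apply: filterS2 (C2_near_near cf) (C2_near_near cg) => q cfq cgq.
by rewrite deriveD //; apply/diff_derivable/C2_near_diff.
Qed.

Lemma C2_nearD V W (f g : V -> W) p :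
  C2_near f p -> C2_near g p -> C2_near (f + g) p.
Proof.
move=> cf cg.
apply: filterS2 (nbhs_interior (C2_near_near cf)) (nbhs_interior (C2_near_near cg)).
move=> q cfq cgq; have cf1 := nbhs_singleton cfq; have cg1 := nbhs_singleton cgq.
split; first by apply: differentiableD; exact: C2_near_diff.
move=> v.
have E : {near q, 'D_v f + 'D_v g =1 'D_v (f + g)}.
  by apply: filterS2 cfq cgq => r fr gr; rewrite deriveD //;
    apply/diff_derivable/C2_near_diff.
split.
  apply: near_eq_differentiable E _.
  by apply: differentiableD; exact: C2_near_derive_diff.
move=> u.
have E2 : {near q, 'D_u ('D_v f) + 'D_u ('D_v g) =1 'D_u ('D_v (f + g))}.
  by apply: filterS2 cfq cgq => r fr gr; rewrite derive2D.
apply: near_eq_continuous_at E2 _.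
by apply: continuousD; exact: C2_near_continuous.
Qed.

Lemma C2_near_sum V W n (f : 'I_n -> V -> W) p :
  (forall i, C2_near (f i) p) -> C2_near (\sum_i f i) p.
Proof.
move=> cf; elim/big_ind: _; first exact: (C2_near_cst 0).
  by move=> g h cg ch; exact: C2_nearD.
by move=> i _; exact: cf.
Qed.

Lemma derive_sum_diff V W n (f : 'I_n -> V -> W) p v :
  (forall i, differentiable (f i) p) ->
  'D_v (\sum_i f i) p = \sum_i 'D_v (f i) p.
Proof. by move=> df; rewrite derive_sum // => i; exact: diff_derivable. Qed.

Lemma derive2_sum V W n (f : 'I_n -> V -> W) p u v :
  (forall i, C2_near (f i) p) ->
  'D_u ('D_v (\sum_i f i)) p = \sum_i 'D_u ('D_v (f i)) p.
Proof.
move=> cf; rewrite -derive_sum; last first.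
  by move=> i; exact/diff_derivable/C2_near_derive_diff.
apply: near_eq_derive.
have : \forall q \near p, forall i, C2_near (f i) q.
  by apply: filter_forall => i; exact: C2_near_near.
apply: filterS => q h; rewrite derive_sum_diff ?fct_sumE //.
by move=> i; exact: C2_near_diff.
Qed.

End C2.

(** * Gradients, Jacobians and Hessians *)

Section matrix_calculus.
Variable R : realType.

Definition dot n (v c : 'cV[R]_n) : R := (v^T *m c) 0 0.

Lemma dot_is_linear n (v : 'cV[R]_n) : linear (dot v).
Proof. by move=> k a b; rewrite /dot mulmxDr -scalemxAr !mxE. Qed.

HB.instance Definition _ n (v : 'cV[R]_n) :=
  GRing.isLinear.Build R 'cV[R]_n R _ (dot v) (dot_is_linear v).

Lemma dot_continuous n (v : 'cV[R]_n) : continuous (dot v).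
Proof. exact: mx_linear_continuous. Qed.

Lemma dot_delta n (k : 'I_n) (v : 'cV[R]_n) : dot (delta_mx k 0) v = v k 0.
Proof. by rewrite /dot trmx_delta -rowE [LHS]mxE. Qed.

Lemma dot0l n (v : 'cV[R]_n) : dot 0 v = 0.
Proof. by rewrite /dot trmx0 mul0mx mxE. Qed.

Lemma dotC n (v c : 'cV[R]_n) : dot v c = dot c v.
Proof. by rewrite /dot -[c in LHS]trmxK -trmx_mul mxE. Qed.

Lemma jac_mul n m (f : 'cV[R]_n -> 'cV[R]_m) p v :
  differentiable f p -> jac f p *m v = 'D_v f p.
Proof.
move=> df; rewrite [in RHS](matrix_sum_delta v) deriveE // linear_sum.
apply/matrixP => i j; rewrite ord1 mxE summxE; apply: eq_bigr => k _.
by rewrite big_ord1 linearZ !mxE mulrC.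
Qed.

Lemma grad_dot n (g : 'cV[R]_n -> R) p v :
  differentiable g p -> (v^T *m grad g p) 0 0 = 'D_v g p.
Proof.
move=> df; rewrite [in RHS](matrix_sum_delta v) deriveE // linear_sum mxE.
by apply: eq_bigr => k _; rewrite big_ord1 linearZ !mxE.
Qed.

Lemma C2_near_grad_diff n (g : 'cV[R]_n -> R) p :
  C2_near g p -> differentiable (grad g) p.
Proof.
move=> cg.
(* [grad] is built from the differential, whereas [C2_near] speaks of directional derivatives; the
   two agree wherever g is differentiable, hence near p. *)
have E : {near p, (fun q => \sum_i 'D_(delta_mx i 0) g q *: (delta_mx i 0 : 'cV_n))
             =1 grad g}.
  apply: filterS (C2_near_near cg) => q cgq; apply/matrixP => i j; rewrite ord1 summxE mxE (bigD1 i) //= big1 => [|k ki].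
    rewrite !mxE !eqxx mulr1 addr0 deriveE //.
    exact: C2_near_diff.
  by rewrite !mxE eq_sym (negbTE ki) mulr0.
apply: near_eq_differentiable E _.
rewrite -fct_sumE; apply: differentiable_sum => i.
by apply: differentiableZl; exact: C2_near_derive_diff.
Qed.

(** Bridge between Hessian matrices and iterated directional derivatives, the form in which the
    Riccati identity is stated. *)
Lemma hess_mul n (g : 'cV[R]_n -> R) p (v d : 'cV[R]_n) :
  C2_near g p -> (v^T *m hess g p *m d) 0 0 = 'D_d ('D_v g) p.
Proof.
move=> cg; rewrite -mulmxA /hess jac_mul; last exact: C2_near_grad_diff.
rewrite -[LHS]/(dot v _) -derive_linear_comp; first last.
- exact: C2_near_grad_diff.
- exact: dot_continuous.
apply: near_eq_derive; apply: filterS (C2_near_near cg) => q cgq.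
by rewrite -[RHS]grad_dot //; exact: C2_near_diff.
Qed.

Lemma hess_sym n (g : 'cV[R]_n -> R) p : C2_near g p -> (hess g p)^T = hess g p.
Proof.
move=> cg; apply/matrixP => i j.
have E k l : (hess g p) k l = ((delta_mx k 0 : 'cV_n)^T *m hess g p *m (delta_mx l 0 : 'cV_n)) 0 0.
  by rewrite trmx_delta -rowE -colE !mxE.
rewrite mxE !E (hess_mul _ _ cg) (hess_mul _ _ cg).
exact: C2_near_sym.
Qed.

End matrix_calculus.

(** * Second derivatives of convex functions *)

Section convex_second_order.
Local Open Scope convex_scope.
Variables (R : realType) (V : normedModType R).

Lemma derive_opp_dir (W : normedModType R) (f : V -> W) p v :
  differentiable f p -> 'D_(- v) f p = - 'D_v f p.
Proof. by move=> df; rewrite !deriveE // linearN. Qed.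

Lemma half_onem : unstable.onem (2^-1 : R) = 2^-1.
Proof. rewrite /unstable.onem; lra. Qed.

Lemma half_half : (2^-1 + 2^-1 : R) = 1.
Proof. lra. Qed.

Lemma midpoint_contra (x y z d : R) :
  x - z < d -> y - z < - d -> ~ z <= 2^-1 * x + 2^-1 * y.
Proof. move=> h1 h2; apply/negP; lra. Qed.

Lemma below_two (a b : R) : 0 < a -> 0 < b -> exists s, [/\ 0 < s, s < a & s < b].
Proof.
move=> a0 b0; exists (Num.min a b / 2).
have m0 : 0 < Num.min a b by rewrite lt_min a0.
by split; [lra | |]; apply: (@lt_le_trans _ _ (Num.min a b));
  rewrite ?ge_min ?lexx ?orbT // ltr_pdivrMr ?ltr0n // ltr_pMr // ltr1n.
Qed.

(** A negative second derivative makes the slope along w drop below its value at p just after p, and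
    the increment of g is s times such a slope by the mean value theorem. *)
Lemma below_tangent (g : V -> R) p w : C2_near g p -> 'D_w ('D_w g) p < 0 ->
  exists2 e, 0 < e &
    forall s, 0 < s < e -> g (s *: w + p) - g p < s * 'D_w g p.
Proof.
move=> cg c0.
have dg := derive_cvg (diff_derivable (v := w) (C2_near_derive_diff w cg)).
have [e1 /= e10 he1] : exists2 e, 0 < e & forall h, 0 < h < e ->
    h^-1 * ('D_w g (h *: w + p) - 'D_w g p) < 0.
  have : \forall h \near (0 : R)^', h^-1 * ('D_w g (h *: w + p) - 'D_w g p) < 0.
    exact: cvgr_lt _ dg _ c0.
  rewrite near_withinE => /nbhs_normP[e /= e0 he].
  exists e => // h /andP[h0 h1]; apply: he; last by rewrite gt_eqF.
  by rewrite /ball_ /= sub0r normrN gtr0_norm.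
have [e2 /= e20 he2] : exists2 e, 0 < e & forall h, 0 <= h < e ->
    differentiable g (h *: w + p).
  have lc : (fun h : R => h *: w + p) @ 0 --> p.
    rewrite -[X in _ --> X]add0r -[X in _ --> X + _](scale0r w).
    by apply: cvgD; [apply: cvgZr_tmp; exact: cvg_id | exact: cvg_cst].
  have /nbhs_normP[e /= e0 he] := lc _ (C2_near_near cg).
  exists e => // h /andP[h0 h1]; apply: C2_near_diff; apply: he.
  by rewrite /ball_ /= sub0r normrN ger0_norm.
exists (Num.min e1 e2); first by rewrite lt_min e10.
move=> s /andP[s0]; rewrite lt_min => /andP[s1 s2].
have [|a /andP[a0 as_] E] := @mean_value R (fun a => g (a *: w + p))
    (fun a => 'D_w g (a *: w + p)) s s0.
  move=> a /andP[a0 as_]; apply: line_is_derive; apply: diff_derivable.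
  by apply: he2; rewrite a0 (le_lt_trans as_).
move: E; rewrite scale0r add0r => ->; rewrite mulrC ltr_pM2l //.
have := he1 a; rewrite a0 (lt_trans as_ s1) => /(_ isT).
by rewrite pmulr_rlt0 ?invr_gt0 // subr_lt0.
Qed.

Lemma convex_derive2_ge0 (g : V -> R) p v :
  convex_function setT (g : convex_lmodType V -> R^o) -> C2_near g p ->
  0 <= 'D_v ('D_v g) p.
Proof.
move=> gconv cg; rewrite leNgt; apply/negP => c0.
have dg := C2_near_diff cg.
(* Negative curvature puts g below its tangent in both directions v and - v,
   against convexity at the midpoint p. *)
have E : 'D_(- v) ('D_(- v) g) p = 'D_v ('D_v g) p.
  rewrite derive_opp_dir; last exact: C2_near_derive_diff.
  rewrite -[RHS]opprK; congr (- _).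
  rewrite -deriveN; last exact/diff_derivable/C2_near_derive_diff.
  apply: near_eq_derive; apply: filterS (C2_near_near cg) => q cq.
  by rewrite derive_opp_dir //; exact: C2_near_diff.
have [e1 e10 h1] := below_tangent cg c0.
have [|e2 e20 h2] := @below_tangent g p (- v) cg; first by rewrite E.
have [s [s0 s1 s2]] := below_two e10 e20.
have := h1 s; rewrite s0 s1 => /(_ isT) {}h1.
have := h2 s; rewrite s0 s2 => /(_ isT) {}h2.
rewrite (derive_opp_dir v dg) in h2.
move: h1 h2; move: ('D_v g p) => D h1 h2; clear E cg dg c0.
have t01 : (0 <= 2^-1 :> R) && (2^-1 <= 1 :> R).
  by rewrite invr_ge0 ler0n /= invf_le1 ?ler1n // ltr0n.
pose t : {i01 R} := Itv01 (proj1 (andP t01)) (proj2 (andP t01)).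
have /= := gconv t (s *: v + p) (s *: - v + p) (mem_set Logic.I) (mem_set Logic.I).
have -> : (s *: v + p : convex_lmodType V) <| t |> (s *: - v + p : convex_lmodType V) = p.
  rewrite /conv /= half_onem scalerN !scalerDr scalerN addrACA subrr add0r.
  by rewrite -scalerDl half_half scale1r.
rewrite convRE /= half_onem; move: h1 h2.
move: (g (s *: v + p)) (g (s *: - v + p)) (g p) => x y z.
by rewrite [s * - _]mulrN => h1 h2; apply: midpoint_contra h1 h2.
Qed.

End convex_second_order.

(** * Symmetric pencils and spectral radii *)

Section quadratic_forms.
Variable R : realType.

Lemma qformE n (A : 'M[R]_n) v : qform A v = dot v (A *m v).
Proof. by rewrite /qform /dot mulmxA. Qed.

Lemma dot_self_ge0 n (v : 'cV[R]_n) : 0 <= dot v v.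
Proof.
by rewrite /dot mxE; apply: sumr_ge0 => i _; rewrite mxE -expr2 sqr_ge0.
Qed.

Lemma dot_self_eq0 n (v : 'cV[R]_n) : dot v v = 0 -> v = 0.
Proof.
rewrite /dot mxE => /eqP; rewrite psumr_eq0; last first.
  by move=> i _; rewrite mxE -expr2 sqr_ge0.
move=> /allP h; apply/matrixP => i j; rewrite ord1 mxE.
have := h i (mem_index_enum i); rewrite mxE mulf_eq0 orbb.
by move/eqP.
Qed.

Lemma dot_nondeg n (v : 'cV[R]_n) : (forall c, dot c v = 0) -> v = 0.
Proof. by move=> h; apply: dot_self_eq0; exact: h. Qed.

Lemma dot_trmx m n (A : 'M[R]_(m, n)) u v : dot u (A *m v) = dot (A^T *m u) v.
Proof. by rewrite /dot trmx_mul trmxK mulmxA. Qed.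

Lemma dotZr n k (u v : 'cV[R]_n) : dot u (k *: v) = k * dot u v.
Proof. by rewrite linearZ. Qed.

Lemma dotZl n k (u v : 'cV[R]_n) : dot (k *: u) v = k * dot u v.
Proof. by rewrite dotC dotZr dotC. Qed.

Lemma dotDl n (u v w : 'cV[R]_n) : dot (u + v) w = dot u w + dot v w.
Proof. by rewrite ![dot _ w]dotC; exact: linearD. Qed.

Lemma dotNl n (u v : 'cV[R]_n) : dot (- u) v = - dot u v.
Proof. by rewrite -scaleN1r dotZl mulN1r. Qed.

Lemma qformZ n (A : 'M[R]_n) k v : qform A (k *: v) = k ^+ 2 * qform A v.
Proof. by rewrite !qformE -scalemxAr dotZr dotZl mulrA. Qed.

Lemma qform0 n (A : 'M[R]_n) : qform A 0 = 0.
Proof. by rewrite -(scale0r 0) qformZ expr0n mul0r. Qed.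

Lemma qformD n (A : 'M[R]_n) u v : A^T = A ->
  qform A (u + v) = qform A u + 2 * dot u (A *m v) + qform A v.
Proof.
move=> sA; rewrite !qformE mulmxDr linearD /= !dotDl.
by rewrite [dot v (A *m u)]dot_trmx sA [dot (A *m v) u]dotC; ring.
Qed.

Lemma qform_comb n (A B : 'M[R]_n) k v :
  qform (k *: A + B) v = k * qform A v + qform B v.
Proof. by rewrite !qformE mulmxDl -scalemxAl linearP. Qed.

Lemma qform_scale n (A : 'M[R]_n) k v : qform (k *: A) v = k * qform A v.
Proof. by rewrite !qformE -scalemxAl dotZr. Qed.

Lemma qformN n (A : 'M[R]_n) v : qform (- A) v = - qform A v.
Proof. by rewrite !qformE mulNmx linearN. Qed.

Lemma quad_ge0_lin0 (a b : R) : (forall t, 0 <= t ^+ 2 * a + 2 * (t * b)) -> b = 0.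
Proof.
move=> h; apply/eqP; rewrite -sqrf_eq0 eq_le sqr_ge0 andbT.
have a0 : 0 <= a.
  rewrite leNgt; apply/negP => a0.
  have := h 1; have := h (-1); nra.
(* The exact minimiser is - b / a; the [+ 1] avoids a zero denominator and still leaves a negative
   multiple of b^2. *)
have := h (- b / (a + 1)).
have a1 : 0 < a + 1 by rewrite ltr_wpDl.
have -> : (- b / (a + 1)) ^+ 2 * a + 2 * (- b / (a + 1) * b) =
   - (b ^+ 2 * ((a + 2) / (a + 1) ^+ 2)).
  by field; rewrite gt_eqF.
rewrite oppr_ge0 pmulr_lle0 //.
by rewrite divr_gt0 ?exprn_gt0 // ltr_wpDl.
Qed.

(** The form is minimal at c, so along every line through c the coefficient linear in t vanishes;
    that coefficient pairs the direction with B c. *)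
Lemma psd_kernel n (B : 'M[R]_n) c : B^T = B -> (forall v, 0 <= qform B v) ->
  qform B c = 0 -> B *m c = 0.
Proof.
move=> sB pB qc; apply: dot_nondeg => u.
apply: (@quad_ge0_lin0 (qform B u)) => t.
have := pB (t *: u + c).
by rewrite qformD // qformZ dotZl qc addr0.
Qed.

Lemma loewner_boundsP n (A B : 'M[R]_n) k : A^T = A -> B^T = B ->
  loewner_bounds A B k <-> forall v, `|qform B v| <= k * qform A v.
Proof.
move=> sA sB; split=> [[[_ h1] [_ h2]] v|h].
  rewrite ler_norml; have := h1 v; have := h2 v.
  rewrite opprK [B + _]addrC !qform_comb qformN => h3 h4.
  by rewrite -[- _ <= _]subr_ge0 opprK addrC h4 -subr_ge0.
have symk : (k *: A)^T = k *: A by rewrite linearZ /= sA.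
split; split; try by rewrite opprK linearD /= ?linearN /= symk sB.
- move=> v; rewrite opprK addrC qform_comb.
  by have := h v; rewrite ler_norml -subr_ge0 opprK addrC => /andP[].
- by rewrite linearB /= symk sB.
- move=> v; rewrite qform_comb qformN subr_ge0.
  by apply: le_trans (h v); exact: ler_norm.
Qed.

(** Stated on row vectors to match the extreme value theorem used in [rayleigh_max]. *)
Lemma qform_continuous n (A : 'M[R]_n) : continuous (fun v : 'rV[R]_n => qform A v^T).
Proof.
move=> x; rewrite /continuous_at /qform.
apply: (mx_cvg_entry (F := nbhs x)).
apply: (cvg_mulmx (F := nbhs x)); last by apply: (cvg_trmx (F := nbhs x)); exact: cvg_id.
apply: (cvg_mulmx (F := nbhs x)); last exact: cvg_cst.
by do 2 apply: (cvg_trmx (F := nbhs x)); exact: cvg_id.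
Qed.

(** k is the maximum of |qform B v| / qform A v on a unit sphere, and homogeneity extends the bound
    to all v. With s the sign of the form of B at the maximiser, k A - s B is positive semidefinite
    and its form vanishes there, so the maximiser lies in its kernel. *)
Lemma rayleigh_max n (A B : 'M[R]_n) : (0 < n)%N -> A^T = A -> B^T = B ->
  (forall v, v != 0 -> 0 < qform A v) ->
  exists k, [/\ loewner_bounds A B k, lbound (loewner_bounds A B) k &
    exists (s : R) (v : 'cV[R]_n), [/\ v != 0, `|s| = 1 & B *m v = (s * k) *: (A *m v)]].
Proof.
move=> n0 sA sB pA.
pose S := [set v : 'rV[R]_n | `|v| = 1].
pose f (v : 'rV[R]_n) := `|qform B v^T| / qform A v^T.
have S0 v : S v -> v^T != 0.
  move=> Sv; apply/eqP => v0.
  have : v = 0 by rewrite -[v]trmxK v0 trmx0.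
  by move=> v0'; move: Sv; rewrite /S /= v0' normr0 => /esym/eqP; rewrite oner_eq0.
have normS (v : 'rV[R]_n) : v != 0 -> S (`|v|^-1 *: v).
  move=> v0; rewrite /S /= normrZ normfV normr_id mulVf //.
  by rewrite normr_eq0.
have Sne : S !=set0.
  exists (`|const_mx 1 : 'rV[R]_n|^-1 *: const_mx 1); apply: normS.
  apply/eqP => /matrixP/(_ 0 (Ordinal n0)); rewrite !mxE => /eqP.
  by rewrite oner_eq0.
have cS : compact S.
  apply: bounded_closed_compact.
    by exists 1; split=> // x x1 v /= ->; exact: ltW.
  rewrite /S; apply: (@closed_comp _ _ (fun v : 'rV[R]_n => `|v|) [set x | x = 1]).
    by move=> v _; exact: norm_continuous.
  exact: closed_eq.
have cf : {within S, continuous f}.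
  apply: continuous_in_subspaceT => v; rewrite inE => Sv.
  have cB := @qform_continuous _ B v.
  have cA := @qform_continuous _ A v.
  have qA0 : qform A v^T != 0 by rewrite gt_eqF // pA // S0.
  exact: (cvgM (cvg_norm cB) (cvgV qA0 cA)).
have [c cS1 cmax] := EVT_max_rV Sne cS cf.
rewrite inE in cS1.
have c0 := S0 _ cS1.
have bound v : `|qform B v| <= f c * qform A v.
  have [->|v0] := eqVneq v 0; first by rewrite !qform0 normr0 mulr0.
  have vT0 : v^T != 0 by apply: contra v0 => /eqP/(congr1 trmx); rewrite trmxK trmx0 => ->.
  have := cmax (`|v^T|^-1 *: v^T); rewrite inE => /(_ (normS _ vT0)).
  rewrite /f linearZ /= trmxK !qformZ normrM.
  set t := `|v^T|^-1 ^+ 2.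
  have t0 : 0 < t by rewrite /t exprn_gt0 // invr_gt0 normr_gt0.
  by rewrite (gtr0_norm t0) -mulf_div divff ?gt_eqF // mul1r ler_pdivrMr // pA.
exists (f c); split.
- exact/loewner_boundsP.
- move=> k /(loewner_boundsP _ sA sB)/(_ c^T); rewrite /f.
  by rewrite ler_pdivrMr // pA.
(* A sign that is never 0, so that [s * s = 1] also when the form vanishes. *)
pose s : R := if 0 <= qform B c^T then 1 else -1.
exists s, c^T; split=> //.
  by rewrite /s; case: ifP; rewrite ?normrN normr1.
have ss : s * s = 1 by rewrite /s; case: ifP; rewrite ?mulrNN mulr1.
have sq : s * qform B c^T = `|qform B c^T|.
  rewrite /s; case: ifP => [h|/negbT]; first by rewrite mul1r ger0_norm.
  by rewrite -ltNge mulN1r => h; rewrite ltr0_norm.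
have snorm v : - s * qform B v + f c * qform A v >= 0.
  rewrite mulNr addrC subr_ge0; apply: le_trans (bound v).
  have -> : `|qform B v| = `|s * qform B v|.
    by rewrite normrM /s; case: ifP; rewrite ?normrN normr1 mul1r.
  exact: ler_norm.
have /eqP : (- s *: B + f c *: A) *m c^T = 0.
  apply: psd_kernel.
  - by rewrite linearD /= !linearZ /= sA sB.
  - by move=> v; rewrite qform_comb qform_scale.
  - rewrite qform_comb qform_scale.
    by rewrite mulNr sq /f divfK ?subrr ?addNr // gt_eqF // pA.
rewrite mulmxDl -!scalemxAl scaleNr addrC subr_eq0 => /eqP E.
by rewrite -scalerA E scalerA ss scale1r.
Qed.

End quadratic_forms.

(** * Spectral radii of matrices that come from a symmetric pencil *)

Section spectral.
Variable R : realType.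
Local Notation rc := (real_complex R).
Local Notation normc := ComplexField.Normc.normc.

(** An attained bound. It transfers between matrices of different sizes more easily than the [sup]
    of [spectral_radius]. *)
Definition spectral_radius_is n (A : 'M[R]_n) (k : R) : Prop :=
  (forall c, eigenvalue (map_mx rc A) c -> normc c <= k) /\
  exists2 c, eigenvalue (map_mx rc A) c & normc c = k.

Lemma spectral_radiusE n (A : 'M[R]_n) k :
  spectral_radius_is A k -> spectral_radius A = k.
Proof.
move=> [ub [c ec nc]]; apply/eqP; rewrite eq_le; apply/andP; split.
  apply: ge_sup; first by exists (normc c), c.
  by move=> _ [c' ec' <-]; exact: ub.
apply: ub_le_sup; last by exists c.
by exists k => _ [c' ec' <-]; exact: ub.
Qed.

Lemma normc_ge0 (c : R[i]) : 0 <= normc c.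
Proof. by case: c => a b; exact: sqrtr_ge0. Qed.

Lemma normc_real (x : R) : normc (rc x) = `|x|.
Proof. by rewrite /= expr0n addr0 sqrtr_sqr. Qed.

Lemma complex_re_sum (I : Type) (r : seq I) (f : I -> R[i]) :
  complex.Re (\sum_(i <- r) f i) = \sum_(i <- r) complex.Re (f i).
Proof. by apply: (big_morph (fun z : R[i] => complex.Re z)) => // -[a b] [c d]. Qed.

Lemma complex_im_sum (I : Type) (r : seq I) (f : I -> R[i]) :
  complex.Im (\sum_(i <- r) f i) = \sum_(i <- r) complex.Im (f i).
Proof. by apply: (big_morph (fun z : R[i] => complex.Im z)) => // -[a b] [c d]. Qed.

(** [eigenvalue] is about row vectors multiplied from the left; passing to columns transposes the
    matrix, which is harmless for the symmetric A and B below. *)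
Definition re_col n (v : 'rV[R[i]]_n) : 'cV[R]_n := \col_i complex.Re (v 0 i).
Definition im_col n (v : 'rV[R[i]]_n) : 'cV[R]_n := \col_i complex.Im (v 0 i).

Lemma re_col_mul m n (v : 'rV[R[i]]_m) (A : 'M[R]_(m, n)) :
  re_col (v *m map_mx rc A) = A^T *m re_col v.
Proof.
apply/matrixP => i j; rewrite !mxE complex_re_sum; apply: eq_bigr => k _.
by rewrite !mxE; case: (v 0 k) => a b /=; rewrite mulr0 subr0 mulrC.
Qed.

Lemma im_col_mul m n (v : 'rV[R[i]]_m) (A : 'M[R]_(m, n)) :
  im_col (v *m map_mx rc A) = A^T *m im_col v.
Proof.
apply/matrixP => i j; rewrite !mxE complex_im_sum; apply: eq_bigr => k _.
by rewrite !mxE; case: (v 0 k) => a b /=; rewrite mulr0 add0r mulrC.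
Qed.

Lemma re_colZ n (c : R[i]) (v : 'rV[R[i]]_n) :
  re_col (c *: v) = complex.Re c *: re_col v - complex.Im c *: im_col v.
Proof. by apply/matrixP => i j; rewrite !mxE; case: c (v 0 i) => a b [x y]. Qed.

Lemma im_colZ n (c : R[i]) (v : 'rV[R[i]]_n) :
  im_col (c *: v) = complex.Re c *: im_col v + complex.Im c *: re_col v.
Proof. by apply/matrixP => i j; rewrite !mxE; case: c (v 0 i) => a b [x y]. Qed.

Lemma complex_row_eq0 n (v : 'rV[R[i]]_n) : re_col v = 0 -> im_col v = 0 -> v = 0.
Proof.
move=> h1 h2; apply/matrixP => i j; rewrite ord1 mxE.
move/matrixP/(_ j 0): h1; move/matrixP/(_ j 0): h2; rewrite !mxE.
by case: (v 0 j) => a b /= -> ->.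
Qed.

Section generalized.
Variables (n d : nat) (A B : 'M[R]_d) (k : R).
Hypotheses (sA : A^T = A) (sB : B^T = B).
Hypothesis pA : forall v, v != 0 -> 0 < qform A v.
Hypothesis boundB : forall v, `|qform B v| <= k * qform A v.

Lemma pos_def_ge0 v : 0 <= qform A v.
Proof.
by have [->|v0] := eqVneq v 0; [rewrite qform0 | apply: ltW; exact: pA].
Qed.

(* Pairing the eigenvector equation with the real and the imaginary part of f
   shows that c is real and is a mean of Rayleigh quotients. *)
Lemma generalized_eigenvalue_bound (c : R[i]) (f : 'rV[R[i]]_d) : f != 0 ->
  f *m map_mx rc B = c *: (f *m map_mx rc A) -> normc c <= k.
Proof.
move=> f0 E; set a := re_col f; set b := im_col f.
have := congr1 (@re_col _) E; rewrite re_colZ !re_col_mul im_col_mul sA sB -/a -/b => Er.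
have := congr1 (@im_col _) E; rewrite im_colZ !im_col_mul re_col_mul sA sB -/a -/b => Ei.
have m0 : 0 < qform A a + qform A b.
  have [a0|a0] := eqVneq a 0; last by rewrite ltr_pwDl ?pA ?pos_def_ge0.
  have [b0|b0] := eqVneq b 0; last by rewrite ltr_wpDl ?pA ?pos_def_ge0.
  by move: f0; rewrite (complex_row_eq0 a0 b0) eqxx.
have sym u v (M : 'M[R]_d) : M^T = M -> dot u (M *m v) = dot v (M *m u).
  by move=> sM; rewrite dot_trmx sM dotC.
have Er1 := congr1 (dot a) Er; have Er2 := congr1 (dot b) Er.
have Ei1 := congr1 (dot a) Ei; have Ei2 := congr1 (dot b) Ei.
move: Er1 Er2 Ei1 Ei2; rewrite !linearB !linearD /= !dotZr -!qformE.
rewrite (sym b a A sA) (sym b a B sB).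
move: (boundB a) (boundB b) m0.
case: c E {Er Ei} => x y _ /=.
move: (qform B a) (qform B b) (dot a (B *m b)) (dot a (A *m b)) (qform A a) (qform A b).
move=> ba bb bab aab aa ab ha hb m0 e1 e2 e3 e4.
have y0 : y = 0.
  have : y * (aa + ab) = 0 by lra.
  by move/eqP; rewrite mulf_eq0 (gt_eqF m0) orbF => /eqP.
have xE : x * (aa + ab) = ba + bb by lra.
rewrite y0 expr0n addr0 sqrtr_sqr -(ler_pM2r m0) -{1}(gtr0_norm m0) -normrM xE.
by apply: le_trans (ler_normD _ _) _; rewrite mulrDr lerD.
Qed.

(** Let w be a row eigenvector for c <> 0. Multiplying its equation by Z shows that f = w Z A^-1
    satisfies f B = - c f A, so c is bounded through the pencil. Conversely v^T W is a row
    eigenvector for - s k, unless it is zero. *)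
Lemma spectral_radius_generalized (s : R) (v : 'cV[R]_d)
    (Z : 'M[R]_(n, d)) (W : 'M[R]_(d, n)) :
  (0 < n)%N -> A \in unitmx -> W *m Z = B ->
  v != 0 -> `|s| = 1 -> B *m v = (s * k) *: (A *m v) ->
  spectral_radius_is (- (Z *m invmx A *m W)) k.
Proof.
move=> n0 uA WZ v0 s1 Bv; set J := - _.
have k0 : 0 <= k.
  have := boundB v; have := pA v0; have := normr_ge0 (qform B v).
  by move=> h1 h2 /(le_trans h1); rewrite pmulr_lge0.
have ub c : eigenvalue (map_mx rc J) c -> normc c <= k.
  case/eigenvalueP => w Ew w0.
  have [->|c0] := eqVneq c 0; first by rewrite /= expr0n addr0 sqrtr0.
  set g := w *m map_mx rc Z.
  have wE : c *: w = - (g *m map_mx rc (invmx A) *m map_mx rc W).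
    by rewrite -Ew /J map_mxN !map_mxM mulmxN !mulmxA.
  have g0 : g != 0.
    apply: contraNneq w0 => g0; move: wE; rewrite g0 !mul0mx oppr0 => /eqP.
    by rewrite scaler_eq0 (negbTE c0).
  pose f := g *m map_mx rc (invmx A).
  have fA : f *m map_mx rc A = g.
    by rewrite /f -mulmxA -map_mxM mulVmx // map_mx1 mulmx1.
  have -> : normc c = normc (- c) by case: (c) => x y /=; rewrite !sqrrN.
  apply: (@generalized_eigenvalue_bound _ f).
    by apply: contraNneq g0 => f0; rewrite -fA f0 mul0mx.
  rewrite fA scaleNr /g scalemxAl wE -/f -WZ map_mxM mulmxA.
  by rewrite mulNmx opprK.
split=> //.
pose u := v^T *m W.
have vB : v^T *m B = (s * k) *: (v^T *m A).
  by rewrite -[B]sB -trmx_mul Bv linearZ /= trmx_mul sA.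
have uJ : u *m J = (- (s * k)) *: u.
  rewrite /J mulmxN !mulmxA /u -(mulmxA v^T) WZ vB -!scalemxAl.
  by rewrite -(mulmxA v^T) mulmxV // mulmx1 scaleNr.
have [u0|u0] := eqVneq u 0; last first.
  exists (rc (- (s * k))).
    apply/eigenvalueP; exists (map_mx rc u); first by rewrite -map_mxM uJ map_mxZ.
    by rewrite map_mx_eq0.
  by rewrite normc_real normrN normrM s1 mul1r ger0_norm.
(* Here k = 0, so that any eigenvalue attains the bound. *)
have [c ec] := eigenvalue_closed (map_mx rc J) n0.
exists c => //; apply/eqP; rewrite eq_le ub //=.
suff -> : k = 0 by exact: normc_ge0.
have /eqP : (s * k) *: (v^T *m A) = 0 by rewrite -vB -WZ mulmxA -/u u0 mul0mx.
rewrite scaler_eq0 mulf_eq0 => /orP[/orP[/eqP s0|/eqP //]|/eqP vA0].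
  by move: s1; rewrite s0 normr0 => /esym/eqP; rewrite oner_eq0.
by have := pA v0; rewrite /qform vA0 mul0mx mxE ltxx.
Qed.

End generalized.

(** Row eigenvectors are carried over by w T in one direction and by w S in the other. Only the
    eigenvalue 0 can be new, and it does not exceed k since k is an attained modulus. *)
Lemma spectral_radius_compression m n (A : 'M[R]_n) (T : 'M[R]_(m, n)) (S : 'M[R]_(n, m)) k :
  S *m T = 1%:M -> spectral_radius_is A k -> spectral_radius_is (T *m A *m S) k.
Proof.
move=> ST [ub [c ec nc]].
have STc : map_mx rc S *m map_mx rc T = 1%:M by rewrite -map_mxM ST map_mx1.
split.
  move=> c' /eigenvalueP[w Ew w0].
  have [->|c0] := eqVneq c' 0.
    by rewrite /= expr0n addr0 sqrtr0 -nc normc_ge0.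
  apply: ub; apply/eigenvalueP; exists (w *m map_mx rc T).
    rewrite scalemxAl -Ew !map_mxM -!mulmxA STc mulmx1 //.
  apply: contraNneq w0 => wT0; move: Ew.
  rewrite !map_mxM !mulmxA wT0 !mul0mx => /esym/eqP.
  by rewrite scaler_eq0 (negbTE c0).
case/eigenvalueP: ec => w Ew w0; exists c => //.
apply/eigenvalueP; exists (w *m map_mx rc S).
  by rewrite !map_mxM !mulmxA -(mulmxA w) STc mulmx1 Ew scalemxAl.
apply: contraNneq w0 => wS0.
by rewrite -[w]mulmx1 -STc mulmxA wS0 mul0mx.
Qed.

End spectral.

(** * Stacked trajectories *)

Section blocks.
Variables (R : realType) (N nx nu : nat).
Notation xvec := 'cV[R]_(\sum_(i < N.+1) nx).
Notation uvec := 'cV[R]_(\sum_(i < N) nu).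
Notation wvec := 'cV[R]_(\sum_(i < N.+1) nx + \sum_(i < N) nu).

Definition xblk (k : 'I_N.+1) (x : xvec) : 'cV[R]_nx :=
  @submxcol R N.+1 (fun=> nx) 1 x k.
Definition ublk (i : 'I_N) (u : uvec) : 'cV[R]_nu :=
  @submxcol R N (fun=> nu) 1 u i.

Lemma xblk_linear k : linear (xblk k).
Proof. by move=> a x y; apply/matrixP => i j; rewrite !mxE. Qed.
HB.instance Definition _ k := GRing.isLinear.Build R xvec 'cV[R]_nx _ (xblk k) (xblk_linear k).

Lemma ublk_linear k : linear (ublk k).
Proof. by move=> a x y; apply/matrixP => i j; rewrite !mxE. Qed.
HB.instance Definition _ k := GRing.isLinear.Build R uvec 'cV[R]_nu _ (ublk k) (ublk_linear k).

(** [st] and [ct] with the trajectory as last argument, so that a linear structure can be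
    attached. *)
Definition stl (k : 'I_N.+1) (w : wvec) : 'cV[R]_nx := st w k.
Definition ctl (i : 'I_N) (w : wvec) : 'cV[R]_nu := ct w i.

Lemma stl_linear k : linear (stl k).
Proof. by move=> a x y; apply/matrixP => i j; rewrite !mxE. Qed.
HB.instance Definition _ k := GRing.isLinear.Build R wvec 'cV[R]_nx _ (stl k) (stl_linear k).

Lemma ctl_linear k : linear (ctl k).
Proof. by move=> a x y; apply/matrixP => i j; rewrite !mxE. Qed.
HB.instance Definition _ k := GRing.isLinear.Build R wvec 'cV[R]_nu _ (ctl k) (ctl_linear k).

Definition stage (i : 'I_N) (w : wvec) : 'cV[R]_(nx + nu) :=
  col_mx (st w (cur i)) (ct w i).

Lemma stage_linear i : linear (stage i).
Proof.
move=> a x y; rewrite /stage -[st _ _]/(stl _ _) -[ct _ _]/(ctl _ _) !linearP.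
by rewrite -add_col_mx scale_col_mx.
Qed.
HB.instance Definition _ i := GRing.isLinear.Build R wvec 'cV[R]_(nx + nu) _ (stage i) (stage_linear i).

Lemma xblkP (x y : xvec) : (forall k, xblk k x = xblk k y) -> x = y.
Proof. by move=> h; apply/mxcolP => k; exact: h. Qed.

Lemma ublkP (x y : uvec) : (forall k, ublk k x = ublk k y) -> x = y.
Proof. by move=> h; apply/mxcolP => k; exact: h. Qed.

Lemma wvecP (w z : wvec) :
  (forall k, st w k = st z k) -> (forall i, ct w i = ct z i) -> w = z.
Proof.
move=> hs hc; rewrite -[w]vsubmxK -[z]vsubmxK; congr col_mx.
- by apply: xblkP => k; exact: hs.
- by apply: ublkP => k; exact: hc.
Qed.

Lemma ord_cases (Q : 'I_N.+1 -> Prop) :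
  Q ord0 -> (forall i, Q (nxt i)) -> forall k, Q k.
Proof. by move=> q0 q1 k; case: (unliftP ord0 k) => [j ->|-> //]; exact: q1. Qed.

Lemma xblk_stack0 b0 b : xblk ord0 (@stack_cons R N nx b0 b) = b0.
Proof. by rewrite /xblk /stack_cons mxcolK unlift_none. Qed.

Lemma xblk_stackS b0 b i : xblk (nxt i) (@stack_cons R N nx b0 b) = b i.
Proof. by rewrite /xblk /stack_cons mxcolK /nxt liftK. Qed.

Lemma xblk_mxcol (b : 'I_N.+1 -> 'cV[R]_nx) k :
  xblk k (@mxcol R N.+1 (fun=> nx) 1 b) = b k.
Proof. by rewrite /xblk mxcolK. Qed.

Lemma ublk_mxcol (b : 'I_N -> 'cV[R]_nu) k :
  ublk k (@mxcol R N (fun=> nu) 1 b) = b k.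
Proof. by rewrite /ublk mxcolK. Qed.

Lemma stack_cons_eq0 b0 b : @stack_cons R N nx b0 b = 0 <-> b0 = 0 /\ forall i, b i = 0.
Proof.
split=> [E|[E0 E]].
  split=> [|i]; [rewrite -(xblk_stack0 b0 b)|rewrite -(xblk_stackS b0 b i)];
    by rewrite E linear0.
apply: xblkP; apply: ord_cases => [|i]; rewrite linear0 ?xblk_stack0 ?xblk_stackS //.
Qed.

Lemma umxcol_eq0 (b : 'I_N -> 'cV[R]_nu) :
  @mxcol R N (fun=> nu) 1 b = 0 <-> forall i, b i = 0.
Proof.
split=> [E i|E]; first by rewrite -(ublk_mxcol b i) E linear0.
by apply: ublkP => i; rewrite linear0 ublk_mxcol.
Qed.

Lemma dot_blocks (x y : xvec) : dot x y = \sum_k dot (xblk k x) (xblk k y).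
Proof.
rewrite /dot -[x in LHS](@submxcolK R N.+1 (fun=> nx)) -[y in LHS](@submxcolK R N.+1 (fun=> nx)).
by rewrite tr_mxcol mul_mxrow_mxcol summxE.
Qed.

(** Forward simulation gives existence and uniqueness at once. It underlies the solvability of all
    three residual equations and the injectivity of their linear parts. *)
Lemma forward_sweep (x0 : 'cV[R]_nx) (phi : 'I_N -> 'cV[R]_nx -> 'cV[R]_nu -> 'cV[R]_nx)
    (psi : 'I_N -> 'cV[R]_nx -> 'cV[R]_nu) :
  exists w0 : wvec, forall w,
    [/\ st w ord0 = x0, forall i, st w (nxt i) = phi i (st w (cur i)) (ct w i) &
        forall i, ct w i = psi i (st w (cur i))] <-> w = w0.
Proof.
(* The trajectory is built over all natural numbers; the default [x0] occurs only for k >= N, beyond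
   the last stage. *)
pose step k x := if insub k is Some i then phi i x (psi i x) else x0.
pose traj := fix traj k := if k is k'.+1 then step k' (traj k') else x0.
pose w0 : wvec := col_mx (@mxcol R N.+1 (fun=> nx) 1 (fun k => traj k))
   (@mxcol R N (fun=> nu) 1 (fun i => psi i (traj i))).
have st0 k : st w0 k = traj k by rewrite /st /w0 col_mxKu mxcolK.
have ct0 i : ct w0 i = psi i (traj i) by rewrite /ct /w0 col_mxKd mxcolK.
have trajS (i : 'I_N) : traj i.+1 = phi i (traj i) (psi i (traj i)).
  by rewrite /= /step valK.
exists w0 => w; split=> [[h0 h1 h2]|->].
  have hst : forall k, st w k = traj k.
    move=> [k hk]; elim: k hk => [|k IH] hk /=.
      by rewrite -h0; congr (st w _); apply: val_inj.
    have kN : (k < N)%N by [].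
    have -> : Ordinal hk = nxt (Ordinal kN) by apply: val_inj.
    have E : st w (cur (Ordinal kN)) = traj k.
      by rewrite -(IH (ltnW hk)); congr (st w _); apply: val_inj.
    by rewrite h1 h2 E -trajS.
  by apply: wvecP => [k|i]; rewrite ?hst ?st0 // ct0 h2 hst.
split=> [|i|i]; rewrite ?st0 ?ct0 //.
by rewrite -trajS; congr (traj _).
Qed.

Lemma forward_unique (w z : wvec) (phi : 'I_N -> 'cV[R]_nx -> 'cV[R]_nu -> 'cV[R]_nx)
    (psi : 'I_N -> 'cV[R]_nx -> 'cV[R]_nu) :
  st w ord0 = st z ord0 ->
  (forall i, st w (nxt i) = phi i (st w (cur i)) (ct w i)) ->
  (forall i, st z (nxt i) = phi i (st z (cur i)) (ct z i)) ->
  (forall i, ct w i = psi i (st w (cur i))) ->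
  (forall i, ct z i = psi i (st z (cur i))) -> w = z.
Proof.
move=> h0 h1 h2 h3 h4; have [w0 E] := forward_sweep (st z ord0) phi psi.
by rewrite (proj1 (E w)) // (proj1 (E z)).
Qed.

End blocks.

(** * The Riccati recursion *)

Section riccati.
Variables (R : realType) (N nx nu : nat) (P : ocp R N nx nu).
Notation xvec := 'cV[R]_(\sum_(i < N.+1) nx).
Notation uvec := 'cV[R]_(\sum_(i < N) nu).
Notation wvec := 'cV[R]_(\sum_(i < N.+1) nx + \sum_(i < N) nu).

Section one_stage.
Variables (wb : wvec) (i : 'I_N) (Pp : 'M[R]_nx * 'cV[R]_nx).
Hypothesis symP : Pp.1^T = Pp.1.
Hypothesis symS : (stage_hess P wb i)^T = stage_hess P wb i.
Hypothesis unitH : ric_H P wb i Pp \in unitmx.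
Variables (x xn : 'cV[R]_nx) (u : 'cV[R]_nu).

Local Notation A := (lin_A P wb i).
Local Notation B := (lin_B P wb i).
Local Notation Q := (hess_Q P wb i).
Local Notation S := (hess_S P wb i).
Local Notation Ru := (hess_R P wb i).
Local Notation H := (ric_H P wb i Pp).
Local Notation K := (ric_K P wb i Pp).
Local Notation C := (S + B^T *m Pp.1 *m A).
Local Notation g := (ric_g P wb i Pp).

Definition dyn_defect : 'cV[R]_nx := xn - (A *m x + B *m u + lin_a P wb i).
Definition fb_defect : 'cV[R]_nu := u - (ric_kappa P wb i Pp + K *m x).

Lemma ric_HK : H *m K = - C.
Proof. by rewrite /ric_K mulmxN mulmxA mulmxV // mul1mx. Qed.

Lemma ric_Hkappa : H *m ric_kappa P wb i Pp = - g.
Proof. by rewrite /ric_kappa mulmxN mulmxA mulmxV // mul1mx. Qed.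

Lemma hess_Q_sym : Q^T = Q.
Proof. by rewrite /hess_Q trmx_ulsub symS. Qed.

Lemma hess_R_sym : Ru^T = Ru.
Proof. by rewrite /hess_R trmx_drsub symS. Qed.

Lemma ric_H_sym : H^T = H.
Proof.
by rewrite /ric_H linearD /= hess_R_sym !trmx_mul trmxK symP mulmxA.
Qed.

(** Inserting K turns the step into a Schur complement, which is visibly symmetric. *)
Lemma ric_step_sym : (ric_step P wb i Pp).1^T = (ric_step P wb i Pp).1.
Proof.
have -> : (ric_step P wb i Pp).1 =
    Q + A^T *m Pp.1 *m A - C^T *m invmx H *m C.
  have CT : C^T = S^T + A^T *m Pp.1 *m B.
    by rewrite linearD /= !trmx_mul trmxK symP mulmxA.
  by rewrite /ric_step /= /ric_K mulmxN mulmxA -CT.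
rewrite linearB linearD /= hess_Q_sym !trmx_mul !trmxK symP trmx_inv ric_H_sym.
by rewrite !mulmxA.
Qed.

(** The left-hand side is the u-gradient of the quadratic stage cost plus the cost-to-go at [xn]. K
    and kappa solve H u + C x + g = 0, so only the defects survive. *)
Lemma stage_control_residual :
  grad_r P wb i + S *m x + Ru *m u + B^T *m (Pp.1 *m xn + Pp.2) =
  H *m fb_defect + B^T *m (Pp.1 *m dyn_defect).
Proof.
have -> : H *m fb_defect = H *m u + g + C *m x.
  rewrite /fb_defect mulmxBr mulmxDr ric_Hkappa mulmxA ric_HK mulNmx.
  by rewrite opprD !opprK addrA.
have -> : B^T *m (Pp.1 *m xn + Pp.2) = B^T *m (Pp.1 *m dyn_defect) +
    B^T *m Pp.1 *m A *m x + B^T *m Pp.1 *m B *m u +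
    B^T *m (Pp.1 *m lin_a P wb i + Pp.2).
  have E : xn = dyn_defect + (A *m x + B *m u + lin_a P wb i) by rewrite subrK.
  by rewrite [in LHS]E !mulmxDr !mulmxA !addrA.
rewrite /ric_H /ric_g !mulmxDl.
(* With every product generalised to a variable, an additive identity remains, checked entry by
   entry. *)
move: (Ru *m u) (S *m x) (grad_r P wb i) (B^T *m (Pp.1 *m dyn_defect)).
move: (B^T *m Pp.1 *m A *m x) (B^T *m Pp.1 *m B *m u).
move: (B^T *m (Pp.1 *m lin_a P wb i + Pp.2)) => v1 v2 v3 v4 v5 v6 v7.
by apply/matrixP => k l; rewrite !mxE; ring.
Qed.

(** The x-gradient reproduces the costate P_i x + p_i of the preceding state. The term C^T u is
    eliminated through K^T H = - C^T, which needs the symmetry of H. *)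
Lemma stage_state_residual :
  grad_q P wb i + Q *m x + S^T *m u + A^T *m (Pp.1 *m xn + Pp.2) =
  (ric_step P wb i Pp).1 *m x + (ric_step P wb i Pp).2 +
    (A^T *m (Pp.1 *m dyn_defect) - K^T *m (H *m fb_defect)).
Proof.
have CT : C^T = S^T + A^T *m Pp.1 *m B.
  by rewrite linearD /= !trmx_mul trmxK symP mulmxA.
have KH : K^T *m H = - C^T.
  by rewrite -[H]ric_H_sym -trmx_mul ric_HK linearN.
have Hd : H *m fb_defect = H *m u + g + C *m x.
  rewrite /fb_defect mulmxBr mulmxDr ric_Hkappa mulmxA ric_HK mulNmx.
  by rewrite opprD !opprK addrA.
have KC : K^T *m C = C^T *m K.
  by rewrite -[C in LHS]opprK -ric_HK mulmxN mulmxA KH mulNmx opprK.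
have -> : K^T *m (H *m fb_defect) =
    - (S^T *m u + A^T *m Pp.1 *m B *m u) + K^T *m g + C^T *m K *m x.
  by rewrite Hd !mulmxDr [K^T *m (H *m u)]mulmxA KH mulNmx [K^T *m (C *m x)]mulmxA KC CT mulmxDl.
have -> : A^T *m (Pp.1 *m xn + Pp.2) = A^T *m (Pp.1 *m dyn_defect) +
    A^T *m Pp.1 *m A *m x + A^T *m Pp.1 *m B *m u +
    A^T *m (Pp.1 *m lin_a P wb i + Pp.2).
  have E : xn = dyn_defect + (A *m x + B *m u + lin_a P wb i) by rewrite subrK.
  by rewrite [in LHS]E !mulmxDr !mulmxA !addrA.
rewrite /ric_step /= -CT !mulmxDl.
move: (A^T *m (Pp.1 *m dyn_defect)) (C^T *m K *m x) (K^T *m g) (S^T *m u) (Q *m x).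
move: (A^T *m Pp.1 *m A *m x) (A^T *m Pp.1 *m B *m u) (grad_q P wb i).
move: (A^T *m (Pp.1 *m lin_a P wb i + Pp.2)) => v1 v2 v3 v4 v5 v6 v7 v8 v9.
by apply/matrixP => k l; rewrite !mxE; ring.
Qed.

End one_stage.
End riccati.

(** * Derivatives of the cost and of the constraints *)

Section column_embeddings.
Variables (R : realType) (a b : nat).

Definition col_l (z : 'cV[R]_a) : 'cV[R]_(a + b) := col_mx z 0.
Definition col_r (z : 'cV[R]_b) : 'cV[R]_(a + b) := col_mx 0 z.

Lemma col_l_linear : linear col_l.
Proof. by move=> k y z; rewrite /col_l scale_col_mx add_col_mx scaler0 addr0. Qed.
HB.instance Definition _ := GRing.isLinear.Build R 'cV[R]_a 'cV[R]_(a + b) _ col_l col_l_linear.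

Lemma col_r_linear : linear col_r.
Proof. by move=> k y z; rewrite /col_r scale_col_mx add_col_mx scaler0 addr0. Qed.
HB.instance Definition _ := GRing.isLinear.Build R 'cV[R]_b 'cV[R]_(a + b) _ col_r col_r_linear.

End column_embeddings.

Section partial_derivatives.
Variables (R : realType) (a b : nat) (W : normedModType R).
Variables (f : 'cV[R]_a -> 'cV[R]_b -> W) (x : 'cV[R]_a) (u : 'cV[R]_b).

Lemma derive_on_stack_l v : 'D_(col_mx v 0) (on_stack f) (col_mx x u) = 'D_v (f ^~ u) x.
Proof.
rewrite /derive (_ : (fun h => _) =
  (fun h => h^-1 *: (((f ^~ u) \o shift x) (h *: v) - f x u))) //.
apply/funext => h /=.
by rewrite /on_stack scale_col_mx add_col_mx scaler0 add0r !col_mxKu !col_mxKd.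
Qed.

Lemma derive_on_stack_r v : 'D_(col_mx 0 v) (on_stack f) (col_mx x u) = 'D_v (f x) u.
Proof.
rewrite /derive (_ : (fun h => _) =
  (fun h => h^-1 *: ((f x \o shift u) (h *: v) - f x u))) //.
apply/funext => h /=.
by rewrite /on_stack scale_col_mx add_col_mx scaler0 add0r !col_mxKu !col_mxKd.
Qed.

Hypothesis df : differentiable (on_stack f) (col_mx x u).

Lemma differentiable_partial_l : differentiable (f ^~ u) x.
Proof.
have -> : f ^~ u = on_stack f \o (fun z => col_l b z + col_mx 0 u).
  by apply/funext => z; rewrite /= /on_stack add_col_mx addr0 add0r col_mxKu col_mxKd.
apply: differentiable_comp.
  by apply: differentiable_affine; exact: mx_linear_continuous.
by rewrite add_col_mx addr0 add0r.
Qed.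

Lemma differentiable_partial_r : differentiable (f x) u.
Proof.
have -> : f x = on_stack f \o (fun z => col_r a z + col_mx x 0).
  by apply/funext => z; rewrite /= /on_stack add_col_mx addr0 add0r col_mxKu col_mxKd.
apply: differentiable_comp.
  by apply: differentiable_affine; exact: mx_linear_continuous.
by rewrite add_col_mx addr0 add0r.
Qed.

Lemma derive_on_stack v1 v2 : 'D_(col_mx v1 v2) (on_stack f) (col_mx x u) =
  'D_v1 (f ^~ u) x + 'D_v2 (f x) u.
Proof.
rewrite -derive_on_stack_l -derive_on_stack_r.
have -> : col_mx v1 v2 = col_mx v1 0 + col_mx 0 v2 by rewrite add_col_mx addr0 add0r.
by rewrite !deriveE // linearD.
Qed.

End partial_derivatives.

Section ocp_derivatives.
Variables (R : realType) (N nx nu : nat) (P : ocp R N nx nu).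
Notation xvec := 'cV[R]_(\sum_(i < N.+1) nx).
Notation uvec := 'cV[R]_(\sum_(i < N) nu).
Notation wvec := 'cV[R]_(\sum_(i < N.+1) nx + \sum_(i < N) nu).

Lemma stage_continuous i : continuous (@stage R N nx nu i).
Proof. exact: mx_linear_continuous. Qed.

Lemma stl_continuous k : continuous (@stl R N nx nu k).
Proof. exact: mx_linear_continuous. Qed.

Lemma smooth_data_near w : smooth_data P w -> \forall z \near w, smooth_data P z.
Proof.
move=> [h1 h2 h3].
have n1 : \forall z \near w, forall i, C2_near (on_stack (dyn P i)) (stage i z).
  apply: (@filter_forall _ _ (fun i z => C2_near (on_stack (dyn P i)) (stage i z)) (nbhs w)) => i.
  exact: C2_near_preimage (@stage_continuous i) (h1 i).
have n2 : \forall z \near w, forall i, C2_near (on_stack (cost P i)) (stage i z).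
  apply: (@filter_forall _ _ (fun i z => C2_near (on_stack (cost P i)) (stage i z)) (nbhs w)) => i.
  exact: C2_near_preimage (@stage_continuous i) (h2 i).
have n3 : \forall z \near w, C2_near (fcost P) (stl ord_max z).
  exact: C2_near_preimage (@stl_continuous ord_max) h3.
by apply: filterS3 n1 n2 n3.
Qed.

Lemma V_sum : V P =
  \sum_i (on_stack (cost P i) \o @stage R N nx nu i) + (fcost P \o @stl R N nx nu ord_max).
Proof.
apply/funext => w; rewrite -[RHS]/((\sum_i _) w + fcost P (st w ord_max)) fct_sumE.
congr (_ + _); apply: eq_bigr => i _.
by rewrite /= /on_stack /stage col_mxKu col_mxKd.
Qed.

(** Linear insertion of one block. It lets stacked maps be written as sums of composites, the shape
    to which the closure properties of [C2_near] and of limits apply. *)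
Definition put_block (k : 'I_N.+1) (c : 'cV[R]_nx) : xvec :=
  @mxcol R N.+1 (fun=> nx) 1 (fun j => if j == k then c else 0).

Lemma xblk_put k j c : xblk j (put_block k c) = if j == k then c else 0.
Proof. exact: xblk_mxcol. Qed.

Lemma put_block_linear k : linear (put_block k).
Proof.
by move=> a x y; apply: xblkP => j; rewrite linearP /= !xblk_put; case: ifP;
  rewrite ?scaler0 ?addr0.
Qed.
HB.instance Definition _ k :=
  GRing.isLinear.Build R 'cV[R]_nx xvec _ (put_block k) (put_block_linear k).

Definition neg_states (w : wvec) : xvec := - usubmx w.

Lemma neg_states_linear : linear neg_states.
Proof. by move=> a x y; rewrite /neg_states linearP /= opprD scalerN. Qed.
HB.instance Definition _ :=
  GRing.isLinear.Build R wvec xvec _ neg_states neg_states_linear.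

Lemma F_sum : F P =
  \sum_i (put_block (nxt i) \o (on_stack (dyn P i) \o @stage R N nx nu i)) +
  (neg_states + cst (put_block ord0 (xinit P))).
Proof.
apply/funext => w.
rewrite -[RHS]/((\sum_i _) w + (- usubmx w + put_block ord0 (xinit P))) fct_sumE.
apply: xblkP; apply: ord_cases => [|i].
  rewrite xblk_stack0 !linearD linear_sum linearN /= big1 => [|i _].
    by rewrite add0r xblk_put eqxx addrC.
  by rewrite xblk_put -val_eqE.
rewrite xblk_stackS !linearD linear_sum linearN /= xblk_put -val_eqE /= addr0.
congr (_ - _); rewrite (bigD1 i) //= big1 => [|j ji]; rewrite xblk_put.
  by rewrite eqxx addr0 /on_stack /stage col_mxKu col_mxKd.
case: eqP => // /(@lift_inj _ ord0) E.
by rewrite E eqxx in ji.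
Qed.

Lemma V_C2 w : smooth_data P w -> C2_near (V P) w.
Proof.
move=> [h1 h2 h3]; rewrite V_sum; apply: C2_nearD.
  apply: C2_near_sum => i; apply: C2_near_comp_linear; last exact: h2.
  exact: stage_continuous.
by apply: C2_near_comp_linear; [exact: stl_continuous | exact: h3].
Qed.

Lemma F_C2 w : smooth_data P w -> C2_near (F P) w.
Proof.
move=> [h1 h2 h3]; rewrite F_sum; apply: C2_nearD.
  apply: C2_near_sum => i; apply: C2_near_linear_comp; first exact: mx_linear_continuous.
  by apply: C2_near_comp_linear; [exact: stage_continuous | exact: h1].
apply: C2_nearD; last exact: C2_near_cst.
by apply: C2_near_linear; exact: mx_linear_continuous.
Qed.

Section at_point.
Variable w : wvec.
Hypothesis sm : smooth_data P w.

Lemma stage_cost_C2 i : C2_near (on_stack (cost P i)) (col_mx (st w (cur i)) (ct w i)).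
Proof. by case: sm. Qed.

Lemma stage_dyn_C2 i : C2_near (on_stack (dyn P i)) (col_mx (st w (cur i)) (ct w i)).
Proof. by case: sm. Qed.

Lemma fcost_C2 : C2_near (fcost P) (st w ord_max).
Proof. by case: sm. Qed.

Lemma stage_hess_sym i : (stage_hess P w i)^T = stage_hess P w i.
Proof. exact: hess_sym (stage_cost_C2 i). Qed.

Lemma term_P_sym : (term_P P w)^T = term_P P w.
Proof. exact: hess_sym fcost_C2. Qed.

Lemma lin_mul i vx vu : lin_A P w i *m vx + lin_B P w i *m vu =
  'D_(col_mx vx vu) (on_stack (dyn P i)) (stage i w).
Proof.
have df := C2_near_diff (stage_dyn_C2 i).
rewrite /lin_A /lin_B jac_mul; last exact: differentiable_partial_l df.
rewrite jac_mul; last exact: differentiable_partial_r df.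
by rewrite derive_on_stack.
Qed.

Lemma cost_grad_dot i vx vu :
  dot vx (grad (cost P i ^~ (ct w i)) (st w (cur i))) +
  dot vu (grad (cost P i (st w (cur i))) (ct w i)) =
  'D_(col_mx vx vu) (on_stack (cost P i)) (stage i w).
Proof.
have df := C2_near_diff (stage_cost_C2 i).
rewrite derive_on_stack //; congr (_ + _); apply: grad_dot.
  exact: differentiable_partial_l df.
exact: differentiable_partial_r df.
Qed.

Lemma cost_hess_dot i vx vu dx du :
  dot vx (hess_Q P w i *m dx + (hess_S P w i)^T *m du) +
  dot vu (hess_S P w i *m dx + hess_R P w i *m du) =
  'D_(col_mx dx du) ('D_(col_mx vx vu) (on_stack (cost P i))) (stage i w).
Proof.
rewrite -hess_mul; last exact: stage_cost_C2.
rewrite -[hess _ _]/(stage_hess P w i) -mulmxA.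
rewrite -[in RHS](submxK (stage_hess P w i)) mul_block_col.
rewrite tr_col_mx mul_row_col mxE /hess_S trmx_dlsub stage_hess_sym //.
Qed.

Lemma derive_V v : 'D_v (V P) w =
  \sum_i (dot (st v (cur i)) (grad (cost P i ^~ (ct w i)) (st w (cur i))) +
          dot (ct v i) (grad (cost P i (st w (cur i))) (ct w i))) +
  dot (st v ord_max) (grad (fcost P) (st w ord_max)).
Proof.
have dc i : differentiable (on_stack (cost P i) \o @stage R N nx nu i) w.
  apply: differentiable_comp_linear; first exact: stage_continuous.
  exact: C2_near_diff (stage_cost_C2 i).
have dt : differentiable (fcost P \o @stl R N nx nu ord_max) w.
  apply: differentiable_comp_linear; first exact: stl_continuous.
  exact: C2_near_diff fcost_C2.
rewrite V_sum deriveD; [|exact/diff_derivable/differentiable_sum|exact: diff_derivable].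
rewrite derive_sum_diff //; congr (_ + _).
  by apply: eq_bigr => i _; rewrite cost_grad_dot derive_comp_linear.
rewrite derive_comp_linear; apply/esym/grad_dot.
exact: C2_near_diff fcost_C2.
Qed.

Lemma derive2_V v d : 'D_d ('D_v (V P)) w =
  \sum_i (dot (st v (cur i)) (hess_Q P w i *m st d (cur i) + (hess_S P w i)^T *m ct d i) +
          dot (ct v i) (hess_S P w i *m st d (cur i) + hess_R P w i *m ct d i)) +
  dot (st v ord_max) (term_P P w *m st d ord_max).
Proof.
have dc i : C2_near (on_stack (cost P i) \o @stage R N nx nu i) w.
  by apply: C2_near_comp_linear; [exact: stage_continuous|exact: stage_cost_C2].
have dt : C2_near (fcost P \o @stl R N nx nu ord_max) w.
  by apply: C2_near_comp_linear; [exact: stl_continuous|exact: fcost_C2].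
rewrite V_sum derive2D; [|exact: C2_near_sum|exact: dt].
rewrite (derive2_sum _ _ dc); congr (_ + _).
  apply: eq_bigr => i _.
  by rewrite cost_hess_dot derive_comp_linear_fun derive_comp_linear.
rewrite derive_comp_linear_fun derive_comp_linear -hess_mul; last exact: fcost_C2.
by rewrite -mulmxA.
Qed.

Lemma derive_F v : 'D_v (F P) w =
  stack_cons (- st v ord0)
    (fun i => lin_A P w i *m st v (cur i) + lin_B P w i *m ct v i - st v (nxt i)).
Proof.
have dF := C2_near_diff (F_C2 sm).
have xD k : xblk k ('D_v (F P) w) = 'D_v (xblk k \o F P) w.
  by rewrite (derive_linear_comp _ _ dF) //; exact: mx_linear_continuous.
apply: xblkP; apply: ord_cases => [|i]; rewrite xD ?xblk_stack0 ?xblk_stackS.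
  have -> : xblk ord0 \o F P = cst (xinit P) - (@stl R N nx nu ord0 : _ -> _).
    by apply/funext => z; rewrite /= xblk_stack0.
  rewrite deriveB; first last.
  - exact/diff_derivable/linear_differentiable/stl_continuous.
  - exact/diff_derivable/differentiable_cst.
  by rewrite derive_cst derive_of_linear sub0r.
have -> : xblk (nxt i) \o F P = (on_stack (dyn P i) \o @stage R N nx nu i) - (@stl R N nx nu (nxt i) : _ -> _).
  apply/funext => z; rewrite /= xblk_stackS.
  by rewrite -[RHS]/(on_stack (dyn P i) (stage i z) - st z (nxt i)) /on_stack /stage col_mxKu col_mxKd.
rewrite deriveB; first last.
- exact/diff_derivable/linear_differentiable/stl_continuous.
- apply/diff_derivable/differentiable_comp_linear; first exact: stage_continuous.
  exact: C2_near_diff (stage_dyn_C2 i).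
by rewrite derive_of_linear derive_comp_linear lin_mul.
Qed.

End at_point.
End ocp_derivatives.

(** * The Riccati identity *)

Section riccati_identity.
Variables (R : realType) (N nx nu : nat) (P : ocp R N nx nu).
Notation xvec := 'cV[R]_(\sum_(i < N.+1) nx).
Notation uvec := 'cV[R]_(\sum_(i < N) nu).
Notation wvec := 'cV[R]_(\sum_(i < N.+1) nx + \sum_(i < N) nu).

Definition costate (wb w : wvec) : xvec :=
  @mxcol R N.+1 (fun=> nx) 1 (fun k => (ric P wb k).1 *m st w k + (ric P wb k).2).

Definition dyn_err (wb w : wvec) (i : 'I_N) : 'cV[R]_nx :=
  dyn_defect P wb i (st w (cur i)) (st w (nxt i)) (ct w i).
Definition fb_err (wb w : wvec) (i : 'I_N) : 'cV[R]_nu :=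
  fb_defect P wb i (ric P wb i.+1) (st w (cur i)) (ct w i).

(** The defect terms of [stage_state_residual] and [stage_control_residual], paired with v and
    summed over the stages. *)
Definition ric_remainder (wb w v : wvec) : R :=
  \sum_(i < N) (dot (st v (cur i))
       ((lin_A P wb i)^T *m ((ric P wb i.+1).1 *m dyn_err wb w i) -
        (fb_K P wb i)^T *m (ric_H P wb i (ric P wb i.+1) *m fb_err wb w i)) +
     dot (ct v i)
       (ric_H P wb i (ric P wb i.+1) *m fb_err wb w i +
        (lin_B P wb i)^T *m ((ric P wb i.+1).1 *m dyn_err wb w i))).

Lemma stB (w z : wvec) k : st (w - z) k = st w k - st z k.
Proof. exact: (linearB (@stl R N nx nu k)). Qed.

Lemma ctB (w z : wvec) i : ct (w - z) i = ct w i - ct z i.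
Proof. exact: (linearB (@ctl R N nx nu i)). Qed.

Variable wb : wvec.
Hypothesis sm : smooth_data P wb.
Hypothesis rr : riccati_regular P wb.

Lemma ric_sym k : (k <= N)%N -> (ric P wb k).1^T = (ric P wb k).1.
Proof.
(* Backward induction: m counts the stages from the end of the horizon. *)
move=> kN; rewrite -(subKn kN); move: (N - k)%N (leq_subr k N) => m.
elim: m => [|m IH] mN; first by rewrite subn0 ricN; exact: term_P_sym.
have lt : (N - m.+1 < N)%N by rewrite ltn_subrL (leq_trans _ mN).
rewrite -[(N - m.+1)%N]/(nat_of_ord (Ordinal lt)) ricE /=.
rewrite subnSK //; apply: ric_step_sym.
- exact: (IH (ltnW mN)).
- exact: stage_hess_sym.
Qed.

Lemma sum_cur_nxt (y : 'I_N.+1 -> R) :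
  \sum_(i < N) (y (cur i) - y (nxt i)) + y ord_max - y ord0 = 0.
Proof.
rewrite big_split /= sumrN.
have E1 : \sum_k y k = \sum_(i < N) y (cur i) + y ord_max := big_ord_recr _ _.
have E2 : \sum_k y k = y ord0 + \sum_(i < N) y (nxt i) := big_ord_recl _ _.
rewrite E1 in E2; move: E2.
move: (\sum_(i < N) y (cur i)) (\sum_(i < N) y (nxt i)) (y ord0) (y ord_max).
by move=> a b c e E; lra.
Qed.

(** By definition of q and r, the gradient at [wb] plus the Hessian applied to w - wb is q + Q x +
    S^T u in the state and r + S x + R u in the control, evaluated at w. The two stage residual
    lemmas then apply, and the last bracket is ready to telescope. *)
Lemma kkt_stage_identity (w v : wvec) i :
  (dot (st v (cur i)) (grad (cost P i ^~ (ct wb i)) (st wb (cur i))) +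
   dot (ct v i) (grad (cost P i (st wb (cur i))) (ct wb i))) +
  (dot (st v (cur i)) (hess_Q P wb i *m st (w - wb) (cur i) +
                       (hess_S P wb i)^T *m ct (w - wb) i) +
   dot (ct v i) (hess_S P wb i *m st (w - wb) (cur i) + hess_R P wb i *m ct (w - wb) i)) +
  dot (xblk (nxt i) (costate wb w))
     (lin_A P wb i *m st v (cur i) + lin_B P wb i *m ct v i - st v (nxt i)) =
  (dot (st v (cur i))
     ((lin_A P wb i)^T *m ((ric P wb i.+1).1 *m dyn_err wb w i) -
      (fb_K P wb i)^T *m (ric_H P wb i (ric P wb i.+1) *m fb_err wb w i)) +
   dot (ct v i)
     (ric_H P wb i (ric P wb i.+1) *m fb_err wb w i +
      (lin_B P wb i)^T *m ((ric P wb i.+1).1 *m dyn_err wb w i))) +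
  (dot (st v (cur i)) (xblk (cur i) (costate wb w)) -
   dot (st v (nxt i)) (xblk (nxt i) (costate wb w))).
Proof.
have sP := ric_sym (ltn_ord i); have sS := stage_hess_sym sm i.
have Eu := stage_control_residual (rr i) (st w (cur i)) (st w (nxt i)) (ct w i).
have Ex := stage_state_residual sP sS (rr i) (st w (cur i)) (st w (nxt i)) (ct w i).
have lc : xblk (cur i) (costate wb w) =
    (ric_step P wb i (ric P wb i.+1)).1 *m st w (cur i) + (ric_step P wb i (ric P wb i.+1)).2.
  by rewrite xblk_mxcol /= ricE.
have ln : xblk (nxt i) (costate wb w) = (ric P wb i.+1).1 *m st w (nxt i) + (ric P wb i.+1).2.
  by rewrite xblk_mxcol.
rewrite -ln -lc in Ex; rewrite -ln in Eu.
have {}Ex := congr1 (dot (st v (cur i))) Ex.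
have {}Eu := congr1 (dot (ct v i)) Eu.
rewrite !stB !ctB /dyn_err /fb_err -[fb_K P wb i]/(ric_K P wb i (ric P wb i.+1)).
have gq : grad (cost P i ^~ (ct wb i)) (st wb (cur i)) =
   grad_q P wb i + hess_Q P wb i *m st wb (cur i) + (hess_S P wb i)^T *m ct wb i.
  by rewrite /grad_q addrAC !subrK.
have gr : grad (cost P i (st wb (cur i))) (ct wb i) =
   grad_r P wb i + hess_S P wb i *m st wb (cur i) + hess_R P wb i *m ct wb i.
  by rewrite /grad_r addrAC !subrK.
rewrite gq gr.
have lA : dot (xblk (nxt i) (costate wb w)) (lin_A P wb i *m st v (cur i)) =
   dot (st v (cur i)) ((lin_A P wb i)^T *m xblk (nxt i) (costate wb w)).
  by rewrite dot_trmx dotC.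
have lB : dot (xblk (nxt i) (costate wb w)) (lin_B P wb i *m ct v i) =
   dot (ct v i) ((lin_B P wb i)^T *m xblk (nxt i) (costate wb w)).
  by rewrite dot_trmx dotC.
have dotDr n (a b c : 'cV[R]_n) : dot a (b + c) = dot a b + dot a c by exact: linearD.
have dotNr n (a b : 'cV[R]_n) : dot a (- b) = - dot a b by exact: linearN.
rewrite ![hess_Q P wb i *m (_ - _)]mulmxBr ![_^T *m (ct w i - _)]mulmxBr.
rewrite ![hess_S P wb i *m (_ - _)]mulmxBr ![hess_R P wb i *m (_ - _)]mulmxBr.
rewrite !(dotDr, dotNr) lA lB (dotC (xblk _ _) (st v (nxt i))).
rewrite !(dotDr, dotNr) in Ex Eu.
(* The inner products become atoms, and the claim is linear in them. *)
move: Ex Eu; clear; do ![match goal with |- context [dot ?a ?b] => move: (dot a b) => ? end].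
move=> Ex Eu; lra.
Qed.

Lemma dot_stack (lam : xvec) b0 b : dot lam (stack_cons b0 b) =
  dot (xblk ord0 lam) b0 + \sum_(i < N) dot (xblk (nxt i) lam) (b i).
Proof.
rewrite dot_blocks.
have -> : \sum_k dot (xblk k lam) (xblk k (stack_cons b0 b)) =
  dot (xblk ord0 lam) (xblk ord0 (stack_cons b0 b)) +
  \sum_(i < N) dot (xblk (nxt i) lam) (xblk (nxt i) (stack_cons b0 b)) := big_ord_recl _ _.
by rewrite xblk_stack0; congr (_ + _); apply: eq_bigr => i _; rewrite xblk_stackS.
Qed.

Lemma kkt_identity (w v : wvec) :
  'D_v (V P) wb + 'D_(w - wb) ('D_v (V P)) wb + dot (costate wb w) ('D_v (F P) wb) =
  ric_remainder wb w v.
Proof.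
rewrite derive_V // derive2_V // derive_F // dot_stack.
have T := sum_cur_nxt (fun k => dot (st v k) (xblk k (costate wb w))).
(* The terminal costate is the terminal gradient expanded at [wb] and closes the telescoping sum at
   its upper end; at the lower end the initial-state block of the derivative of F cancels the
   costate at stage 0. *)
have Tm : dot (st v ord_max) (xblk ord_max (costate wb w)) =
   dot (st v ord_max) (grad (fcost P) (st wb ord_max)) +
   dot (st v ord_max) (term_P P wb *m st (w - wb) ord_max).
  rewrite xblk_mxcol ricN /= -[RHS](linearD (dot (st v ord_max))) stB mulmxBr /term_p.
  congr (dot _ _); move: (term_P P wb *m st w ord_max) (term_P P wb *m st wb ord_max).
  by move=> a b; rewrite addrCA addrA.
set X1 := \sum_i (dot _ (grad _ _) + dot _ (grad _ _)).
set X2 := \sum_i (dot _ (_ + _) + dot _ (_ + _)).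
set X3 := \sum_(i < N) dot (xblk (nxt i) _) _.
have E : X1 + X2 + X3 = ric_remainder wb w v +
    \sum_(i < N) (dot (st v (cur i)) (xblk (cur i) (costate wb w)) -
                 dot (st v (nxt i)) (xblk (nxt i) (costate wb w))).
  rewrite /X1 /X2 /X3 /ric_remainder -!big_split /=.
  by apply: eq_bigr => i _; exact: kkt_stage_identity.
rewrite linearN /= [dot (xblk ord0 _) _]dotC.
move: E T Tm; move: X1 X2 X3 (ric_remainder wb w v) => X1 X2 X3 rem.
move: (\sum_(i < N) (_ - _)) => Y.
do ![match goal with |- context [dot ?a ?b] => move: (dot a b) => ? end].
move=> E T Tm; lra.
Qed.

End riccati_identity.

(** * Residual maps *)

Section residual_calculus.
Variables (R : realType) (V W : normedModType R) (Rf : V -> V -> W) (z w : V).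
Hypothesis dR : differentiable (fun q : V * V => Rf q.1 q.2) (z, w).

Lemma derive_pair_l v : 'D_(v, 0) (fun q : V * V => Rf q.1 q.2) (z, w) = 'D_v (Rf ^~ w) z.
Proof.
rewrite /derive (_ : (fun h => _) =
  (fun h => h^-1 *: (((Rf ^~ w) \o shift z) (h *: v) - Rf z w))) //.
by apply/funext => h /=; rewrite scaler0 add0r.
Qed.

Lemma derive_pair_r v : 'D_(0, v) (fun q : V * V => Rf q.1 q.2) (z, w) = 'D_v (Rf z) w.
Proof.
rewrite /derive (_ : (fun h => _) =
  (fun h => h^-1 *: ((Rf z \o shift w) (h *: v) - Rf z w))) //.
by apply/funext => h /=; rewrite scaler0 add0r.
Qed.

Lemma derive_pair v1 v2 : 'D_(v1, v2) (fun q : V * V => Rf q.1 q.2) (z, w) =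
  'D_v1 (Rf ^~ w) z + 'D_v2 (Rf z) w.
Proof.
rewrite -derive_pair_l -derive_pair_r !(deriveE _ dR) -linearD; congr ('d _ _ _).
by congr pair; rewrite ?addr0 ?add0r.
Qed.

Lemma differentiable_pair_l : differentiable (Rf ^~ w) z.
Proof.
have -> : Rf ^~ w = (fun q : V * V => Rf q.1 q.2) \o (fun v => (v, w)) by [].
apply: differentiable_comp => //; apply: differentiable_pair => //.
Qed.

Lemma differentiable_pair_r : differentiable (Rf z) w.
Proof.
have -> : Rf z = (fun q : V * V => Rf q.1 q.2) \o (fun v => (z, v)) by [].
apply: differentiable_comp => //; apply: differentiable_pair => //.
Qed.

End residual_calculus.

Section stacked_derivatives.
Variables (R : realType) (V : normedModType R) (a b : nat).
Variables (h : V -> 'cV[R]_(a + b)) (p : V).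
Hypothesis dh : differentiable h p.

Lemma derive_usubmx v : usubmx ('D_v h p) = 'D_v (fun q => usubmx (h q)) p.
Proof. exact: esym (derive_linear_comp _ (@mx_linear_continuous R _ _ _ usubmx) dh). Qed.

Lemma derive_dsubmx v : dsubmx ('D_v h p) = 'D_v (fun q => dsubmx (h q)) p.
Proof. exact: esym (derive_linear_comp _ (@mx_linear_continuous R _ _ _ dsubmx) dh). Qed.

End stacked_derivatives.

Section rates.
Variable R : realType.

Lemma mx_inj_unit n (A : 'M[R]_n) : (forall v : 'cV[R]_n, A *m v = 0 -> v = 0) ->
  A \in unitmx.
Proof.
move=> inj; rewrite -unitmx_tr -row_free_unit; apply: inj_row_free => v vA.
rewrite -[v]trmxK; have -> : v^T = 0; last by rewrite trmx0.
by apply: inj; rewrite -[A]trmxK -trmx_mul vA trmx0.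
Qed.

Lemma solution_mapP n (Rs : 'cV[R]_n -> 'cV[R]_n -> 'cV[R]_n) zb z0 :
  (forall z, Rs z zb = 0 <-> z = z0) -> forall y, Rs y zb = 0 <-> y = solution_map Rs zb.
Proof.
move=> E; suff -> : solution_map Rs zb = z0 by [].
rewrite /solution_map; apply: get_unique; first exact/E.
by move=> y /E.
Qed.

Lemma well_definedP n (Rs : 'cV[R]_n -> 'cV[R]_n -> 'cV[R]_n) z :
  (forall zb, exists z0, forall y, Rs y zb = 0 <-> y = z0) -> Rs z z = 0 ->
  differentiable (Rs ^~ z) z -> (forall v, 'D_v (Rs ^~ z) z = 0 -> v = 0) ->
  well_defined_at Rs (solution_map Rs) z.
Proof.
move=> uni fix_z dR inj; split.
- by have [z0 E] := uni z; apply/esym/(solution_mapP E).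
- by near=> zb; have [z0 E] := uni zb; exact: solution_mapP E.
- by apply: mx_inj_unit => v; rewrite jac_mul //; exact: inj.
Unshelve. all: by end_near. Qed.

(** The implicit differentiation rule, one direction at a time: rate matrices are identified by
    checking a linear equation rather than by computing an inverse. *)
Lemma rate_matrix_mul n (Rs : 'cV[R]_n -> 'cV[R]_n -> 'cV[R]_n) z (h j : 'cV[R]_n) :
  differentiable (fun q => Rs q.1 q.2) (z, z) -> jac (Rs ^~ z) z \in unitmx ->
  'D_j (Rs ^~ z) z + 'D_h (Rs z) z = 0 <-> rate_matrix Rs z *m h = j.
Proof.
move=> dR uL; rewrite -!jac_mul; last 2 first.
- exact: differentiable_pair_r dR.
- exact: differentiable_pair_l dR.
rewrite /rate_matrix mulNmx -mulmxA.
move: (jac (Rs ^~ z) z) (jac (Rs z) z) uL => L D uL {dR}; split=> [/eqP|<-].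
  rewrite addrC addr_eq0 => /eqP ->.
  by rewrite mulmxN opprK (mulKmx uL).
by rewrite mulmxN (mulKVmx uL) addNr.
Qed.

End rates.

(** * Linear parts and unique solvability of the three residual equations *)

Section residual_maps.
Variables (R : realType) (N nx nu : nat) (P : ocp R N nx nu).
Notation xvec := 'cV[R]_(\sum_(i < N.+1) nx).
Notation uvec := 'cV[R]_(\sum_(i < N) nu).
Notation wvec := 'cV[R]_(\sum_(i < N.+1) nx + \sum_(i < N) nu).
Notation yvec := 'cV[R]_(\sum_(i < N.+1) nx +
                         (\sum_(i < N.+1) nx + \sum_(i < N) nu)).

(** [lin_dyn wb] and [lin_fb wb] are the linear parts of [Fhat P wb] and [G P wb]; by [derive_F] the
    former is also the derivative of F at [wb]. *)
Definition lin_dyn (wb v : wvec) : xvec :=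
  stack_cons (- st v ord0)
    (fun i => lin_A P wb i *m st v (cur i) + lin_B P wb i *m ct v i - st v (nxt i)).
Definition lin_fb (wb v : wvec) : uvec :=
  @mxcol R N (fun=> nu) 1 (fun i => fb_K P wb i *m st v (cur i) - ct v i).

Lemma st_lin (h : R) (v z : wvec) k : st (h *: v + z) k = h *: st v k + st z k.
Proof. exact: (linearP (@stl R N nx nu k)). Qed.

Lemma ct_lin (h : R) (v z : wvec) i : ct (h *: v + z) i = h *: ct v i + ct z i.
Proof. exact: (linearP (@ctl R N nx nu i)). Qed.

Lemma Fhat_affine wb (h : R) v z : Fhat P wb (h *: v + z) = Fhat P wb z + h *: lin_dyn wb v.
Proof.
apply: xblkP; apply: ord_cases => [|i]; rewrite linearD linearZ /=.
  by rewrite !xblk_stack0 st_lin opprD scalerN addrA addrAC.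
rewrite !xblk_stackS !st_lin ct_lin -!addrA !mulmxDr -!scalemxAr.
move: (lin_A P wb i *m st v (cur i)) (lin_A P wb i *m st z (cur i)) (lin_A P wb i *m - st wb (cur i)).
move: (lin_B P wb i *m ct v i) (lin_B P wb i *m ct z i) (lin_B P wb i *m - ct wb i).
move: (st v (nxt i)) (st z (nxt i)) (lin_f P wb i) => a b c e f g k l m.
by apply/matrixP => r s; rewrite !mxE; ring.
Qed.

Lemma G_affine wb (h : R) v z : G P wb (h *: v + z) = G P wb z + h *: lin_fb wb v.
Proof.
apply: ublkP => i; rewrite linearD linearZ /= !ublk_mxcol st_lin ct_lin.
rewrite -!addrA !mulmxDr -!scalemxAr.
move: (fb_K P wb i *m st v (cur i)) (fb_K P wb i *m st z (cur i)) (fb_K P wb i *m - st wb (cur i)).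
move: (ct wb i) (fb_k P wb i) (ct v i) (ct z i) => a b c e f g k.
by apply/matrixP => r s; rewrite !mxE; ring.
Qed.

Lemma derive_G wb v z : 'D_v (G P wb) z = lin_fb wb v.
Proof. by apply: derive_affine => h; rewrite G_affine. Qed.

Lemma derive_R_MS wb v z : 'D_v (R_MS P ^~ wb) z = col_mx (lin_dyn wb v) (lin_fb wb v).
Proof.
by apply: derive_affine => h; rewrite /R_MS Fhat_affine G_affine scale_col_mx add_col_mx.
Qed.

Lemma F_eq0 w : F P w = 0 <->
  st w ord0 = xinit P /\ forall i, st w (nxt i) = dyn P i (st w (cur i)) (ct w i).
Proof.
rewrite /F stack_cons_eq0; split=> -[h0 h1]; split=> [|i].
- by apply/esym/subr0_eq.
- by apply/esym/subr0_eq.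
- by rewrite h0 subrr.
- by rewrite h1 subrr.
Qed.

Lemma Fhat_eq0 wb w : Fhat P wb w = 0 <->
  st w ord0 = xinit P /\ forall i, st w (nxt i) =
    lin_f P wb i + lin_A P wb i *m (st w (cur i) - st wb (cur i))
      + lin_B P wb i *m (ct w i - ct wb i).
Proof.
rewrite /Fhat stack_cons_eq0; split=> -[h0 h1]; split=> [|i].
- by apply/esym/subr0_eq.
- by apply/esym/subr0_eq.
- by rewrite h0 subrr.
- by rewrite h1 subrr.
Qed.

Lemma G_eq0 wb w : G P wb w = 0 <-> forall i, ct w i =
  ct wb i + fb_k P wb i + fb_K P wb i *m (st w (cur i) - st wb (cur i)).
Proof.
rewrite /G umxcol_eq0; split=> h i; first by apply/esym/subr0_eq.
by rewrite h subrr.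
Qed.

Lemma lin_dyn_eq0 wb v : lin_dyn wb v = 0 <->
  st v ord0 = 0 /\ forall i, st v (nxt i) = lin_A P wb i *m st v (cur i) + lin_B P wb i *m ct v i.
Proof.
rewrite /lin_dyn stack_cons_eq0; split=> -[h0 h1]; split=> [|i].
- by apply/oppr_inj; rewrite h0 oppr0.
- by apply/esym/subr0_eq.
- by rewrite h0 oppr0.
- by rewrite h1 subrr.
Qed.

Lemma st0 k : st (0 : wvec) k = 0.
Proof. exact: (linear0 (@stl R N nx nu k)). Qed.

Lemma ct0 i : ct (0 : wvec) i = 0.
Proof. exact: (linear0 (@ctl R N nx nu i)). Qed.

(** The homogeneous closed loop started at 0 stays at 0. *)
Lemma lin_residual_inj wb v : lin_dyn wb v = 0 -> lin_fb wb v = 0 -> v = 0.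
Proof.
move=> /lin_dyn_eq0[h0 h1]; rewrite /lin_fb umxcol_eq0 => h2.
apply: (@forward_unique _ _ _ _ _ _ (fun i x u => lin_A P wb i *m x + lin_B P wb i *m u)
  (fun i x => fb_K P wb i *m x)) => //; rewrite ?st0 //.
- by move=> i; rewrite !st0 ct0 !mulmx0 addr0.
- by move=> i; apply/esym/subr0_eq.
- by move=> i; rewrite st0 ct0 mulmx0.
Qed.

Lemma lin_dyn_control0 wb v : lin_dyn wb v = 0 -> (forall i, ct v i = 0) -> v = 0.
Proof.
move=> /lin_dyn_eq0[h0 h1] h2.
apply: (@forward_unique _ _ _ _ _ _ (fun i x u => lin_A P wb i *m x + lin_B P wb i *m u)
  (fun i x => 0)) => //; rewrite ?st0 //.
- by move=> i; rewrite !st0 ct0 !mulmx0 addr0.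
- by move=> i; rewrite ct0.
Qed.

Lemma MS_unique wb : exists w0, forall w, R_MS P w wb = 0 <-> w = w0.
Proof.
have [w0 E] := forward_sweep (xinit P)
  (fun i x u => lin_f P wb i + lin_A P wb i *m (x - st wb (cur i))
      + lin_B P wb i *m (u - ct wb i))
  (fun i x => ct wb i + fb_k P wb i + fb_K P wb i *m (x - st wb (cur i))).
exists w0 => w; rewrite -E /R_MS; split.
  move=> /eqP; rewrite col_mx_eq0 => /andP[/eqP/Fhat_eq0[h0 h1] /eqP/G_eq0 h2].
  by split.
move=> [h0 h1 h2]; apply/eqP; rewrite col_mx_eq0; apply/andP; split; apply/eqP.
  exact/Fhat_eq0.
exact/G_eq0.
Qed.

Lemma DDP_unique wb : exists w0, forall w, R_DDP P w wb = 0 <-> w = w0.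
Proof.
have [w0 E] := forward_sweep (xinit P) (fun i x u => dyn P i x u)
  (fun i x => ct wb i + fb_k P wb i + fb_K P wb i *m (x - st wb (cur i))).
exists w0 => w; rewrite -E /R_DDP; split.
  move=> /eqP; rewrite col_mx_eq0 => /andP[/eqP/F_eq0[h0 h1] /eqP/G_eq0 h2].
  by split.
move=> [h0 h1 h2]; apply/eqP; rewrite col_mx_eq0; apply/andP; split; apply/eqP.
  exact/F_eq0.
exact/G_eq0.
Qed.

(** The two trajectories inside y share the controls; the hatted one is contiguous in y, hence the
    shorter [y_hat]. *)
Definition y_nom (y : yvec) : wvec := col_mx (y_x y) (y_u y).
Definition y_hat (y : yvec) : wvec := dsubmx y.

Lemma R_SSE y yb : R_SS P y yb = col_mx (F P (y_nom y)) (R_MS P (y_hat y) (y_nom yb)).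
Proof.
by rewrite /R_SS /R_MS /y_hat -[dsubmx y in RHS]vsubmxK.
Qed.

Lemma yvecP (y : yvec) (a c : wvec) : dsubmx a = dsubmx c ->
  y_nom y = a -> y_hat y = c -> y = col_mx (usubmx a) c.
Proof. by move=> _ <- <-; rewrite /y_nom col_mxKu /y_x /y_hat vsubmxK. Qed.

Lemma SS_unique yb : exists y0, forall y, R_SS P y yb = 0 <-> y = y0.
Proof.
have [w0 E0] := MS_unique (y_nom yb).
(* The system is triangular: the hatted pair solves multiple shooting, and its controls then drive
   the nonlinear simulation in open loop. *)
have [w1 E1] := forward_sweep (xinit P) (fun i x u => dyn P i x u) (fun i x => ct w0 i).
have [h1 h2 h3] := (E1 w1).2 erefl.
have d10 : dsubmx w1 = dsubmx w0 by apply: ublkP => i; exact: h3.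
exists (col_mx (usubmx w1) w0) => y; rewrite R_SSE; split.
  move=> /eqP; rewrite col_mx_eq0 => /andP[/eqP/F_eq0[f0 f1] /eqP/E0 hy].
  apply: yvecP => //; apply/E1; split=> // i.
  by rewrite /ct /y_nom col_mxKd /y_u -[dsubmx y]/(y_hat y) hy.
move=> ->; rewrite /y_nom /y_hat /y_x /y_u col_mxKu col_mxKd -d10 vsubmxK.
apply/eqP; rewrite col_mx_eq0; apply/andP; split; apply/eqP; first exact/F_eq0.
exact/E0.
Qed.

End residual_maps.

(** * Continuity of the Riccati recursion in the base point *)

Section limits_along_filter.
Variables (R : realType) (T : Type) (Fl : set_system T).
Context {FF : Filter Fl}.

Lemma cvg_near_eq (U : topologicalType) (f g : T -> U) (l l' : U) :
  l = l' -> (\forall t \near Fl, f t = g t) -> g @ Fl --> l' -> f @ Fl --> l.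
Proof. by move=> -> fg; apply: cvg_trans; apply: near_eq_cvg; apply: filterS fg. Qed.

Lemma cvg_dot n (f g : T -> 'cV[R]_n) (a b : 'cV[R]_n) :
  f @ Fl --> a -> g @ Fl --> b -> (fun t => dot (f t) (g t)) @ Fl --> dot a b.
Proof.
move=> fa gb; apply: (@mx_cvg_entry _ _ _ _ 1 1 (fun t => (f t)^T *m g t)).
by apply: cvg_mulmx => //; exact: cvg_trmx.
Qed.

Variables (N nx nu : nat) (P : ocp R N nx nu).
Notation wvec := 'cV[R]_(\sum_(i < N.+1) nx + \sum_(i < N) nu).
Variables (w : wvec) (g : T -> wvec).
Hypothesis gw : g @ Fl --> w.
Hypothesis sm : smooth_data P w.

Lemma smooth_along : \forall t \near Fl, smooth_data P (g t).
Proof. exact: gw (smooth_data_near sm). Qed.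

Lemma cvg_st k : (fun t => st (g t) k) @ Fl --> st w k.
Proof. exact: (cvg_comp g (@stl R N nx nu k) gw (@stl_continuous R N nx nu k w)). Qed.

Lemma cvg_ct i : (fun t => ct (g t) i) @ Fl --> ct w i.
Proof. exact: (cvg_comp g (@ctl R N nx nu i) gw (@mx_linear_continuous R _ _ _ (@ctl R N nx nu i) w)). Qed.

Lemma cvg_stage i : (fun t => stage i (g t)) @ Fl --> stage i w.
Proof. exact: (cvg_comp g (@stage R N nx nu i) gw (@stage_continuous R N nx nu i w)). Qed.

Lemma cvg_at_stage i (W : normedModType R) (f : 'cV[R]_(nx + nu) -> W) :
  {for stage i w, continuous f} -> (fun t => f (stage i (g t))) @ Fl --> f (stage i w).
Proof. by move=> cf; apply: continuous_cvg; [exact: cf | exact: cvg_stage]. Qed.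

Lemma cvg_at_last (W : normedModType R) (f : 'cV[R]_nx -> W) :
  {for st w ord_max, continuous f} ->
  (fun t => f (st (g t) ord_max)) @ Fl --> f (st w ord_max).
Proof. by move=> cf; apply: continuous_cvg; [exact: cf | exact: cvg_st]. Qed.

Lemma cvg_dyn_derive i v :
  (fun t => 'D_v (on_stack (dyn P i)) (stage i (g t))) @ Fl -->
  'D_v (on_stack (dyn P i)) (stage i w).
Proof.
apply: (@cvg_at_stage i _ ('D_v (on_stack (dyn P i)))).
exact/differentiable_continuous/C2_near_derive_diff/stage_dyn_C2.
Qed.

Lemma cvg_cost_derive i v :
  (fun t => 'D_v (on_stack (cost P i)) (stage i (g t))) @ Fl -->
  'D_v (on_stack (cost P i)) (stage i w).
Proof.
apply: (@cvg_at_stage i _ ('D_v (on_stack (cost P i)))).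
exact/differentiable_continuous/C2_near_derive_diff/stage_cost_C2.
Qed.

(** Entries of partial Jacobians become derivatives of one stacked map in a fixed direction, whose
    continuity at the stage point is known. *)
Lemma lin_A_entry z i k l : smooth_data P z -> lin_A P z i k l =
  ('D_(col_mx (delta_mx l 0) 0) (on_stack (dyn P i)) (stage i z)) k 0.
Proof. by move=> sz; rewrite -lin_mul // mulmx0 addr0 -colE [RHS]mxE. Qed.

Lemma lin_B_entry z i k l : smooth_data P z -> lin_B P z i k l =
  ('D_(col_mx 0 (delta_mx l 0)) (on_stack (dyn P i)) (stage i z)) k 0.
Proof. by move=> sz; rewrite -lin_mul // mulmx0 add0r -colE [RHS]mxE. Qed.

Lemma cost_grad_x_entry z i k : smooth_data P z ->
  grad (cost P i ^~ (ct z i)) (st z (cur i)) k 0 =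
  'D_(col_mx (delta_mx k 0) 0) (on_stack (cost P i)) (stage i z).
Proof. by move=> sz; rewrite -cost_grad_dot // dot0l addr0 dot_delta. Qed.

Lemma cost_grad_u_entry z i k : smooth_data P z ->
  grad (cost P i (st z (cur i))) (ct z i) k 0 =
  'D_(col_mx 0 (delta_mx k 0)) (on_stack (cost P i)) (stage i z).
Proof. by move=> sz; rewrite -cost_grad_dot // dot0l add0r dot_delta. Qed.

Lemma hess_entry n (f : 'cV[R]_n -> R) p k l : C2_near f p ->
  hess f p k l = 'D_(delta_mx l 0) ('D_(delta_mx k 0) f) p.
Proof. by move=> cf; rewrite -hess_mul // trmx_delta -rowE -colE [RHS]mxE [RHS]mxE. Qed.

Lemma cvg_lin_A i : (fun t => lin_A P (g t) i) @ Fl --> lin_A P w i.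
Proof.
apply: mx_cvgP => k l.
apply: (@cvg_near_eq R (fun t => lin_A P (g t) i k l)
   (fun t => ('D_(col_mx (delta_mx l 0) 0) (on_stack (dyn P i)) (stage i (g t))) k 0) _ _ (lin_A_entry i k l sm)).
  by apply: filterS smooth_along => t st; exact: lin_A_entry.
exact: (@mx_cvg_entry _ _ _ _ _ _ _ _ k 0 (@cvg_dyn_derive i _)).
Qed.

Lemma cvg_lin_B i : (fun t => lin_B P (g t) i) @ Fl --> lin_B P w i.
Proof.
apply: mx_cvgP => k l.
apply: (@cvg_near_eq R (fun t => lin_B P (g t) i k l)
   (fun t => ('D_(col_mx 0 (delta_mx l 0)) (on_stack (dyn P i)) (stage i (g t))) k 0) _ _ (lin_B_entry i k l sm)).
  by apply: filterS smooth_along => t st; exact: lin_B_entry.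
exact: (@mx_cvg_entry _ _ _ _ _ _ _ _ k 0 (@cvg_dyn_derive i _)).
Qed.

Lemma cvg_lin_f i : (fun t => lin_f P (g t) i) @ Fl --> lin_f P w i.
Proof.
have E z : lin_f P z i = on_stack (dyn P i) (stage i z).
  by rewrite /on_stack /stage col_mxKu col_mxKd.
apply: (@cvg_near_eq _ _ (fun t => on_stack (dyn P i) (stage i (g t))) _ _ (E w)).
  by apply: filterE => t; exact: E.
apply: (@cvg_at_stage i _ (on_stack (dyn P i))).
exact/differentiable_continuous/C2_near_diff/stage_dyn_C2.
Qed.

Lemma cvg_lin_a i : (fun t => lin_a P (g t) i) @ Fl --> lin_a P w i.
Proof.
apply: cvgB; first apply: cvgB; first exact: cvg_lin_f.
- by apply: cvg_mulmx; [exact: cvg_lin_A | exact: cvg_st].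
- by apply: cvg_mulmx; [exact: cvg_lin_B | exact: cvg_ct].
Qed.

Lemma cvg_stage_hess i : (fun t => stage_hess P (g t) i) @ Fl --> stage_hess P w i.
Proof.
apply: mx_cvgP => k l.
apply: (@cvg_near_eq R (fun t => stage_hess P (g t) i k l) (fun t =>
  'D_(delta_mx l 0) ('D_(delta_mx k 0) (on_stack (cost P i))) (stage i (g t))) _ _ (hess_entry k l (stage_cost_C2 sm i))).
  by apply: filterS smooth_along => t st; apply: hess_entry; exact: stage_cost_C2.
apply: (@cvg_at_stage i _ ('D_(delta_mx l 0) ('D_(delta_mx k 0) (on_stack (cost P i))))).
exact/C2_near_continuous/stage_cost_C2.
Qed.

Lemma cvg_hess_Q i : (fun t => hess_Q P (g t) i) @ Fl --> hess_Q P w i.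
Proof.
apply: mx_cvgP => k l.
have E z : hess_Q P z i k l = stage_hess P z i (lshift nu k) (lshift nu l).
  by rewrite /hess_Q /ulsubmx [LHS]mxE [LHS]mxE.
apply: (@cvg_near_eq R _ (fun t => stage_hess P (g t) i (lshift nu k) (lshift nu l)) _ _ (E w)).
  by apply: filterE => t; exact: E.
exact: (@mx_cvg_entry _ _ _ _ _ _ _ _ _ _ (@cvg_stage_hess i)).
Qed.

Lemma cvg_hess_S i : (fun t => hess_S P (g t) i) @ Fl --> hess_S P w i.
Proof.
apply: mx_cvgP => k l.
have E z : hess_S P z i k l = stage_hess P z i (rshift nx k) (lshift nu l).
  by rewrite /hess_S /dlsubmx [LHS]mxE [LHS]mxE.
apply: (@cvg_near_eq R _ (fun t => stage_hess P (g t) i (rshift nx k) (lshift nu l)) _ _ (E w)).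
  by apply: filterE => t; exact: E.
exact: (@mx_cvg_entry _ _ _ _ _ _ _ _ _ _ (@cvg_stage_hess i)).
Qed.

Lemma cvg_hess_R i : (fun t => hess_R P (g t) i) @ Fl --> hess_R P w i.
Proof.
apply: mx_cvgP => k l.
have E z : hess_R P z i k l = stage_hess P z i (rshift nx k) (rshift nx l).
  by rewrite /hess_R /drsubmx [LHS]mxE [LHS]mxE.
apply: (@cvg_near_eq R _ (fun t => stage_hess P (g t) i (rshift nx k) (rshift nx l)) _ _ (E w)).
  by apply: filterE => t; exact: E.
exact: (@mx_cvg_entry _ _ _ _ _ _ _ _ _ _ (@cvg_stage_hess i)).
Qed.

Lemma cvg_grad_q i : (fun t => grad_q P (g t) i) @ Fl --> grad_q P w i.
Proof.
apply: cvgB; first apply: cvgB.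
- apply: mx_cvgP => k l; rewrite ord1.
  apply: (@cvg_near_eq R _ (fun t =>
    'D_(col_mx (delta_mx k 0) 0) (on_stack (cost P i)) (stage i (g t))) _ _ (cost_grad_x_entry i k sm)).
    by apply: filterS smooth_along => t st; exact: cost_grad_x_entry.
  exact: cvg_cost_derive.
- by apply: cvg_mulmx; [exact: cvg_hess_Q | exact: cvg_st].
- by apply: cvg_mulmx; [apply: cvg_trmx; exact: cvg_hess_S | exact: cvg_ct].
Qed.

Lemma cvg_grad_r i : (fun t => grad_r P (g t) i) @ Fl --> grad_r P w i.
Proof.
apply: cvgB; first apply: cvgB.
- apply: mx_cvgP => k l; rewrite ord1.
  apply: (@cvg_near_eq R _ (fun t =>
    'D_(col_mx 0 (delta_mx k 0)) (on_stack (cost P i)) (stage i (g t))) _ _ (cost_grad_u_entry i k sm)).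
    by apply: filterS smooth_along => t st; exact: cost_grad_u_entry.
  exact: cvg_cost_derive.
- by apply: cvg_mulmx; [exact: cvg_hess_S | exact: cvg_st].
- by apply: cvg_mulmx; [exact: cvg_hess_R | exact: cvg_ct].
Qed.

Lemma cvg_term_P : (fun t => term_P P (g t)) @ Fl --> term_P P w.
Proof.
apply: mx_cvgP => k l.
apply: (@cvg_near_eq R (fun t => term_P P (g t) k l) (fun t =>
  'D_(delta_mx l 0) ('D_(delta_mx k 0) (fcost P)) (st (g t) ord_max)) _ _ (hess_entry k l (fcost_C2 sm))).
  by apply: filterS smooth_along => t st; apply: hess_entry; exact: fcost_C2.
apply: (@cvg_at_last _ ('D_(delta_mx l 0) ('D_(delta_mx k 0) (fcost P)))).
exact/C2_near_continuous/fcost_C2.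
Qed.

Lemma grad_entry n (f : 'cV[R]_n -> R) p k : C2_near f p ->
  grad f p k 0 = 'D_(delta_mx k 0) f p.
Proof. by move=> cf; rewrite mxE deriveE //; exact: C2_near_diff. Qed.

Lemma cvg_term_p : (fun t => term_p P (g t)) @ Fl --> term_p P w.
Proof.
apply: cvgB; last by apply: cvg_mulmx; [exact: cvg_term_P | exact: cvg_st].
apply: mx_cvgP => k l; rewrite ord1.
apply: (@cvg_near_eq R _ (fun t => 'D_(delta_mx k 0) (fcost P) (st (g t) ord_max)) _ _ (grad_entry k (fcost_C2 sm))).
  by apply: filterS smooth_along => t st; apply: grad_entry; exact: fcost_C2.
apply: (@cvg_at_last _ ('D_(delta_mx k 0) (fcost P))).
exact/differentiable_continuous/C2_near_derive_diff/fcost_C2.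
Qed.

Section one_stage.
Variables (i : 'I_N) (Pp : T -> 'M[R]_nx * 'cV[R]_nx) (Pw : 'M[R]_nx * 'cV[R]_nx).
Hypothesis cP : (fun t => (Pp t).1) @ Fl --> Pw.1.
Hypothesis cp : (fun t => (Pp t).2) @ Fl --> Pw.2.
Hypothesis uH : ric_H P w i Pw \in unitmx.

Lemma cvg_BtP : (fun t => (lin_B P (g t) i)^T *m (Pp t).1) @ Fl --> (lin_B P w i)^T *m Pw.1.
Proof. by apply: cvg_mulmx => //; apply: cvg_trmx; exact: cvg_lin_B. Qed.

Lemma cvg_AtP : (fun t => (lin_A P (g t) i)^T *m (Pp t).1) @ Fl --> (lin_A P w i)^T *m Pw.1.
Proof. by apply: cvg_mulmx => //; apply: cvg_trmx; exact: cvg_lin_A. Qed.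

Lemma cvg_Pap : (fun t => (Pp t).1 *m lin_a P (g t) i + (Pp t).2) @ Fl -->
  Pw.1 *m lin_a P w i + Pw.2.
Proof. by apply: cvgD => //; apply: cvg_mulmx => //; exact: cvg_lin_a. Qed.

Lemma cvg_ric_H : (fun t => ric_H P (g t) i (Pp t)) @ Fl --> ric_H P w i Pw.
Proof.
apply: cvgD; first exact: cvg_hess_R.
by apply: cvg_mulmx; [exact: cvg_BtP | exact: cvg_lin_B].
Qed.

Lemma cvg_ric_g : (fun t => ric_g P (g t) i (Pp t)) @ Fl --> ric_g P w i Pw.
Proof.
apply: cvgD; first exact: cvg_grad_r.
by apply: cvg_mulmx; [apply: cvg_trmx; exact: cvg_lin_B | exact: cvg_Pap].
Qed.

Lemma cvg_ric_K : (fun t => ric_K P (g t) i (Pp t)) @ Fl --> ric_K P w i Pw.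
Proof.
apply: cvgN; apply: cvg_mulmx; first exact: cvg_invmx cvg_ric_H uH.
apply: cvgD; first exact: cvg_hess_S.
by apply: cvg_mulmx; [exact: cvg_BtP | exact: cvg_lin_A].
Qed.

Lemma cvg_ric_step1 : (fun t => (ric_step P (g t) i (Pp t)).1) @ Fl --> (ric_step P w i Pw).1.
Proof.
apply: cvgD; first apply: cvgD.
- exact: cvg_hess_Q.
- by apply: cvg_mulmx; [exact: cvg_AtP | exact: cvg_lin_A].
- apply: cvg_mulmx; last exact: cvg_ric_K.
  apply: cvgD; first by apply: cvg_trmx; exact: cvg_hess_S.
  by apply: cvg_mulmx; [exact: cvg_AtP | exact: cvg_lin_B].
Qed.

Lemma cvg_ric_step2 : (fun t => (ric_step P (g t) i (Pp t)).2) @ Fl --> (ric_step P w i Pw).2.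
Proof.
apply: cvgD; first apply: cvgD.
- exact: cvg_grad_q.
- by apply: cvg_mulmx; [apply: cvg_trmx; exact: cvg_lin_A | exact: cvg_Pap].
- by apply: cvg_mulmx; [apply: cvg_trmx; exact: cvg_ric_K | exact: cvg_ric_g].
Qed.

End one_stage.

Hypothesis rr : riccati_regular P w.

(** Backward induction. Invertibility at the limit point alone suffices, since [cvg_invmx] carries
    it along the filter. *)
Lemma cvg_ric k : (k <= N)%N ->
  (fun t => (ric P (g t) k).1) @ Fl --> (ric P w k).1 /\
  (fun t => (ric P (g t) k).2) @ Fl --> (ric P w k).2.
Proof.
move=> kN; rewrite -(subKn kN); move: (N - k)%N (leq_subr k N) => m.
elim: m => [|m IH] mN.
  rewrite subn0 !ricN; split.
    by under eq_fun do rewrite ricN; exact: cvg_term_P.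
  by under eq_fun do rewrite ricN; exact: cvg_term_p.
have lt : (N - m.+1 < N)%N by rewrite ltn_subrL (leq_trans _ mN).
have E z : ric P z (N - m.+1) = ric_step P z (Ordinal lt) (ric P z (N - m)).
  by rewrite -[(N - m.+1)%N]/(nat_of_ord (Ordinal lt)) ricE /= subnSK.
have [c1 c2] := IH (ltnW mN).
have uH : ric_H P w (Ordinal lt) (ric P w (N - m)) \in unitmx.
  by have := rr (Ordinal lt); rewrite /= subnSK.
rewrite E; split; under eq_fun do rewrite E.
  exact: cvg_ric_step1.
exact: cvg_ric_step2.
Qed.

Lemma cvg_fb_K i : (fun t => fb_K P (g t) i) @ Fl --> fb_K P w i.
Proof. by have [c1 _] := cvg_ric (ltn_ord i); apply: cvg_ric_K => //; exact: rr. Qed.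

Lemma cvg_stage_H i : (fun t => ric_H P (g t) i (ric P (g t) i.+1)) @ Fl -->
  ric_H P w i (ric P w i.+1).
Proof. by have [c1 _] := cvg_ric (ltn_ord i); exact: cvg_ric_H. Qed.

Lemma regular_along : \forall t \near Fl, riccati_regular P (g t).
Proof.
apply: filter_forall => i; apply: near_unitmx; first exact: cvg_stage_H.
exact: rr.
Qed.

End limits_along_filter.

Section blockwise_limits.
Variables (R : realType) (T : Type) (Fl : set_system T).
Context {FF : Filter Fl}.
Variables (N nx nu : nat) (P : ocp R N nx nu).
Notation xvec := 'cV[R]_(\sum_(i < N.+1) nx).
Notation wvec := 'cV[R]_(\sum_(i < N.+1) nx + \sum_(i < N) nu).

Lemma sum_put_block (x : xvec) : x = \sum_k put_block k (xblk k x).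
Proof.
apply: xblkP => j; rewrite linear_sum (bigD1 j) //= xblk_put eqxx big1 ?addr0 // => k kj.
by rewrite xblk_put eq_sym (negbTE kj).
Qed.

Lemma cvg_xblk (f : T -> xvec) (l : xvec) :
  (forall k, (fun t => xblk k (f t)) @ Fl --> xblk k l) -> f @ Fl --> l.
Proof.
move=> h; apply: (@cvg_near_eq _ _ _ _ _ (fun t => \sum_k put_block k (xblk k (f t)))
  _ _ (sum_put_block l)).
  by apply: filterE => t; exact: sum_put_block.
apply: cvg_sumr => k; apply: continuous_cvg; last exact: h.
exact: (@mx_linear_continuous R _ _ _ (@put_block R N nx k)).
Qed.

Lemma cvg_costate (g z : T -> wvec) (w zw : wvec) :
  g @ Fl --> w -> z @ Fl --> zw -> smooth_data P w -> riccati_regular P w ->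
  (fun t => costate P (g t) (z t)) @ Fl --> costate P w zw.
Proof.
move=> gw zzw sm rr; apply: cvg_xblk => k.
have kN : (k <= N)%N by rewrite -ltnS.
have [c1 c2] := cvg_ric gw sm rr kN.
have E a b : xblk k (costate P a b) = (ric P a k).1 *m st b k + (ric P a k).2.
  by rewrite xblk_mxcol.
apply: (@cvg_near_eq _ _ _ _ _ (fun t => (ric P (g t) k).1 *m st (z t) k + (ric P (g t) k).2)
  _ _ (E w zw)).
  by apply: filterE => t; exact: E.
by apply: cvgD => //; apply: cvg_mulmx => //; exact: cvg_st.
Qed.

End blockwise_limits.

(** * The KKT point *)

Section kkt_point.
Variables (R : realType) (N nx nu : nat) (P : ocp R N nx nu).
Notation xvec := 'cV[R]_(\sum_(i < N.+1) nx).
Notation uvec := 'cV[R]_(\sum_(i < N) nu).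
Notation wvec := 'cV[R]_(\sum_(i < N.+1) nx + \sum_(i < N) nu).
Variables (w : wvec) (lam : xvec).

Lemma xblk_Fhat wb z i : xblk (nxt i) (Fhat P wb z) = - dyn_err P wb z i.
Proof.
rewrite xblk_stackS /dyn_err /dyn_defect /lin_a opprB !mulmxBr.
move: (lin_f P wb i) (st z (nxt i)) (lin_A P wb i *m st z (cur i)) (lin_A P wb i *m st wb (cur i)).
move: (lin_B P wb i *m ct z i) (lin_B P wb i *m ct wb i) => a b c e f g.
by apply/matrixP => r s; rewrite !mxE; ring.
Qed.

Lemma ublk_G wb z i : ublk i (G P wb z) = - fb_err P wb z i.
Proof.
rewrite ublk_mxcol /fb_err /fb_defect /fb_k opprB !mulmxBr.
rewrite -[ric_K P wb i _]/(fb_K P wb i) -[ric_kappa P wb i _]/(fb_kappa0 P wb i).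
move: (fb_kappa0 P wb i) (fb_K P wb i *m st z (cur i)) (fb_K P wb i *m st wb (cur i)).
move: (ct z i) (ct wb i) => a b c e f.
by apply/matrixP => r s; rewrite !mxE; ring.
Qed.

Lemma Fhat_diag : Fhat P w w = F P w.
Proof.
apply: xblkP; apply: ord_cases => [|i]; first by rewrite !xblk_stack0.
by rewrite !xblk_stackS !subrr !mulmx0 !addr0.
Qed.

(** Without dynamics defects each stage pairs v only with H d; moving K^T onto the state part
    assembles K v_x - v_u, a block of [lin_fb]. *)
Lemma ric_remainder_exact wb z v : (forall i, dyn_err P wb z i = 0) ->
  ric_remainder P wb z v =
  - \sum_i dot (ublk i (lin_fb P wb v)) (ric_H P wb i (ric P wb i.+1) *m fb_err P wb z i).
Proof.
move=> e0; rewrite /ric_remainder -sumrN; apply: eq_bigr => i _.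
rewrite e0 !mulmx0 sub0r addr0 ublk_mxcol.
move: (ric_H P wb i (ric P wb i.+1) *m fb_err P wb z i) => y.
rewrite linearN /= dot_trmx trmxK dotDl dotNl; ring.
Qed.

Hypothesis sm : smooth_data P w.
Hypothesis rr : riccati_regular P w.
Hypothesis kkt : KKT P w lam.
Hypothesis dMS : differentiable (fun q : wvec * wvec => R_MS P q.1 q.2) (w, w).

Lemma KKT_derive v : 'D_v (V P) w + dot lam ('D_v (F P) w) = 0.
Proof.
have [_ st0] := kkt.
have dV := C2_near_diff (V_C2 sm); have dF := C2_near_diff (F_C2 sm).
rewrite -grad_dot // -jac_mul // dot_trmx -[_ 0 0]/(dot v (grad (V P) w)) [dot _ v]dotC.
by rewrite -linearD st0 linear0.
Qed.

Lemma derive_F_lin v : 'D_v (F P) w = lin_dyn P w v.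
Proof. by rewrite derive_F. Qed.

(** An injective square system is surjective. This supplies the test directions of the following
    proofs. *)
Lemma lin_residual_surj y c : exists v, lin_dyn P w v = y /\ lin_fb P w v = c.
Proof.
have dL := differentiable_pair_l dMS.
have uL : jac (R_MS P ^~ w) w \in unitmx.
  apply: mx_inj_unit => v; rewrite jac_mul // derive_R_MS => /eqP.
  by rewrite col_mx_eq0 => /andP[/eqP h1 /eqP h2]; exact: lin_residual_inj h1 h2.
exists (invmx (jac (R_MS P ^~ w) w) *m col_mx y c).
set v := _ *m _; have : jac (R_MS P ^~ w) w *m v = col_mx y c by rewrite /v mulKVmx.
by rewrite jac_mul // derive_R_MS => /eq_col_mx.
Qed.

Lemma dyn_err_diag i : dyn_err P w w i = 0.
Proof.
have [F0 _] := kkt.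
by apply: oppr_inj; rewrite -xblk_Fhat Fhat_diag F0 linear0 oppr0.
Qed.

(** The difference of the Riccati identity at base and trajectory w and of the KKT condition: the
    derivative of V cancels. *)
Lemma costate_gap v : dot (costate P w w - lam) (lin_dyn P w v) =
  - \sum_i dot (ublk i (lin_fb P w v)) (ric_H P w i (ric P w i.+1) *m fb_err P w w i).
Proof.
rewrite -ric_remainder_exact; last exact: dyn_err_diag.
rewrite -kkt_identity // subrr derive0 addr0 derive_F_lin.
have := KKT_derive v; rewrite derive_F_lin dotDl dotNl.
move: ('D_v (V P) w) (dot (costate P w w) _) (dot lam _) => a b c.
by move=> E; lra.
Qed.

Lemma fb_err_diag i : fb_err P w w i = 0.
Proof.
(* This v kills the costate side of [costate_gap] and makes the other side minus a sum of squares of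
   the H_i d_i; invertibility of H_i then removes the weight. *)
have [v [v1 v2]] := lin_residual_surj 0
  (@mxcol R N (fun=> nu) 1 (fun i => ric_H P w i (ric P w i.+1) *m fb_err P w w i)).
have := costate_gap v; rewrite v1 v2 linear0 => /esym/eqP; rewrite oppr_eq0.
under eq_bigr do rewrite ublk_mxcol.
rewrite psumr_eq0 => [/allP h|j _]; last exact: dot_self_ge0.
have /eqP/dot_self_eq0 E := h i (mem_index_enum i).
by rewrite -(mulKmx (rr i) (fb_err P w w i)) E mulmx0.
Qed.

Lemma costate_diag : costate P w w = lam.
Proof.
apply/subr0_eq; apply: dot_nondeg => y; rewrite dotC.
have [v [v1 v2]] := lin_residual_surj y 0.
rewrite -v1 costate_gap big1 ?oppr0 // => i _.
by rewrite fb_err_diag mulmx0 linear0.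
Qed.

Lemma R_MS_fix : R_MS P w w = 0.
Proof.
apply/eqP; rewrite col_mx_eq0; apply/andP; split; apply/eqP.
  by rewrite Fhat_diag; case: kkt.
by apply: ublkP => i; rewrite ublk_G fb_err_diag oppr0 linear0.
Qed.

Lemma R_DDP_fix : R_DDP P w w = 0.
Proof. by have := R_MS_fix; rewrite /R_MS Fhat_diag. Qed.

Lemma derive_V_null v : lin_dyn P w v = 0 -> 'D_v (V P) w = 0.
Proof. by move=> v0; have := KKT_derive v; rewrite derive_F_lin v0 linear0 addr0. Qed.

(* With exact linearized dynamics the Riccati identity completes the squares. *)
Lemma hess_V_null v d : lin_dyn P w v = 0 -> lin_dyn P w d = 0 ->
  'D_d ('D_v (V P)) w =
  \sum_i dot (ublk i (lin_fb P w v)) (ric_H P w i (ric P w i.+1) *m ublk i (lin_fb P w d)).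
Proof.
move=> v0 d0.
have := kkt_identity sm rr (d + w) v.
rewrite addrK derive_V_null // add0r derive_F_lin v0 linear0 addr0 => ->.
have wd : d + w = 1 *: d + w by rewrite scale1r.
rewrite ric_remainder_exact => [|i].
  rewrite -sumrN; apply: eq_bigr => i _.
  have -> : fb_err P w (d + w) i = - ublk i (lin_fb P w d).
    apply: oppr_inj; rewrite -ublk_G wd G_affine scale1r linearD /= ublk_G fb_err_diag.
    by rewrite oppr0 add0r opprK.
  by rewrite mulmxN linearN opprK.
apply: oppr_inj; rewrite -xblk_Fhat wd Fhat_affine d0 scaler0 addr0.
by rewrite xblk_Fhat dyn_err_diag.
Qed.

(** The weights H_i are only known to be invertible, so d is not tested against itself but against a
    v whose feedback residual is H_i times that of d, which gives a sum of squares. *)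
Lemma hess_V_nondeg d : lin_dyn P w d = 0 ->
  (forall v, lin_dyn P w v = 0 -> 'D_d ('D_v (V P)) w = 0) -> d = 0.
Proof.
move=> d0 h; apply: (lin_residual_inj d0); apply: ublkP => i; rewrite linear0.
have [v [v1 v2]] := lin_residual_surj 0
  (@mxcol R N (fun=> nu) 1 (fun i => ric_H P w i (ric P w i.+1) *m ublk i (lin_fb P w d))).
have := h v v1; rewrite hess_V_null // v2 => /eqP.
under eq_bigr do rewrite ublk_mxcol.
rewrite psumr_eq0 => [/allP hh|j _]; last exact: dot_self_ge0.
have /eqP/dot_self_eq0 E := hh i (mem_index_enum i).
by rewrite -(mulKmx (rr i) (ublk i (lin_fb P w d))) E mulmx0.
Qed.

Lemma hess_V_ge0 v : convex_costs P -> 0 <= 'D_v ('D_v (V P)) w.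
Proof.
move=> [cl cN]; rewrite derive2_V // addr_ge0 //.
  apply: sumr_ge0 => i _; rewrite cost_hess_dot //.
  by apply: convex_derive2_ge0; [exact: cl | exact: stage_cost_C2].
have -> : dot (st v ord_max) (term_P P w *m st v ord_max) =
   'D_(st v ord_max) ('D_(st v ord_max) (fcost P)) (st w ord_max).
  by rewrite -hess_mul /dot ?mulmxA //; exact: fcost_C2.
by apply: convex_derive2_ge0; [exact: cN | exact: fcost_C2].
Qed.

End kkt_point.

(** * The linearized iteration *)

Lemma cvg_lin_mul (R : realType) (T : Type) (Fl : set_system T) {FF : Filter Fl}
    (N nx nu : nat) (P : ocp R N nx nu)
    (g : T -> 'cV[R]_(\sum_(i < N.+1) nx + \sum_(i < N) nu)) w i
    (a : 'cV[R]_nx) (b : 'cV[R]_nu) :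
  g @ Fl --> w -> smooth_data P w ->
  (fun t => lin_A P (g t) i *m a + lin_B P (g t) i *m b) @ Fl -->
  lin_A P w i *m a + lin_B P w i *m b.
Proof.
move=> gw sm; apply: cvgD.
  by apply: cvg_mulmx; [exact: (cvg_lin_A gw sm) | exact: cvg_cst].
by apply: cvg_mulmx; [exact: (cvg_lin_B gw sm) | exact: cvg_cst].
Qed.

Lemma cvg_stage_remainder (R : realType) (T : Type) (Fl : set_system T) {FF : Filter Fl}
    (a b : nat) (A Pm : T -> 'M[R]_a) (B : T -> 'M[R]_(a, b)) (K : T -> 'M[R]_(b, a))
    (H : T -> 'M[R]_b) (e : T -> 'cV[R]_a) (d : T -> 'cV[R]_b)
    (A0 P0 : 'M[R]_a) (B0 : 'M[R]_(a, b)) (K0 : 'M[R]_(b, a)) (H0 : 'M[R]_b)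
    (e0 : 'cV[R]_a) (d0 : 'cV[R]_b) (vx : 'cV[R]_a) (vu : 'cV[R]_b) :
  A @ Fl --> A0 -> B @ Fl --> B0 -> K @ Fl --> K0 -> H @ Fl --> H0 -> Pm @ Fl --> P0 ->
  e @ Fl --> e0 -> d @ Fl --> d0 ->
  (fun t => dot vx ((A t)^T *m (Pm t *m e t) - (K t)^T *m (H t *m d t)) +
            dot vu (H t *m d t + (B t)^T *m (Pm t *m e t))) @ Fl -->
  dot vx (A0^T *m (P0 *m e0) - K0^T *m (H0 *m d0)) +
  dot vu (H0 *m d0 + B0^T *m (P0 *m e0)).
Proof.
move=> cA cB cK cH cP ce cd.
have cHd : (fun t => H t *m d t) @ Fl --> H0 *m d0 by exact: cvg_mulmx.
have cPe : (fun t => Pm t *m e t) @ Fl --> P0 *m e0 by exact: cvg_mulmx.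
have cAT : (fun t => (A t)^T) @ Fl --> A0^T by exact: cvg_trmx.
have cBT : (fun t => (B t)^T) @ Fl --> B0^T by exact: cvg_trmx.
have cKT : (fun t => (K t)^T) @ Fl --> K0^T by exact: cvg_trmx.
apply: cvgD; apply: cvg_dot; try exact: cvg_cst.
  by apply: cvgB; [exact: (cvg_mulmx cAT cPe) | exact: (cvg_mulmx cKT cHd)].
by apply: cvgD; [exact: cHd | exact: (cvg_mulmx cBT cPe)].
Qed.

Section linearized_iteration.
Variables (R : realType) (N nx nu : nat) (P : ocp R N nx nu).
Notation xvec := 'cV[R]_(\sum_(i < N.+1) nx).
Notation uvec := 'cV[R]_(\sum_(i < N) nu).
Notation wvec := 'cV[R]_(\sum_(i < N.+1) nx + \sum_(i < N) nu).
Variables (w : wvec) (lam : xvec).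
Hypothesis sm : smooth_data P w.
Hypothesis rr : riccati_regular P w.
Hypothesis kkt : KKT P w lam.
Hypothesis dMS : differentiable (fun q : wvec * wvec => R_MS P q.1 q.2) (w, w).

Lemma Fhat_base_increment h i t :
  xblk (nxt i) (Fhat P (t *: h + w) w) - xblk (nxt i) (Fhat P w w) =
  on_stack (dyn P i) (stage i (t *: h + w)) - on_stack (dyn P i) (stage i w) -
  t *: (lin_A P (t *: h + w) i *m st h (cur i) + lin_B P (t *: h + w) i *m ct h i).
Proof.
have fE z : on_stack (dyn P i) (stage i z) = lin_f P z i.
  by rewrite /on_stack /stage col_mxKu col_mxKd.
rewrite Fhat_diag !xblk_stackS !fE -[dyn P i _ _]/(lin_f P w i).
have -> : st w (cur i) - st (t *: h + w) (cur i) = - (t *: st h (cur i)).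
  by rewrite st_lin opprD addrCA subrr addr0.
have -> : ct w i - ct (t *: h + w) i = - (t *: ct h i).
  by rewrite ct_lin opprD addrCA subrr addr0.
rewrite !mulmxN -!scalemxAr.
move: (lin_f P w i) (lin_f P _ i) (st w (nxt i)) => a b c.
move: (lin_A P _ i *m _) (lin_B P _ i *m _) => e f.
by apply/matrixP => r s; rewrite !mxE; ring.
Qed.

(** Moving the base by t h changes the linearization at w by f(w + t h) - f(w) minus t times the
    Jacobian at the moved base. This is o(t) by continuity of the Jacobian. *)
Lemma derive_Fhat_base h : 'D_h (fun wb => Fhat P wb w) w = 0.
Proof.
have dR := differentiable_pair_r dMS.
have E : 'D_h (fun wb => Fhat P wb w) w = usubmx ('D_h (R_MS P w) w).
  rewrite (derive_usubmx dR) (_ : (fun q => usubmx (R_MS P w q)) = fun wb => Fhat P wb w) //.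
  by apply/funext => wb; rewrite /R_MS col_mxKu.
have dF : differentiable (fun wb => Fhat P wb w) w.
  have -> : (fun wb => Fhat P wb w) = usubmx \o R_MS P w.
    by apply/funext => wb; rewrite /= col_mxKu.
  apply: differentiable_comp => //.
  exact/linear_differentiable/mx_linear_continuous.
have xD k : xblk k ('D_h (fun wb => Fhat P wb w) w) = 'D_h (xblk k \o fun wb => Fhat P wb w) w.
  by rewrite (derive_linear_comp _ _ dF) //; exact: mx_linear_continuous.
apply: xblkP; apply: ord_cases => [|i]; rewrite xD linear0.
  have -> : xblk ord0 \o (fun wb => Fhat P wb w) = cst (xinit P - st w ord0).
    by apply/funext => wb; rewrite /= xblk_stack0.
  by rewrite derive_cst.
apply: derive_limit.
pose f := on_stack (dyn P i) \o @stage R N nx nu i.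
have df : differentiable f w.
  apply: differentiable_comp_linear; first exact: stage_continuous.
  exact: C2_near_diff (stage_dyn_C2 sm i).
have Df : 'D_h f w = lin_A P w i *m st h (cur i) + lin_B P w i *m ct h i.
  by rewrite (lin_mul sm) derive_comp_linear.
pose q t := t^-1 *: (f (t *: h + w) - f w) -
  (lin_A P (t *: h + w) i *m st h (cur i) + lin_B P (t *: h + w) i *m ct h i).
have q0 : q @ 0^' --> (0 : 'cV[R]_nx).
  rewrite -(subrr ('D_h f w)); apply: cvgB.
    exact: derive_cvg (diff_derivable df).
  by rewrite Df; exact: cvg_lin_mul (@line_cvg _ _ w h) sm.
apply: (cvg_near_eq (g := q) erefl _ q0).
have t0 : \forall t \near (0 : R)^', t != 0 by exact: nbhs_dnbhs_neq.
apply: filterS t0 => t t0; rewrite /q /=.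
by rewrite Fhat_base_increment scalerBr scalerA mulVf // scale1r.
Qed.

(** The hypothesis is the vanishing of the joint derivative in the direction (j, h), and the
    residual is zero at the fixed point. Both kinds of defect are blocks of this residual up to
    sign. *)
Lemma residual_along_curve h j :
  'D_j (R_MS P ^~ w) w + 'D_h (R_MS P w) w = 0 ->
  (fun t => t^-1 *: R_MS P (t *: j + w) (t *: h + w)) @ 0^' --> (0 : wvec).
Proof.
move=> E; have := derive_cvg (diff_derivable (v := (j, h)) dMS).
rewrite (derive_pair dMS) E; apply: cvg_near_eq => //.
apply: filterE => t; congr (_ *: _).
by rewrite /= (R_MS_fix sm rr kkt dMS) subr0.
Qed.

Lemma dyn_err_along_curve h j i :
  'D_j (R_MS P ^~ w) w + 'D_h (R_MS P w) w = 0 ->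
  (fun t => t^-1 *: dyn_err P (t *: h + w) (t *: j + w) i) @ 0^' --> (0 : 'cV[R]_nx).
Proof.
move=> E; have c0 := residual_along_curve E.
pose L (x : wvec) : 'cV[R]_nx := - stl (nxt i) x.
have cL : {for 0, continuous L}.
  by apply: continuousN; exact: stl_continuous.
have E0 : (0 : 'cV[R]_nx) = L 0 by rewrite /L linear0 oppr0.
apply: (cvg_near_eq (g := fun t => L (t^-1 *: R_MS P (t *: j + w) (t *: h + w))) E0).
  apply: filterE => t; rewrite /L linearZ /= -scalerN; congr (_ *: _).
  by rewrite -[dyn_err _ _ _ _]opprK -xblk_Fhat /stl /st /R_MS col_mxKu.
by apply: continuous_cvg; [exact: cL | exact: c0].
Qed.

Lemma fb_err_along_curve h j i :
  'D_j (R_MS P ^~ w) w + 'D_h (R_MS P w) w = 0 ->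
  (fun t => t^-1 *: fb_err P (t *: h + w) (t *: j + w) i) @ 0^' --> (0 : 'cV[R]_nu).
Proof.
move=> E; have c0 := residual_along_curve E.
pose L (x : wvec) : 'cV[R]_nu := - ctl i x.
have cL : {for 0, continuous L}.
  by apply: continuousN; exact: mx_linear_continuous.
have E0 : (0 : 'cV[R]_nu) = L 0 by rewrite /L linear0 oppr0.
apply: (cvg_near_eq (g := fun t => L (t^-1 *: R_MS P (t *: j + w) (t *: h + w))) E0).
  apply: filterE => t; rewrite /L linearZ /= -scalerN; congr (_ *: _).
  by rewrite -[fb_err _ _ _ _]opprK -ublk_G /ctl /ct /R_MS col_mxKd.
by apply: continuous_cvg; [exact: cL | exact: c0].
Qed.

Lemma remainder_along_curve h j v :
  'D_j (R_MS P ^~ w) w + 'D_h (R_MS P w) w = 0 ->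
  (fun t => t^-1 * ric_remainder P (t *: h + w) (t *: j + w) v) @ 0^' --> (0 : R).
Proof.
move=> E; pose g t := t *: h + w.
have gw : g @ 0^' --> w by exact: line_cvg.
(* The factor 1/t is attached to the defects, which then tend to 0 while all their coefficients
   converge. *)
pose rem t := \sum_(i < N) (dot (st v (cur i))
       ((lin_A P (g t) i)^T *m ((ric P (g t) i.+1).1 *m (t^-1 *: dyn_err P (g t) (t *: j + w) i)) -
        (fb_K P (g t) i)^T *m (ric_H P (g t) i (ric P (g t) i.+1) *m
           (t^-1 *: fb_err P (g t) (t *: j + w) i))) +
     dot (ct v i)
       (ric_H P (g t) i (ric P (g t) i.+1) *m (t^-1 *: fb_err P (g t) (t *: j + w) i) +
        (lin_B P (g t) i)^T *m ((ric P (g t) i.+1).1 *m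
           (t^-1 *: dyn_err P (g t) (t *: j + w) i)))).
have E0 : (0 : R) = \sum_(i < N) (dot (st v (cur i))
       ((lin_A P w i)^T *m ((ric P w i.+1).1 *m 0) -
        (fb_K P w i)^T *m (ric_H P w i (ric P w i.+1) *m 0)) +
     dot (ct v i)
       (ric_H P w i (ric P w i.+1) *m 0 +
        (lin_B P w i)^T *m ((ric P w i.+1).1 *m 0))).
  by rewrite big1 // => i _; rewrite !mulmx0 subr0 addr0 !linear0 addr0.
apply: (cvg_near_eq (g := rem) E0).
  apply: filterE => t; rewrite /rem /ric_remainder mulr_sumr; apply: eq_bigr => i _.
  by rewrite -!scalemxAr -scalerBr -scalerDr !dotZr mulrDr.
apply: cvg_sumr => i.
have [cP _] := cvg_ric gw sm rr (ltn_ord i).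
apply: cvg_stage_remainder.
- exact: (cvg_lin_A gw sm).
- exact: (cvg_lin_B gw sm).
- exact: (cvg_fb_K gw sm rr).
- exact: (cvg_stage_H gw sm rr).
- exact: cP.
- exact: dyn_err_along_curve i E.
- exact: fb_err_along_curve i E.
Qed.

(** The Riccati identity at base w + t h and trajectory w + t j, divided by t. As v is a null
    direction, the first derivatives of V and F along v vanish at w, so those at the moved base
    become difference quotients. In the limit the second derivatives of V in the directions h and j
    - h add up to the one in the direction j. *)
Lemma rate_stationarity h j v : lin_dyn P w v = 0 ->
  'D_j (R_MS P ^~ w) w + 'D_h (R_MS P w) w = 0 ->
  'D_j ('D_v (V P)) w + dot lam ('D_h ('D_v (F P)) w) = 0.
Proof.
move=> v0 E; pose g t := t *: h + w; pose z t := t *: j + w.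
have gw : g @ 0^' --> w by exact: line_cvg.
have zw : z @ 0^' --> w by exact: line_cvg.
have V2 := V_C2 sm; have F2 := F_C2 sm.
have cD : {for w, continuous ('D_(j - h) ('D_v (V P)))} by exact: C2_near_continuous.
have DV0 := derive_V_null sm kkt v0.
have DF0 : 'D_v (F P) w = 0 by rewrite derive_F_lin.
pose lhs t := t^-1 *: ('D_v (V P) (g t) - 'D_v (V P) w) + 'D_(j - h) ('D_v (V P)) (g t) +
  dot (costate P (g t) (z t)) (t^-1 *: ('D_v (F P) (g t) - 'D_v (F P) w)).
have c1 : lhs @ 0^' --> 'D_h ('D_v (V P)) w + 'D_(j - h) ('D_v (V P)) w +
    dot lam ('D_h ('D_v (F P)) w).
  apply: cvgD; first apply: cvgD.
  - exact: derive_cvg (diff_derivable (C2_near_derive_diff v V2)).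
  - exact: (line_cvg_comp h cD).
  - apply: cvg_dot; last exact: derive_cvg (diff_derivable (C2_near_derive_diff v F2)).
    by rewrite -(costate_diag sm rr kkt dMS); exact: cvg_costate.
have c2 : lhs @ 0^' --> (0 : R).
  apply: (cvg_near_eq erefl _ (remainder_along_curve v E)).
  have t0 : \forall t \near (0 : R)^', t != 0 by exact: nbhs_dnbhs_neq.
  apply: filterS3 t0 (smooth_along gw sm) (regular_along gw sm rr) => t t0 st rt.
  rewrite -(kkt_identity st rt) /lhs DV0 DF0 !subr0.
  have -> : t *: j + w - (t *: h + w) = t *: (j - h).
    by rewrite opprD addrACA subrr addr0 scalerBr.
  have -> : 'D_(t *: (j - h)) ('D_v (V P)) (t *: h + w) =
      t * 'D_(j - h) ('D_v (V P)) (t *: h + w).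
    have dD := C2_near_derive_diff v (V_C2 st).
    by rewrite !(deriveE _ dD) linearZ.
  rewrite dotZr !mulrDr mulKf //.
have := cvg_unique (@norm_hausdorff _ _) c1 c2.
have dD := C2_near_derive_diff v V2.
rewrite !(deriveE _ dD) linearB /=.
move: ('d _ w j) ('d _ w h) (dot _ _) => a b c; move=> e; rewrite -e; ring.
Qed.

End linearized_iteration.

(** * Contraction rates *)

Section null_space.
Variable R : realType.

Lemma mulmx_ext m n (A B : 'M[R]_(m, n)) : (forall h : 'cV[R]_n, A *m h = B *m h) -> A = B.
Proof.
move=> h; apply/matrixP => i k; have := h (delta_mx k 0); rewrite -!colE.
by move/matrixP/(_ i 0); rewrite !mxE.
Qed.

Section basis.
Variables (m n d : nat) (A : 'M[R]_(m, n)) (Z : 'M[R]_(n, d)).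
Hypothesis basis : null_space_basis A Z.

Lemma null_basis_mul (g : 'cV[R]_d) : A *m (Z *m g) = 0.
Proof.
have /andP[_ /andP[/sub_kermxP AZ _]] := basis.
by rewrite mulmxA -[A *m Z]trmxK trmx_mul AZ trmx0 mul0mx.
Qed.

Lemma null_basis_span (v : 'cV[R]_n) : A *m v = 0 -> exists g, v = Z *m g.
Proof.
move=> Av; have /andP[_ /andP[_ kZ]] := basis.
have vk : (v^T <= kermx A^T)%MS by apply/sub_kermxP; rewrite -trmx_mul Av trmx0.
have /submxP[D E] := submx_trans vk kZ.
by exists D^T; rewrite -[v]trmxK E trmx_mul trmxK.
Qed.

Lemma null_basis_inj (g : 'cV[R]_d) : Z *m g = 0 -> g = 0.
Proof.
move=> Zg; have /andP[rf _] := basis.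
rewrite -[g]trmxK; suff -> : g^T = 0 by rewrite trmx0.
by apply: (row_free_inj rf); rewrite /= mul0mx -trmx_mul Zg trmx0.
Qed.

End basis.
End null_space.

Section contraction.
Variables (R : realType) (N nx nu : nat) (P : ocp R N nx nu).
Notation xvec := 'cV[R]_(\sum_(i < N.+1) nx).
Notation uvec := 'cV[R]_(\sum_(i < N) nu).
Notation wvec := 'cV[R]_(\sum_(i < N.+1) nx + \sum_(i < N) nu).
Notation yvec := 'cV[R]_(\sum_(i < N.+1) nx +
                         (\sum_(i < N.+1) nx + \sum_(i < N) nu)).

Variables (w : wvec) (lam : xvec).
Hypothesis sm : smooth_data P w.
Hypothesis rr : riccati_regular P w.
Hypothesis kkt : KKT P w lam.
Hypothesis dMS : differentiable (fun q : wvec * wvec => R_MS P q.1 q.2) (w, w).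

Lemma MS_well_defined : well_defined_at (R_MS P) (Pi_MS P) w.
Proof.
apply: well_definedP.
- exact: MS_unique.
- exact: R_MS_fix sm rr kkt dMS.
- exact: differentiable_pair_l dMS.
move=> v; rewrite derive_R_MS => /eqP; rewrite col_mx_eq0 => /andP[/eqP h1 /eqP h2].
exact: lin_residual_inj h1 h2.
Qed.

Lemma MS_unit : jac (R_MS P ^~ w) w \in unitmx.
Proof. by have [] := MS_well_defined. Qed.

(** By [derive_Fhat_base] the base point enters only the feedback block to first order, so the rate
    matrix maps into the null space of the constraint Jacobian. *)
Lemma MS_rate_spec h :
  lin_dyn P w (rate_matrix (R_MS P) w *m h) = 0 /\
  lin_fb P w (rate_matrix (R_MS P) w *m h) + dsubmx ('D_h (R_MS P w) w) = 0.
Proof.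
have /(rate_matrix_mul h _ dMS MS_unit) := erefl (rate_matrix (R_MS P) w *m h).
have dR := differentiable_pair_r dMS.
have us : usubmx ('D_h (R_MS P w) w) = 0.
  rewrite (derive_usubmx dR) -(derive_Fhat_base sm dMS h).
  by congr ('D_h _ w); apply/funext => wb; rewrite /R_MS col_mxKu.
rewrite derive_R_MS -{1}['D_h (R_MS P w) w]vsubmxK us add_col_mx addr0 => /eqP.
by rewrite col_mx_eq0 => /andP[/eqP -> /eqP ->].
Qed.

Section DDP.
Hypothesis dDDP : differentiable (fun q : wvec * wvec => R_DDP P q.1 q.2) (w, w).

Lemma derive_R_DDP v : 'D_v (R_DDP P ^~ w) w = col_mx (lin_dyn P w v) (lin_fb P w v).
Proof.
have dR := differentiable_pair_l dDDP.
rewrite -['D_v _ w]vsubmxK (derive_usubmx dR) (derive_dsubmx dR); congr col_mx.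
  rewrite -(derive_F_lin sm); congr ('D_v _ w).
  by apply/funext => z; rewrite /R_DDP col_mxKu.
rewrite -(derive_G P w v w); congr ('D_v _ w).
by apply/funext => z; rewrite /R_DDP col_mxKd.
Qed.

Lemma DDP_well_defined : well_defined_at (R_DDP P) (Pi_DDP P) w.
Proof.
apply: well_definedP.
- exact: DDP_unique.
- exact: R_DDP_fix sm rr kkt dMS.
- exact: differentiable_pair_l dDDP.
move=> v; rewrite derive_R_DDP => /eqP; rewrite col_mx_eq0 => /andP[/eqP h1 /eqP h2].
exact: lin_residual_inj h1 h2.
Qed.

Lemma DDP_rate : rate_matrix (R_DDP P) w = rate_matrix (R_MS P) w.
Proof.
apply: mulmx_ext => h; apply/rate_matrix_mul => //; first by have [] := DDP_well_defined.
have [j1 j2] := MS_rate_spec h.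
have dR := differentiable_pair_r dDDP; have dR' := differentiable_pair_r dMS.
rewrite derive_R_DDP -['D_h (R_DDP P w) w]vsubmxK add_col_mx j1 add0r.
have -> : usubmx ('D_h (R_DDP P w) w) = 0.
  rewrite (derive_usubmx dR).
  have -> : (fun q => usubmx (R_DDP P w q)) = cst (F P w).
    by apply/funext => z; rewrite /R_DDP col_mxKu.
  by rewrite derive_cst.
have -> : dsubmx ('D_h (R_DDP P w) w) = dsubmx ('D_h (R_MS P w) w).
  rewrite (derive_dsubmx dR) (derive_dsubmx dR'); congr ('D_h _ w).
  by apply/funext => z; rewrite /R_DDP /R_MS !col_mxKd.
by rewrite j2 col_mx0.
Qed.

End DDP.

Section SS.
Variable y : yvec.
Hypotheses (y_nomE : y_nom y = w) (y_hatE : y_hat y = w).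
Hypothesis dSS : differentiable (fun q : yvec * yvec => R_SS P q.1 q.2) (y, y).

Lemma y_nom_linear : linear (@y_nom R N nx nu).
Proof.
move=> a b c; rewrite /y_nom /y_x /y_u !linearP /=.
by rewrite scale_col_mx add_col_mx.
Qed.
HB.instance Definition _ := GRing.isLinear.Build R yvec wvec _ (@y_nom R N nx nu) y_nom_linear.

Lemma y_hat_linear : linear (@y_hat R N nx nu).
Proof. by move=> a b c; rewrite /y_hat linearP. Qed.
HB.instance Definition _ := GRing.isLinear.Build R yvec wvec _ (@y_hat R N nx nu) y_hat_linear.

Lemma derive_y_nom (W : normedModType R) (f : wvec -> W) p v :
  'D_v (f \o @y_nom R N nx nu) p = 'D_(y_nom v) f (y_nom p).
Proof. exact: derive_comp_linear. Qed.

Lemma derive_y_hat (W : normedModType R) (f : wvec -> W) p v :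
  'D_v (f \o @y_hat R N nx nu) p = 'D_(y_hat v) f (y_hat p).
Proof. exact: derive_comp_linear. Qed.

Lemma derive_R_SS v : 'D_v (R_SS P ^~ y) y =
  col_mx (lin_dyn P w (y_nom v)) (col_mx (lin_dyn P w (y_hat v)) (lin_fb P w (y_hat v))).
Proof.
have dR := differentiable_pair_l dSS.
rewrite -['D_v _ y]vsubmxK (derive_usubmx dR) (derive_dsubmx dR); congr col_mx.
  have -> : (fun q => usubmx (R_SS P q y)) = F P \o @y_nom R N nx nu.
    by apply/funext => z; rewrite R_SSE col_mxKu.
  by rewrite derive_y_nom y_nomE derive_F_lin.
have -> : (fun q => dsubmx (R_SS P q y)) = (R_MS P ^~ w) \o @y_hat R N nx nu.
  by apply/funext => z; rewrite R_SSE col_mxKd y_nomE.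
by rewrite derive_y_hat y_hatE derive_R_MS.
Qed.

Lemma derive_R_SS_base h : 'D_h (R_SS P y) y = col_mx 0 ('D_(y_nom h) (R_MS P w) w).
Proof.
have dR := differentiable_pair_r dSS.
rewrite -['D_h _ y]vsubmxK (derive_usubmx dR) (derive_dsubmx dR); congr col_mx.
  have -> : (fun q => usubmx (R_SS P y q)) = cst (F P w).
    by apply/funext => z; rewrite R_SSE col_mxKu y_nomE.
  by rewrite derive_cst.
have -> : (fun q => dsubmx (R_SS P y q)) = R_MS P w \o @y_nom R N nx nu.
  by apply/funext => z; rewrite R_SSE col_mxKd y_hatE.
by rewrite derive_y_nom y_nomE.
Qed.

Lemma SS_well_defined : well_defined_at (R_SS P) (Pi_SS P) y.
Proof.
apply: well_definedP.
- exact: SS_unique.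
- rewrite R_SSE y_nomE y_hatE (R_MS_fix sm rr kkt dMS).
  by have [-> _] := kkt; rewrite col_mx0.
- exact: differentiable_pair_l dSS.
move=> v; rewrite derive_R_SS => /eqP; rewrite !col_mx_eq0.
move=> /andP[/eqP h0 /andP[/eqP h1 /eqP h2]].
have vh := lin_residual_inj h1 h2.
(* The vanishing hatted part includes the common controls, so the nominal states follow a
   homogeneous open loop from 0. *)
have vn : y_nom v = 0.
  apply: (lin_dyn_control0 h0) => i; rewrite /ct /y_nom col_mxKd /y_u.
  by rewrite -[dsubmx v]/(y_hat v) vh linear0; exact: (linear0 (ublk i)).
rewrite -[v]vsubmxK -[dsubmx v]/(y_hat v) vh.
have -> : usubmx v = usubmx (y_nom v) by rewrite /y_nom col_mxKu.
by rewrite vn linear0 col_mx0.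
Qed.

Definition ss_restrict : 'M[R]_(\sum_(i < N.+1) nx + \sum_(i < N) nu,
    \sum_(i < N.+1) nx + (\sum_(i < N.+1) nx + \sum_(i < N) nu)) :=
  col_mx (row_mx 1%:M 0) (row_mx 0 (row_mx 0 1%:M)).
Definition ss_extend : 'M[R]_(\sum_(i < N.+1) nx + (\sum_(i < N.+1) nx + \sum_(i < N) nu),
    \sum_(i < N.+1) nx + \sum_(i < N) nu) :=
  col_mx (row_mx 1%:M 0) 1%:M.

Lemma ss_restrict_mul (v : yvec) : ss_restrict *m v = y_nom v.
Proof.
rewrite /ss_restrict /y_nom mul_col_mx; congr col_mx.
  by rewrite -[v in LHS]vsubmxK mul_row_col mul1mx mul0mx addr0.
rewrite -[v in LHS]vsubmxK mul_row_col mul0mx add0r.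
by rewrite -[dsubmx v in LHS]vsubmxK mul_row_col mul0mx mul1mx add0r.
Qed.

Lemma ss_extend_mul (v : wvec) : ss_extend *m v = col_mx (usubmx v) v.
Proof.
rewrite /ss_extend mul_col_mx mul1mx; congr col_mx.
by rewrite -[v in LHS]vsubmxK mul_row_col mul1mx mul0mx addr0.
Qed.

Lemma y_nom_extend (v : wvec) : y_nom (ss_extend *m v) = v.
Proof.
by rewrite ss_extend_mul /y_nom /y_x /y_u col_mxKu col_mxKd vsubmxK.
Qed.

Lemma y_hat_extend (v : wvec) : y_hat (ss_extend *m v) = v.
Proof. by rewrite ss_extend_mul /y_hat col_mxKd. Qed.

Lemma ss_restrictK : ss_restrict *m ss_extend = 1%:M.
Proof.
by apply: mulmx_ext => h; rewrite -mulmxA ss_restrict_mul y_nom_extend mul1mx.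
Qed.

(** The base enters [R_SS] only through [y_nom], whence the right factor. The multiple shooting
    response satisfies the linearized dynamics, so repeating its states also solves the nominal
    block, whence the left factor. *)
Lemma SS_rate : rate_matrix (R_SS P) y = ss_extend *m rate_matrix (R_MS P) w *m ss_restrict.
Proof.
apply: mulmx_ext => h; apply/rate_matrix_mul => //; first by have [] := SS_well_defined.
rewrite -!mulmxA ss_restrict_mul.
have [j1 _] := MS_rate_spec (y_nom h).
have /(rate_matrix_mul (y_nom h) _ dMS MS_unit) := erefl (rate_matrix (R_MS P) w *m y_nom h).
rewrite derive_R_SS derive_R_SS_base y_nom_extend y_hat_extend derive_R_MS j1 => E.
by rewrite add_col_mx addr0 E col_mx0.
Qed.

End SS.

(** * Reduction to the null space of the constraint Jacobian *)

Section reduced_problem.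
Variables (d : nat) (Z : 'M[R]_(\sum_(i < N.+1) nx + \sum_(i < N) nu, d)).
Hypothesis basis : null_space_basis (jac (F P) w) Z.
Hypothesis cvx : convex_costs P.

Local Notation M := (hess (V P) w).
Local Notation E := (hess (constraint_term P lam) w).
Local Notation Mt := (Z^T *m M *m Z).
Local Notation Et := (Z^T *m E *m Z).

Lemma constraint_term_C2 : C2_near (constraint_term P lam) w.
Proof.
have -> : constraint_term P lam = dot lam \o F P by [].
by apply: C2_near_linear_comp; [exact: dot_continuous | exact: F_C2].
Qed.

Lemma dot_M a b : dot a (M *m b) = 'D_b ('D_a (V P)) w.
Proof. by rewrite -(hess_mul _ _ (V_C2 sm)) /dot mulmxA. Qed.

Lemma dot_E a b : dot a (E *m b) = dot lam ('D_b ('D_a (F P)) w).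
Proof.
rewrite -(derive2_linear_comp _ _ (@dot_continuous R _ lam) (F_C2 sm)).
by rewrite -[RHS](hess_mul _ _ constraint_term_C2) /dot mulmxA.
Qed.

Lemma reduced_sym n (A : 'M[R]_n) (Y : 'M[R]_(n, d)) : A^T = A ->
  (Y^T *m A *m Y)^T = Y^T *m A *m Y.
Proof. by move=> sA; rewrite !trmx_mul trmxK sA mulmxA. Qed.

Lemma Mt_sym : Mt^T = Mt.
Proof. exact: reduced_sym (hess_sym (V_C2 sm)). Qed.

Lemma Et_sym : Et^T = Et.
Proof. exact: reduced_sym (hess_sym constraint_term_C2). Qed.

Lemma dot_reduced n (A : 'M[R]_n) (Y : 'M[R]_(n, d)) a b :
  dot a (Y^T *m A *m Y *m b) = dot (Y *m a) (A *m (Y *m b)).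
Proof. by rewrite -!mulmxA dot_trmx trmxK. Qed.

Lemma lin_dyn_null g : lin_dyn P w (Z *m g) = 0.
Proof.
rewrite -derive_F_lin // -jac_mul; last exact: C2_near_diff (F_C2 sm).
exact: null_basis_mul.
Qed.

Lemma lin_dyn_span v : lin_dyn P w v = 0 -> exists g, v = Z *m g.
Proof.
rewrite -derive_F_lin // -jac_mul; last exact: C2_near_diff (F_C2 sm).
exact: null_basis_span.
Qed.

Lemma qform_Mt g : qform Mt g = 'D_(Z *m g) ('D_(Z *m g) (V P)) w.
Proof. by rewrite qformE dot_reduced dot_M. Qed.

(** Convexity gives semidefiniteness. A vector where the form vanishes lies in the kernel of Mt, so
    Z g is annihilated against every null direction, and [hess_V_nondeg] applies. *)
Lemma Mt_pos g : g != 0 -> 0 < qform Mt g.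
Proof.
move=> g0; have pos v : 0 <= qform Mt v by rewrite qform_Mt; exact: hess_V_ge0.
rewrite lt_neqAle pos andbT eq_sym; apply: contra g0 => /eqP q0; apply/eqP.
have Mg := psd_kernel Mt_sym pos q0.
apply: (null_basis_inj basis).
apply: (hess_V_nondeg sm rr kkt dMS (lin_dyn_null g)) => v /lin_dyn_span[c ->].
by rewrite -dot_M -dot_reduced Mg linear0.
Qed.

Lemma Mt_unit : Mt \in unitmx.
Proof.
apply: mx_inj_unit => g Mg; apply/eqP; apply: contraT => /Mt_pos.
by rewrite qformE Mg linear0 ltxx.
Qed.

(** Writing J h = Z g and testing the stationarity relation with the directions Z c gives Mt g + Z^T
    E h = 0, which is solved for g. *)
Lemma MS_rate : rate_matrix (R_MS P) w = - (Z *m invmx Mt *m (Z^T *m E)).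
Proof.
apply: mulmx_ext => h.
have [j1 _] := MS_rate_spec h.
have /(rate_matrix_mul h _ dMS MS_unit) := erefl (rate_matrix (R_MS P) w *m h).
have [g gE] := lin_dyn_span j1; rewrite gE => stat.
have {}stat : Mt *m g + Z^T *m E *m h = 0.
  apply: dot_nondeg => c; rewrite linearD /= dot_reduced -[_ *m E *m h]mulmxA.
  rewrite [dot c (Z^T *m _)]dot_trmx trmxK dot_M dot_E.
  exact: (rate_stationarity sm rr kkt dMS (lin_dyn_null c) stat).
move/eqP: stat; rewrite addr_eq0 => /eqP stat.
rewrite -[g](mulKmx Mt_unit) stat.
by rewrite mulNmx !mulmxN !mulmxA.
Qed.

End reduced_problem.

End contraction.

Theorem theorem2 (R : realType) (N nx nu : nat) (hN : (1 <= N)%N) (hnu : (1 <= nu)%N)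
  (P : ocp R N nx nu)
  (x : 'cV[R]_(\sum_(i < N.+1) nx)) (u : 'cV[R]_(\sum_(i < N) nu))
  (lam : 'cV[R]_(\sum_(i < N.+1) nx))
  (d : nat) (Z : 'M[R]_(\sum_(i < N.+1) nx + \sum_(i < N) nu, d)) :
  let w := col_mx x u in
  let y := col_mx x (col_mx x u) in
  let M := hess (V P) w in
  let E := hess (constraint_term P lam) w in
  convex_costs P ->
  smooth_data P w ->
  smooth_residuals P w y ->
  riccati_regular P w ->
  KKT P w lam ->
  LICQ P w ->
  SOSC P w lam ->
  null_space_basis (jac (F P) w) Z ->
  [/\ well_defined_at (R_MS P) (Pi_MS P) w,
      well_defined_at (R_SS P) (Pi_SS P) y &
      well_defined_at (R_DDP P) (Pi_DDP P) w] /\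
  exists kappa : R,
    [/\ contraction_rate (R_MS P) w = kappa,
        contraction_rate (R_SS P) y = kappa,
        contraction_rate (R_DDP P) w = kappa,
        loewner_bounds (Z^T *m M *m Z) (Z^T *m E *m Z) kappa &
        lbound (loewner_bounds (Z^T *m M *m Z) (Z^T *m E *m Z)) kappa].
Proof.
move=> w y M E cvx sm [cMS cDDP cSS] rr kkt _ _ basis.
have dMS := C2_near_diff cMS; have dDDP := C2_near_diff cDDP; have dSS := C2_near_diff cSS.
have y_nomE : @y_nom R N nx nu y = w by rewrite /y_nom /y_x /y_u /y !col_mxKd col_mxKu.
have y_hatE : @y_hat R N nx nu y = w by rewrite /y_hat /y col_mxKd.
split.
  split; first exact: MS_well_defined sm rr kkt dMS.
    exact: (SS_well_defined sm rr kkt dMS y_nomE y_hatE dSS).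
  exact: DDP_well_defined sm rr kkt dMS dDDP.
have u0 : (0 < \sum_(i < N) nu)%N by rewrite sum_nat_const card_ord muln_gt0 hN.
have w0 : (0 < \sum_(i < N.+1) nx + \sum_(i < N) nu)%N by rewrite addn_gt0 u0 orbT.
have d0 : (0 < d)%N.
  rewrite lt0n; apply/eqP => d0.
  (* There is at least one control entry, so a null direction whose feedback residual is constantly
     1 cannot be zero; hence the null space is nontrivial. *)
  have [v [v1 v2]] := lin_residual_surj dMS 0 (const_mx 1).
  have [g vE] := lin_dyn_span sm basis v1.
  have v0 : v = 0.
    by rewrite vE; subst d; rewrite (flatmx0 g) mulmx0.
  have : lin_fb P w 0 = 0.
    by apply/umxcol_eq0 => i; rewrite st0 ct0 mulmx0 subr0.
  rewrite -v0 v2 => /matrixP/(_ (Ordinal u0) 0); rewrite !mxE => /eqP.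
  by rewrite oner_eq0.
have sM := Mt_sym sm Z; have sE := Et_sym lam sm Z.
have pM := Mt_pos sm rr kkt dMS basis cvx.
have [k [kb kmin [s [v [v0 s1 vE]]]]] := rayleigh_max d0 sM sE pM.
have rad : spectral_radius_is (rate_matrix (R_MS P) w) k.
  rewrite (MS_rate sm rr kkt dMS basis cvx).
  apply: (spectral_radius_generalized sM sE pM _ w0 _ _ v0 s1 vE).
  - exact/(loewner_boundsP _ sM sE).
  - exact: (Mt_unit sm rr kkt dMS basis cvx).
  - exact: erefl.
exists k; split=> //; rewrite /contraction_rate.
- exact: spectral_radiusE.
- rewrite (SS_rate sm rr kkt dMS y_nomE y_hatE dSS).
  by apply: spectral_radiusE; apply: spectral_radius_compression rad; exact: ss_restrictK.
- by rewrite (DDP_rate sm rr kkt dMS dDDP); exact: spectral_radiusE.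
Qed.
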